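(* Let $n\ge1$, let $D\subset\mathbb{R}^n$ be an open connected set, $\xi\in D$, and let $u,v$ be real-valued harmonic functions on $D$ such that $v$ is differentially subordinate to $u$ and $u,v$ are orthogonal. Then for $1\le p\le2$, $$\|v\|_{p,\infty}\le K_p\|u\|_p,\qquad K_p^p=\frac{1}{\Gamma(p+1)}\left(\frac{\pi}{2}\right)^{p-1}\frac{\sum_{k=0}^\infty (2k+1)^{-2}}{\sum_{k=0}^\infty (-1)^k(2k+1)^{-(p+1)}}.$$ The inequality is sharp (the constant $K_p$ cannot be replaced by a smaller one).
   Context: $v$ is differentially subordinate to $u$ if $|v(\xi)|\le|u(\xi)|$ and $|\nabla v(x)|\le|\nabla u(x)|$ for all $x\in D$; $u,v$ are orthogonal if $\nabla u(x)\cdot\nabla v(x)=0$ for all $x\in D$. For a bounded domain $D_0$ with $\xi\in D_0\subset\overline{D_0}\subset D$, let $\mu^\xi_{D_0}$ be the harmonic measure on $\partial D_0$ corresponding to $\xi$. Define $\|u\|_{p,\infty}=\sup_{\lambda>0}\sup_{D_0}[\lambda^p\mu^\xi_{D_0}(\{x\in\partial D_0:|u(x)|\ge\lambda\})]^{1/p}$ and $\|u\|_p=\sup_{D_0}[\int_{\partial D_0}|u(x)|^p\,d\mu^\xi_{D_0}(x)]^{1/p}$, the suprema over $D_0$ being over all such bounded subdomains. *)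

(* Defs.v *)
From HB Require Import structures.
From mathcomp Require Import all_boot all_order all_algebra.
From mathcomp Require Import all_classical all_reals all_analysis.
Set Implicit Arguments. Unset Strict Implicit. Unset Printing Implicit Defensive.
Import Order.TTheory GRing.Theory Num.Theory.
Import numFieldNormedType.Exports.
Local Open Scope classical_set_scope.
Local Open Scope ring_scope.

Section Defs.
Variables (R : realType) (n : nat).
Local Notation Rn := 'rV[R]_n.

Definition basis_vec (i : 'I_n) : Rn := delta_mx 0 i.

Definition partial (i : 'I_n) (f : Rn -> R) : Rn -> R :=
  fun x => 'D_(basis_vec i) f x.

Definition grad_norm2 (f : Rn -> R) (x : Rn) : R :=
  \sum_(i < n) (partial i f x) ^+ 2.
Definition grad_dot (f g : Rn -> R) (x : Rn) : R :=
  \sum_(i < n) partial i f x * partial i g x.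

Definition eball (c : Rn) (r : R) : set Rn :=
  [set y | \sum_(i < n) (y 0 i - c 0 i) ^+ 2 < r ^+ 2].
Definition ecball (c : Rn) (r : R) : set Rn :=
  [set y | \sum_(i < n) (y 0 i - c 0 i) ^+ 2 <= r ^+ 2].
Definition esphere (c : Rn) (r : R) : set Rn :=
  [set y | \sum_(i < n) (y 0 i - c 0 i) ^+ 2 = r ^+ 2].

Definition harmonic_on (U : set Rn) (f : Rn -> R) : Prop :=
  open U /\
  (forall x, U x -> differentiable f x /\
      forall i, differentiable (partial i f) x) /\
  (forall i j x, U x -> {for x, continuous (partial j (partial i f))}) /\
  (forall x, U x -> \sum_(i < n) partial i (partial i f) x = 0).

Definition domain (U : set Rn) : Prop := open U /\ connected U /\ U !=set0.

Definition bdry (U : set Rn) : set Rn := closure U `\` U.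

Definition lsc_on (U : set Rn) (s : Rn -> \bar R) : Prop :=
  forall x, U x -> forall a : \bar R, (a < s x)%E ->
    \forall y \near x, (a < s y)%E.

Definition superharmonic_on (U : set Rn) (s : Rn -> \bar R) : Prop :=
  (forall x, U x -> s x != -oo%E) /\ lsc_on U s /\
  forall (c : Rn) (r : R), 0 < r -> ecball c r `<=` U ->
    forall h : Rn -> R, {within ecball c r, continuous h} ->
      harmonic_on (eball c r) h ->
      (forall y, esphere c r y -> ((h y)%:E <= s y)%E) ->
      forall y, eball c r y -> ((h y)%:E <= s y)%E.

Definition perron_upper_class (U : set Rn) (f : Rn -> R) : set (Rn -> \bar R) :=
  [set s | superharmonic_on U s /\
     (exists M : R, forall x, U x -> (M%:E <= s x)%E) /\
     (forall y, bdry U y -> forall a : R, a < f y ->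
        \forall x \near y, U x -> (a%:E < s x)%E)].

Definition perron_upper (U : set Rn) (f : Rn -> R) (xi : Rn) : \bar R :=
  ereal_inf [set s xi | s in perron_upper_class U f].

Definition Rn_borel := g_sigma_algebraType (@open Rn).

(* mu is the harmonic measure of the bounded domain U at xi: a Borel measure
   carried by the boundary of U representing the PWB solution of the
   Dirichlet problem for continuous boundary data *)
Definition harmonic_measure (U : set Rn) (xi : Rn)
    (mu : {measure set Rn_borel -> \bar R}) : Prop :=
  mu (~` bdry U) = 0%E /\
  forall f : Rn -> R, continuous f ->
    (\int[mu]_(x in (setT : set Rn_borel)) (f x)%:E)%E = perron_upper U f xi.

Definition admissible (D : set Rn) (xi : Rn) (D0 : set Rn) : Prop :=
  domain D0 /\ bounded_set D0 /\ D0 xi /\ closure D0 `<=` D.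

Definition strong_norm (D : set Rn) (xi : Rn) (p : R) (u : Rn -> R) : \bar R :=
  ereal_sup
    ((fun mu : {measure set Rn_borel -> \bar R} =>
        ((\int[mu]_(x in (setT : set Rn_borel)) (`|u x| `^ p)%:E) `^ p^-1)%E)
     @` [set mu | exists D0, admissible D xi D0 /\ harmonic_measure D0 xi mu]).

Definition weak_norm (D : set Rn) (xi : Rn) (p : R) (u : Rn -> R) : \bar R :=
  ereal_sup
    ((fun t : R * (set Rn * {measure set Rn_borel -> \bar R}) =>
        (((t.1 `^ p)%:E * t.2.2 [set x | bdry t.2.1 x /\ (t.1 <= `|u x|)%R])
           `^ p^-1)%E)
     @` [set t | 0 < t.1 /\ admissible D xi t.2.1 /\
                  harmonic_measure t.2.1 xi t.2.2]).

End Defs.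

Definition Gamma (R : realType) (s : R) : R :=
  fine (\int[@lebesgue_measure R]_(t in `[0%R, +oo[%classic)
          ((t `^ (s - 1)) * expR (- t))%:E)%E.

Definition Kp_pow (R : realType) (p : R) : R :=
  (Gamma (p + 1))^-1 * (pi / 2) `^ (p - 1) *
  (limn (series (fun k : nat => (k.*2.+1%:R : R) ^- 2)) /
   limn (series (fun k : nat => (-1) ^+ k * (k.*2.+1%:R : R) `^ (- (p + 1))))).

Definition Kp (R : realType) (p : R) : R := Kp_pow p `^ p^-1.

(* Main.v *)
(* For [|y| < pi/2] let [W(x, y)] be the Poisson extension to the strip of the boundary values [|x|^p],
   let [W = |x|^p] outside the strip, and let [W0 = W(0, 0)]. Then [|x|^p <= W <= |x|^p + W0], and [W >= W0]
   where [|y| <= |x|]. If [v] is orthogonal and differentially subordinate to [u], then [W(u, v)] is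
   subharmonic: in the strip [W] is harmonic and convex in [x], and outside it is touched from below by
   functions of [x] alone. For [k = pi / (2 lambda)] this gives
     [W0 1_{|k v| >= pi/2} <= |k u|^p + (W0 - W(k u, k v))],
   and the harmonic measure integral of the bracket is at most [W0 - W(k u(xi), k v(xi)) <= 0]. Hence
   [lambda^p mu(|v| >= lambda)] is at most [((pi/2)^p / W0)] times the integral of [|u|^p]. Expanding
   [1 / cosh] in [W0 = (2/pi) int_0^oo s^p / cosh s ds], together with [sum (2k+1)^-2 = pi^2/8], shows that
   [(pi/2)^p / W0 = K_p^p].
   The inequality is sharp for the conformal map [u + i v] of the unit disc onto the strip: there [W(u, v)] is
   a harmonic majorant of [|u|^p], so [||u||_p^p <= W0], while the harmonic measure of the circle of radius
   [r] at its centre, which is the uniform measure, concentrates on [|v|] close to [pi/2] as [r] tends to 1. *)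
Require Import Defs.
From HB Require Import structures.
From mathcomp Require Import all_boot all_order all_algebra.
From mathcomp Require Import all_classical all_reals all_analysis.
From mathcomp.real_closed Require Import complex.
From mathcomp Require Import measurable_realfun zify ring lra.
Set Implicit Arguments. Unset Strict Implicit. Unset Printing Implicit Defensive.
Import Order.TTheory GRing.Theory Num.Theory.
Import numFieldNormedType.Exports.
Local Open Scope classical_set_scope.
Local Open Scope ring_scope.

(** * Second differences, powers and hyperbolic functions *)

(** The majorant need not be differentiable across the lines [|y| = pi/2], so subharmonicity is
    expressed by lower bounds on symmetric second differences along the axes. These suffice for the
    maximum principle, hence for comparison with Perron upper functions, through which harmonic
    measure is defined. The delicate inequality is [W >= W0] on the cone [|y| <= |x|]. Since [W] is
    even and, by convexity in [x] and harmonicity, concave in [y], it reduces to the diagonal. There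
    two symmetric densities with the same mass and the same second moment are compared; their
    difference has the sign of a quadratic in [sinh(s)^2] with negative leading coefficient, and a
    suitable chord of the concave function [Y^(p/2)] of [Y = s^2] changes sides exactly where that
    quadratic changes sign. This is where [p <= 2] matters most. For sharpness the harmonic measure
    of a disc must be computed: Fejer means of the boundary data extend to harmonic polynomials,
    which squeeze the Perron solution at the centre. *)

Definition peano {R : realType} (f : R -> R) (b c : R) : Prop :=
 forall eta : R, 0 < eta -> exists2 rho : R, 0 < rho &
    forall t : R, `|t| <= rho -> `|f t - f 0 - b * t - c * t ^+ 2| <= eta * t ^+ 2.

(** The lower symmetric second derivative at 0 is at least [c]. Being one-sided, the condition
    passes from a function to any larger one that agrees with it at 0. *)
Definition sdge {R : realType} (f : R -> R) (c : R) : Prop :=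
 forall eta : R, 0 < eta -> exists2 rho : R, 0 < rho &
    forall t : R, 0 < t <= rho -> (c - eta) * t ^+ 2 <= f t + f (- t) - 2 * f 0.

Section second_order.
Context {R : realType}.
Implicit Types (f g : R -> R) (a b c : R).

Lemma norm_MVT (g dg : R -> R) (rho t K : R) :
  (forall s : R, `|s| < rho -> is_derive s 1 g (dg s)) -> `|t| < rho ->
  (forall s, `|s| <= `|t| -> `|dg s| <= K) ->
  `|g t - g 0| <= K * `|t|.
Proof.
move=> gd trho dgK.
have cg (a b : R) : - rho < a -> b < rho -> {within `[a, b], continuous g}.
  move=> ra rb; apply: derivable_within_continuous => s.
  rewrite in_itv/= => /andP[sa sb].
  have [] // := gd s; by rewrite ltr_norml; apply/andP; split; lra.
have [t0|t0] := leP 0 t.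
  have r0 : - rho < 0 by have := normr_ge0 t; lra.
  have tr : t < rho by move: trho; rewrite ger0_norm.
  have [|s] := @MVT_segment R g dg 0 t t0 _ (cg 0 t r0 tr).
    move=> s; rewrite in_itv/= => /andP[s0 st]; apply: gd.
    by rewrite ger0_norm ?(ltW s0)//; exact: lt_trans st _.
  rewrite in_itv/= => /andP[s0 st] ->; rewrite normrM subr0.
  by apply: ler_wpM2r => //; apply: dgK; rewrite !ger0_norm.
have r0 : 0 < rho by have := normr_ge0 t; lra.
have tr : - rho < t by move: trho; rewrite ltr0_norm//; lra.
have [|s] := @MVT_segment R g dg t 0 (ltW t0) _ (cg t 0 tr r0).
  move=> s; rewrite in_itv/= => /andP[s0 st]; apply: gd.
  by rewrite ltr0_norm//; lra.
rewrite in_itv/= => /andP[s0 st] E; rewrite distrC E normrM sub0r normrN.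
by apply: ler_wpM2r => //; apply: dgK; rewrite !ler0_norm// ?(ltW t0)// lerN2.
Qed.

Lemma is_derive0_near (f : R -> R) (c : R) : is_derive (0:R) 1 f c ->
 forall eta : R, 0 < eta -> exists2 rho : R, 0 < rho &
    forall t : R, `|t| <= rho -> `|f t - f 0 - c * t| <= eta * `|t|.
Proof.
move=> [fd fc] eta e0.
have : (h^-1 *: ((f \o shift (0:R)) (h *: (1:R)) - f 0)) @[h --> (0:R)^'] --> c.
  by rewrite -fc; exact: fd.
move/cvgrPdist_le => /(_ _ e0).
rewrite /dnbhs /within /= nearE => -[rho /= r0 H].
exists (rho / 2); first by rewrite divr_gt0.
move=> t tr; have [->|tn0] := eqVneq t 0; first by rewrite mulr0 subr0 subrr !normr0 mulr0.
have := H t; rewrite /ball_/= sub0r normrN => /(_ _ tn0).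
have -> : `|t| < rho by lra.
move=> /(_ isT); rewrite addr0 /GRing.scale/= mulr1 => K.
have -> : f t - f 0 - c * t = - (t * (c - t^-1 * (f t - f 0))) by field.
by rewrite normrN normrM mulrC ler_wpM2r.
Qed.

(** Taylor's formula with Peano remainder: [f1] is known to be differentiable only at 0, so the mean
    value inequality is applied to [f] minus its quadratic part. *)
Lemma peano_derive (f f1 : R -> R) (rho c : R) : 0 < rho ->
  (forall s : R, `|s| < rho -> is_derive s 1 f (f1 s)) -> is_derive (0:R) 1 f1 c ->
  peano f (f1 0) (c / 2).
Proof.
move=> r0 fd f1d eta e0.
have [r1 r10 H] := is_derive0_near f1d e0.
exists (Num.min r1 (rho / 2)); first by rewrite lt_min r10 divr_gt0.
move=> t; rewrite le_min => /andP[tr1 tr].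
pose g (s : R) := f s - f1 0 * s - c / 2 * s ^+ 2.
have gd (s : R) : `|s| < rho -> is_derive s 1 g (f1 s - f1 0 - c * s).
  move=> /fd fds; rewrite /g; apply: is_derive_eq.
  by rewrite /GRing.scale/=; field.
have trho : `|t| < rho by lra.
have := @norm_MVT g _ rho t (eta * `|t|) gd trho.
have -> : g t - g 0 = f t - f 0 - f1 0 * t - c / 2 * t ^+ 2 by rewrite /g; ring.
have -> : eta * `|t| * `|t| = eta * t ^+ 2 by rewrite -mulrA -expr2 real_normK ?num_real.
apply => s st; apply: le_trans (H s _) _; first exact: le_trans st _.
by rewrite ler_wpM2l// ltW.
Qed.

Lemma peano_sdge f b c : peano f b c -> sdge f (2 * c).
Proof.
move=> fp eta e0; have e20 : 0 < eta / 2 by lra.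
have [rho r0 H] := fp _ e20; exists rho => // t /andP[t0 tr].
have := H t; rewrite gtr0_norm// => /(_ tr).
have := H (- t); rewrite normrN gtr0_norm// => /(_ tr).
rewrite !ler_norml => /andP[]; rewrite sqrrN => ? ? /andP[? ?]; nra.
Qed.

Lemma sdgeD f g a b : sdge f a -> sdge g b -> sdge (fun t => f t + g t) (a + b).
Proof.
move=> fa gb eta e0; have e20 : 0 < eta / 2 by lra.
have [r1 r10 H1] := fa _ e20; have [r2 r20 H2] := gb _ e20.
exists (Num.min r1 r2); first by rewrite lt_min r10.
move=> t /andP[t0]; rewrite le_min => /andP[t1 t2].
have := H1 t; have := H2 t; rewrite t0 t1 t2 => /(_ isT) ? /(_ isT) ?; nra.
Qed.

Lemma sdge_weaken f a b : b <= a -> sdge f a -> sdge f b.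
Proof.
move=> ba fa eta e0; have [rho r0 H] := fa _ e0; exists rho => // t tr.
by apply: le_trans (H t tr); apply: ler_wpM2r; [exact: sqr_ge0|lra].
Qed.

Lemma peanoN f b c : peano f b c -> peano (fun t => - f t) (- b) (- c).
Proof.
move=> fp eta e0; have [rho r0 H] := fp _ e0; exists rho => // t tr.
by rewrite -normrN; have := H t tr; congr (`|_| <= _); ring.
Qed.

(** Adding [e x^2] makes every second difference strictly positive, which excludes an interior
    maximum. *)
Lemma max_principle1 f (T M : R) : 0 < T ->
  {within `[- T, T], continuous f} ->
  (forall x : R, - T < x < T -> sdge (fun h => f (x + h)) 0) ->
  f T <= M -> f (- T) <= M -> forall x : R, - T <= x <= T -> f x <= M.
Proof.
move=> T0 cf sd fT fNT x0 x0T; rewrite leNgt; apply/negP => Mx0.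
(* With [e T^2] equal to half of the excess [f x0 - M], the perturbed function is still larger at
   [x0] than at the end points. *)
set e := (f x0 - M) / (2 * T ^+ 2).
have TT0 : 0 < T ^+ 2 by rewrite exprn_gt0.
have e0 : 0 < e by rewrite divr_gt0 ?subr_gt0 ?mulr_gt0.
have eT : 2 * (e * T ^+ 2) = f x0 - M by rewrite /e; field; rewrite gt_eqF.
have [||z] := @EVT_max R (fun x => f x + e * x ^+ 2) (- T) T.
- by lra.
- move=> x; apply: cvgD; first exact: cf.
  apply: cvgM; first exact: cvg_cst.
  apply: (@continuous_subspaceT _ _ _ (fun y : R => y ^+ 2)).
  exact: exprn_continuous.
rewrite in_itv/= => zT H.
have Hx0 := H x0; rewrite in_itv/= in Hx0; have {}Hx0 := Hx0 x0T.
have zz : - T < z < T.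
  have sq0 := sqr_ge0 x0.
  case/andP: zT => z1 z2; rewrite !lt_neqAle z1 z2 !andbT; apply/andP; split; apply/eqP.
    by move=> zE; move: Hx0; rewrite -zE sqrrN; nra.
  by move=> zE; move: Hx0; rewrite zE; nra.
have [rho r0 K] := sd z zz e e0.
pose t := Num.min rho (Num.min (T - z) (z + T)).
case/andP: zz => z1 z2.
have t0 : 0 < t by rewrite !lt_min r0/=; lra.
have tr : t <= rho by rewrite ge_min lexx.
have tz1 : t <= T - z by rewrite !ge_min lexx orbT.
have tz2 : t <= z + T by rewrite !ge_min lexx !orbT.
have := K t; rewrite t0 tr => /(_ isT); rewrite addr0.
have := H (z + t); rewrite in_itv/= => /(_ _); have -> : - T <= z + t <= T by lra.
move=> /(_ isT).
have := H (z - t); rewrite in_itv/= => /(_ _); have -> : - T <= z - t <= T by lra.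
move=> /(_ isT).
have tt0 : 0 < e * t ^+ 2 by rewrite mulr_gt0// exprn_gt0.
nra.
Qed.

End second_order.

(** * Inequalities for powers *)

Section power_inequalities.
Context {R : realType}.
Implicit Types (x y z t p al : R).

(** Bernoulli's inequality for exponents at most 1, read off from Young's inequality with exponents
    [1/al] and [1/(1 - al)]. *)
Lemma powR_le_tangent1 z al : 0 <= z -> 0 < al <= 1 ->
  z `^ al <= 1 + al * (z - 1).
Proof.
move=> z0 /andP[al0]; rewrite le_eqVlt => /orP[/eqP->|al1].
  by rewrite powRr1//; lra.
have := @conjugate_powR R (z `^ al) 1 al^-1 (1 - al)^-1 (powR_ge0 _ _) ler01.
rewrite !invr_gt0 !invrK mulr1 powR1 mul1r -powRrM divff ?gt_eqF// powRr1//.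
have -> : 0 < 1 - al by lra.
have -> : al + (1 - al) = 1 by ring.
by move=> /(_ al0 isT erefl); lra.
Qed.

(** The previous inequality with exponent [1/p], at the point [z^p]. *)
Lemma powR_ge_tangent1 z p : 0 <= z -> 1 <= p -> 1 + p * (z - 1) <= z `^ p.
Proof.
move=> z0 p1; have p0 : 0 < p by lra.
have := @powR_le_tangent1 (z `^ p) p^-1 (powR_ge0 _ _).
rewrite invr_gt0 p0 invf_le1// p1 -powRrM divff ?gt_eqF// powRr1// => /(_ isT).
rewrite -(ler_pM2l p0) mulrDr mulrA divff ?gt_eqF//; lra.
Qed.

Lemma powR_invl b z : 0 < b -> b^-1 `^ z = (b `^ z)^-1.
Proof. by move=> b0; rewrite -(powR_inv1 (ltW b0)) -powRrM mulN1r powRN. Qed.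

Lemma powR_support x p : 1 <= p ->
  exists m, forall y, `|x| `^ p + m * (y - x) <= `|y| `^ p.
Proof.
move=> p1; have p0 : 0 < p by lra.
suff pos x' : 0 < x' -> exists m, forall y, `|x'| `^ p + m * (y - x') <= `|y| `^ p.
  have [x0|x0|->] := ltgtP x 0; [|exact: pos|].
    have [m {}H] : exists m, forall y, `|- x| `^ p + m * (y - - x) <= `|y| `^ p by apply: pos; rewrite oppr_gt0.
    by exists (- m) => y; have := H (- y); rewrite !normrN; apply: le_trans; lra.
  exists 0 => y; rewrite mul0r addr0 normr0 powR0 ?gt_eqF//; exact: powR_ge0.
move=> x0; exists (p * (x' `^ p / x')) => y.
rewrite (gtr0_norm x0).
have xp := powR_gt0 p x0.
have [y0|y0] := leP 0 y.
  have := @powR_ge_tangent1 (y / x') p (divr_ge0 y0 (ltW x0)) p1.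
  have xi0 : 0 <= x'^-1 by rewrite invr_ge0 ltW.
  rewrite (powRM _ y0 xi0) powR_invl//.
  rewrite -(ler_pM2l xp) (ger0_norm y0) mulrCA divff ?mulr1 ?gt_eqF// => /(le_trans _); apply.
  by rewrite le_eqVlt; apply/orP; left; apply/eqP; field; rewrite gt_eqF.
(* For [y < 0] the supporting line is at most [(1 - p) x'^p], which is not positive. *)
apply: le_trans (powR_ge0 _ _).
have -> : x' `^ p + p * (x' `^ p / x') * (y - x') = x' `^ p * (1 - p) + p * (x' `^ p / x') * y.
  by field; rewrite gt_eqF.
have h1 : 0 < p * (x' `^ p / x') by rewrite mulr_gt0// divr_gt0.
nra.
Qed.

Lemma powR_convex_sym x t p : 1 <= p ->
  2 * `|x| `^ p <= `|x + t| `^ p + `|x - t| `^ p.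
Proof.
move=> p1; have [m H] := powR_support x p1.
by have := H (x + t); have := H (x - t); lra.
Qed.

Lemma powR_le_tangent b s al : 0 < b -> 0 <= s -> 0 < al <= 1 ->
  s `^ al <= b `^ al + al * (b `^ al / b) * (s - b).
Proof.
move=> b0 s0 al01.
have ba := powR_gt0 al b0.
have := @powR_le_tangent1 (s / b) al (divr_ge0 s0 (ltW b0)) al01.
have bi0 : 0 <= b^-1 by rewrite invr_ge0 ltW.
rewrite (powRM _ s0 bi0) powR_invl//.
rewrite -(ler_pM2l ba) mulrCA divff ?gt_eqF// mulr1 => /le_trans -> //.
rewrite le_eqVlt; apply/orP; left; apply/eqP; by field; rewrite gt_eqF.
Qed.

(** A fraction [q] in [[0, 1]] satisfies [q <= q^al], and the fractions of [a + b] made up by [a]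
    and by [b] add up to 1. *)
Lemma powR_subadd a b al : 0 <= a -> 0 <= b -> 0 < al <= 1 ->
  (a + b) `^ al <= a `^ al + b `^ al.
Proof.
move=> a0 b0 /andP[al0 al1].
have [E|ab0] := eqVneq (a + b) 0.
  by rewrite E powR0 ?gt_eqF// addr_ge0// powR_ge0.
have abp : 0 < a + b by rewrite lt_def ab0 addr_ge0.
have H c : 0 <= c -> c <= a + b -> c / (a + b) * (a + b) `^ al <= c `^ al.
  move=> c0 cab; have [->|cn0] := eqVneq c 0; first by rewrite !mul0r powR_ge0.
  have cp : 0 < c by rewrite lt_def cn0.
  have {2}-> : c = c / (a + b) * (a + b) by field.
  have d0 : 0 < c / (a + b) by rewrite divr_gt0.
  rewrite (powRM _ (ltW d0) (ltW abp)) ler_wpM2r ?powR_ge0//.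
  by apply: ger1_powR => //; rewrite d0 ler_pdivrMr ?mul1r.
have := H a a0; have := H b b0.
have -> : b <= a + b by lra.
have -> : a <= a + b by lra.
move=> /(_ isT) h1 /(_ isT) h2; apply: le_trans (lerD h2 h1).
by rewrite -mulrDl -mulrDl divff// mul1r.
Qed.

(** For [p <= 2] this makes [|x|^p] a concave function of [x^2]. *)
Lemma powR_sqr x p : `|x| `^ p = (x ^+ 2) `^ (p / 2).
Proof.
rewrite -real_normK ?num_real// -powR_mulrn// -powRrM.
by congr (_ `^ _); field.
Qed.

(* Concavity of [s `^ (p/2)] applied to [(x+t)^2] and [(x-t)^2]. *)
Lemma powR_clarkson x t p : 1 <= p <= 2 ->
  `|x + t| `^ p + `|x - t| `^ p <= 2 * (`|x| `^ p + `|t| `^ p).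
Proof.
move=> /andP[p1 p2]; rewrite !powR_sqr.
have al : 0 < p / 2 <= 1 by lra.
apply: le_trans (_ : _ <= 2 * (x ^+ 2 + t ^+ 2) `^ (p / 2)) _; last first.
  by rewrite ler_pM2l// powR_subadd// sqr_ge0.
have [E|n0] := eqVneq (x ^+ 2 + t ^+ 2) 0.
  have x0 : x = 0 by apply/eqP; rewrite -sqrf_eq0; apply/eqP; have := sqr_ge0 x; have := sqr_ge0 t; lra.
  have t0 : t = 0 by apply/eqP; rewrite -sqrf_eq0; apply/eqP; have := sqr_ge0 x; have := sqr_ge0 t; lra.
  have p20 : p / 2 != 0 by rewrite gt_eqF//; lra.
  by rewrite x0 t0 subr0 !addr0 expr0n/= addr0 powR0//; lra.
have b0 : 0 < x ^+ 2 + t ^+ 2 by rewrite lt_def n0 addr_ge0 ?sqr_ge0.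
have := powR_le_tangent b0 (sqr_ge0 (x + t)) al.
have := powR_le_tangent b0 (sqr_ge0 (x - t)) al.
set K := p / 2 * _; set B := (x ^+ 2 + t ^+ 2) `^ _ => h1 h2.
apply: le_trans (lerD h2 h1) _; rewrite le_eqVlt; apply/orP; left; apply/eqP; ring.
Qed.

(** Concavity with the denominators cleared, so that coinciding points are allowed. *)
Lemma powR_concave3 a b c al : 0 <= a <= b -> b <= c -> 0 < al <= 1 ->
  (c - b) * a `^ al + (b - a) * c `^ al <= (c - a) * b `^ al.
Proof.
move=> /andP[a0 ab] bc al01.
have [b0|b0] := eqVneq b 0.
  have -> : a = 0 by lra.
  by rewrite b0; lra.
have bp : 0 < b by lra.
have c0 : 0 <= c by lra.
have := powR_le_tangent bp a0 al01; have := powR_le_tangent bp c0 al01.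
set K := al * _ => h1 h2.
have g1 : 0 <= (c - b) by lra.
have g2 : 0 <= (b - a) by lra.
have := lerD (ler_wpM2l g1 h2) (ler_wpM2l g2 h1); lra.
Qed.

Lemma powR_le_1sqr s p : 1 <= p <= 2 -> `|s| `^ p <= 1 + s ^+ 2.
Proof.
move=> /andP[p1 p2]; rewrite powR_sqr.
have := @powR_le_tangent1 (s ^+ 2) (p / 2) (sqr_ge0 _); have -> : 0 < p / 2 <= 1 by lra.
move=> /(_ isT); have := sqr_ge0 s; nra.
Qed.

Lemma continuous_powR p : 0 < p -> continuous (fun x : R => `|x| `^ p).
Proof.
move=> p0 x; have [->|x0] := eqVneq x 0.
  rewrite /continuous_at/= normr0 powR0 ?gt_eqF//.
  apply/cvgrPdist_le => e e0.
  have d0 : 0 < e `^ p^-1 by exact: powR_gt0.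
  apply/nbhs_ballP; exists (e `^ p^-1) => // t; rewrite /ball/= !sub0r !normrN => td.
  rewrite ger0_norm ?powR_ge0//.
  have -> : e = (e `^ p^-1) `^ p by rewrite -powRrM mulVf ?gt_eqF// powRr1// ltW.
  by apply: ge0_ler_powR; rewrite ?nnegrE ?(ltW p0)// ?(ltW d0)// ltW.
have : (fun y : R => `|y| `^ p) @ x --> `|x| `^ p; last by [].
apply: (@continuous_comp R R R Num.norm (@powR R ^~ p) x); first exact: norm_continuous.
apply: differentiable_continuous; apply/derivable1_diffP; apply: derivable_powR.
by rewrite in_itv/= andbT normr_gt0.
Qed.

End power_inequalities.

(* Locked: otherwise rewriting with [exprMn] and the like unfolds these. *)
HB.lock Definition cosh {R : realType} (x : R) : R := (expR x + expR (- x)) / 2.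
HB.lock Definition sinh {R : realType} (x : R) : R := (expR x - expR (- x)) / 2.

Section hyperbolic.
Context {R : realType}.
Implicit Types (x y s t : R).

Lemma coshE x : cosh x = (expR x + expR (- x)) / 2.
Proof. by rewrite cosh.unlock. Qed.

Lemma sinhE x : sinh x = (expR x - expR (- x)) / 2.
Proof. by rewrite sinh.unlock. Qed.

Lemma cosh2 x : cosh x ^+ 2 = 1 + sinh x ^+ 2.
Proof. by rewrite !(coshE, sinhE); have := expRxMexpNx_1 x; nra. Qed.

Lemma coshD x y : cosh (x + y) = cosh x * cosh y + sinh x * sinh y.
Proof. rewrite !(coshE, sinhE) opprD !expRD; by field. Qed.

Lemma sinhD x y : sinh (x + y) = sinh x * cosh y + cosh x * sinh y.
Proof. rewrite !(coshE, sinhE) opprD !expRD; by field. Qed.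

Lemma coshN x : cosh (- x) = cosh x.
Proof. by rewrite !coshE opprK addrC. Qed.

Lemma sinhN x : sinh (- x) = - sinh x.
Proof. rewrite !sinhE opprK; by field. Qed.

Lemma cosh0 : cosh 0 = 1 :> R.
Proof. rewrite !coshE oppr0 expR0; by field. Qed.

Lemma sinh0 : sinh 0 = 0 :> R.
Proof. by rewrite !sinhE oppr0 subrr mul0r. Qed.

Lemma cosh_gt0 x : 0 < cosh x.
Proof. by rewrite !coshE divr_gt0// addr_gt0// expR_gt0. Qed.

Lemma cosh_ge_exp x : expR `|x| <= 2 * cosh x.
Proof.
have := expR_gt0 x; have := expR_gt0 (- x); rewrite !coshE.
by have [x0|x0] := leP 0 x; [rewrite ger0_norm|rewrite ltr0_norm]; lra.
Qed.

Lemma is_derive_cosh x : is_derive x 1 (@cosh R) (sinh x).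
Proof.
rewrite (_ : @cosh R = fun x => (expR x + expR (- x)) / 2); last by apply/funext => t; rewrite coshE.
apply: is_derive_eq; rewrite /GRing.scale/= sinhE; by field.
Qed.

Lemma is_derive_sinh x : is_derive x 1 (@sinh R) (cosh x).
Proof.
rewrite (_ : @sinh R = fun x => (expR x - expR (- x)) / 2); last by apply/funext => t; rewrite sinhE.
apply: is_derive_eq; rewrite /GRing.scale/= coshE; by field.
Qed.

Lemma continuous_cosh : continuous (@cosh R).
Proof.
by move=> x; apply: differentiable_continuous; apply/derivable1_diffP; case: (is_derive_cosh x).
Qed.

Lemma continuous_sinh : continuous (@sinh R).
Proof.
by move=> x; apply: differentiable_continuous; apply/derivable1_diffP; case: (is_derive_sinh x).
Qed.

Lemma peano_cosh : peano (@cosh R) 0 (2^-1).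
Proof.
have := @peano_derive R cosh sinh 1 1 ltr01 (fun s _ => is_derive_cosh s).
by rewrite sinh0 mul1r; apply; have := is_derive_sinh (0:R); rewrite cosh0.
Qed.

Lemma peano_sinh : peano (@sinh R) 1 0.
Proof.
have := @peano_derive R sinh cosh 1 0 ltr01 (fun s _ => is_derive_sinh s).
by rewrite cosh0 mul0r; apply; have := is_derive_cosh (0:R); rewrite sinh0.
Qed.

Lemma peano_cos : peano (@cos R) 0 (- 2^-1).
Proof.
have := @peano_derive R cos (fun x => - sin x) 1 (- 1) ltr01 (fun s _ => is_derive_cos s).
rewrite sin0 oppr0 mulN1r; apply.
by apply: is_derive_eq; rewrite cos0.
Qed.

Lemma peano_sin : peano (@sin R) 1 0.
Proof.
have := @peano_derive R sin cos 1 0 ltr01 (fun s _ => is_derive_sin s).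
rewrite cos0 mul0r; apply.
by apply: is_derive_eq; rewrite sin0 oppr0.
Qed.

Lemma sinh_gt0 x : 0 < x -> 0 < sinh x.
Proof. by move=> x0; rewrite !sinhE divr_gt0// subr_gt0 ltr_expR; lra. Qed.

Lemma sinh_ge0 x : 0 <= x -> 0 <= sinh x.
Proof. by move=> x0; rewrite !sinhE divr_ge0// subr_ge0 ler_expR; lra. Qed.

End hyperbolic.

(** * Integrals over the line *)

(* Locked to keep unification from unfolding integrals. *)
HB.lock Definition lint {R : realType} (f : R -> R) : R := \int[@lebesgue_measure R]_x f x.

Section line_integral.
Context {R : realType}.
Notation mu := (@lebesgue_measure R).
Implicit Types (f g : R -> R).

(** The kernels below decay like [exp(-|s|)]: half of this rate is kept as an integrable weight, the
    other half absorbs quadratic growth. *)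
Definition ew (s : R) : R := expR (- (`|s| / 2)).

Lemma ew_gt0 s : 0 < ew s. Proof. exact: expR_gt0. Qed.

Lemma continuous_ew : continuous ew.
Proof.
move=> s; apply: (@continuous_comp _ _ _ (fun s : R => - (`|s| / 2)) expR); last exact: continuous_expR.
apply: (@continuousN _ _ _ (fun s : R => `|s| / 2)).
apply: (@continuousM _ _ _ (fun s : R => 2^-1)); last exact: cst_continuous.
exact: norm_continuous.
Qed.

Lemma ge0_integral_fold (g : R -> R) : continuous g -> (forall x, 0 <= g x) ->
  (\int[mu]_x (g x)%:E = \int[mu]_(x in `[0%R, +oo[) (g x)%:E
    + \int[mu]_(x in `[0%R, +oo[) (g (- x))%:E)%E.
Proof.
move=> cg g0.
have mg : measurable_fun [set: R] g by exact: continuous_measurable_fun.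
rewrite -(setUv `[0%R, +oo[%classic) ge0_integral_setU//=; last 4 first.
- exact: measurableC.
- by apply/measurable_EFinP; rewrite setUv.
- by move=> x _; rewrite lee_fin.
- exact/disj_setPCl.
congr (_ + _)%E; rewrite setCitvr integral_itv_bndo_bndc; last exact/measurable_EFinP/measurable_funTS.
rewrite -{1}oppr0 ge0_integration_by_substitutionNy//.
exact: continuous_subspaceT.
Qed.

Lemma ge0_integral_opp (g : R -> R) : continuous g -> (forall x, 0 <= g x) ->
  (\int[mu]_x (g (- x))%:E = \int[mu]_x (g x)%:E)%E.
Proof.
move=> cg g0; rewrite (ge0_integral_fold cg g0) ge0_integral_fold//.
  by rewrite addeC; congr (_ + _)%E; apply: eq_integral => x _; rewrite opprK.
move=> x; apply: (@continuous_comp _ _ _ (@GRing.opp R) g); last exact: cg.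
exact: opp_continuous.
Qed.

Lemma ge0_integral_shift (a : R) (g : R -> R) : continuous g -> (forall x, 0 <= g x) ->
  (\int[mu]_x (g (x + a))%:E = \int[mu]_x (g x)%:E)%E.
Proof.
move=> cg g0.
have D : ((fun x : R => x + a)^`() = cst 1)%classic.
  by apply/funext => x; rewrite derive1E deriveD// derive_id derive_cst addr0.
rewrite [RHS](@increasing_ge0_integration_by_substitutionT R (fun x => x + a))//.
- by apply: eq_integral => x _; rewrite fctE D mulr1.
- by move=> x y xy; rewrite ltrD2r.
- by rewrite D => x; exact: cst_continuous.
- by rewrite D; exact: is_cvg_cst.
- by rewrite D; exact: is_cvg_cst.
- by under eq_fun do rewrite addrC; exact: cvg_addrl_Ny.
- by under eq_fun do rewrite addrC; exact: cvg_addrl.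
Qed.

Lemma integral0y_expN (a : R) : 0 < a ->
  (\int[mu]_(x in `[0%R, +oo[) (expR (- (a * x)))%:E = (a^-1)%:E)%E.
Proof.
move=> a0.
pose F (x : R) := - (expR (- (a * x)) / a).
have dF (x : R) : is_derive x 1 F (expR (- (a * x))).
  by rewrite /F; apply: is_derive_eq; rewrite /GRing.scale/=; field; rewrite gt_eqF.
have cF : continuous F.
  by move=> x; apply: differentiable_continuous; apply/derivable1_diffP; case: (dF x).
rewrite (@ge0_continuous_FTC2y R _ F 0 0).
- by rewrite /F mulr0 oppr0 expR0 -EFinB; congr EFin; field; rewrite gt_eqF.
- by move=> x _; exact: expR_ge0.
- apply: continuous_subspaceT => x.
  apply: (@continuous_comp _ _ _ (fun x : R => - (a * x)) expR); last exact: continuous_expR.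
  apply: (@continuousN _ _ _ (fun x : R => a * x)).
  by apply: (@continuousM _ _ (cst a) id); [exact: cst_continuous|].
- rewrite -oppr0; apply: cvgN; rewrite -(mul0r a^-1); apply: cvgM; last exact: cvg_cst.
  apply: (@cvg_comp _ _ _ (fun x : R => a * x) (fun x => expR (- x)) _ _ _ _ (@cvgr_expR R)).
  exact: gt0_cvgMry.
- by move=> x _; case: (dF x).
- by apply: cvg_at_right_filter; exact: cF.
- by move=> x _; rewrite derive1E; case: (dF x).
Qed.

Lemma integral_ew : (\int[mu]_x (ew x)%:E = 4%:E)%E.
Proof.
rewrite ge0_symfun_integralT.
- rewrite -set_itvcy.
  under eq_integral => x.
    rewrite inE/= in_itv/= andbT => x0; rewrite /ew ger0_norm// mulrC.
    over.
  by rewrite integral0y_expN// invrK -EFinM; congr EFin; ring.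
- by move=> x; exact/ltW/ew_gt0.
- exact: continuous_ew.
- by move=> x; rewrite /= /ew normrN.
Qed.

(** Domination by one integrable weight makes the class closed under sums, multiples, translations
    and reflections, and each member integrable. *)
Definition adm f := continuous f /\ exists M, forall s, `|f s| <= M * ew s.

Lemma adm_integrable f : adm f -> mu.-integrable setT (EFin \o f).
Proof.
move=> [cf [M fM]].
apply: (@le_integrable _ _ _ mu setT measurableT _ (EFin \o (fun s => M * ew s))) => //.
- by apply/measurable_EFinP; exact: continuous_measurable_fun.
- move=> s _; rewrite /= lee_fin; apply: le_trans (fM s) _; exact: ler_norm.
rewrite (_ : EFin \o _ = (fun s => M%:E * (EFin \o ew) s)%E); last first.
  by apply/funext => s; rewrite /= EFinM.
apply: integrableZl => //.
apply/integrableP; split.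
  by apply/measurable_EFinP; exact: continuous_measurable_fun continuous_ew.
under eq_integral do rewrite /= ger0_norm ?(ltW (ew_gt0 _))//.
by rewrite integral_ew ltry.
Qed.

Lemma lintE f : lint f = \int[mu]_x f x.
Proof. by rewrite lint.unlock. Qed.

Lemma eq_lint f g : f =1 g -> lint f = lint g.
Proof. by move=> /funext->. Qed.

Lemma admD f g : adm f -> adm g -> adm (fun s => f s + g s).
Proof.
move=> [cf [M fM]] [cg [N gN]]; split.
  by move=> x; apply: (@continuousD _ _ _ f g); [exact: cf|exact: cg].
exists (M + N) => s; apply: le_trans (ler_normD _ _) _; rewrite mulrDl.
exact: lerD.
Qed.

Lemma admZ k f : adm f -> adm (fun s => k * f s).
Proof.
move=> [cf [M fM]]; split.
  by move=> x; apply: (@continuousM _ _ (cst k) f); [exact: cst_continuous|exact: cf].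
by exists (`|k| * M) => s; rewrite normrM -mulrA ler_wpM2l.
Qed.

Lemma admN f : adm f -> adm (fun s => - f s).
Proof. by move=> /(admZ (- 1)); under eq_fun do rewrite mulN1r. Qed.

Lemma admB f g : adm f -> adm g -> adm (fun s => f s - g s).
Proof. by move=> af /admN; exact: admD. Qed.

Lemma lintD f g : adm f -> adm g -> lint (fun s => f s + g s) = lint f + lint g.
Proof. by move=> af ag; rewrite !lintE RintegralD//; exact: adm_integrable. Qed.

Lemma lintB f g : adm f -> adm g -> lint (fun s => f s - g s) = lint f - lint g.
Proof. by move=> af ag; rewrite !lintE RintegralB//; exact: adm_integrable. Qed.

Lemma lintZ k f : adm f -> lint (fun s => k * f s) = k * lint f.
Proof. by move=> af; rewrite !lintE RintegralZl//; exact: adm_integrable. Qed.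

Lemma le_lint f g : adm f -> adm g -> (forall s, f s <= g s) -> lint f <= lint g.
Proof. by move=> af ag fg; rewrite !lintE; apply: le_Rintegral => //; exact: adm_integrable. Qed.

Lemma lint_ge0 f : (forall s, 0 <= f s) -> 0 <= lint f.
Proof. by move=> f0; rewrite lintE; apply: Rintegral_ge0. Qed.

Lemma normr_lint f : adm f -> `|lint f| <= lint (fun s => `|f s|).
Proof. by move=> af; rewrite !lintE; apply: le_normr_Rintegral => //; exact: adm_integrable. Qed.

Lemma adm_norm f : adm f -> adm (fun s => `|f s|).
Proof.
move=> [cf [M fM]]; split.
  by move=> x; apply: continuous_comp; [exact: cf|exact: norm_continuous].
by exists M => s; rewrite normr_id.
Qed.

Lemma adm_shift a f : adm f -> adm (fun s => f (s + a)).
Proof.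
move=> [cf [M fM]]; split.
  move=> x; apply: (@continuous_comp _ _ _ (fun x => x + a) f); last exact: cf.
  by apply: (@continuousD _ _ _ id (cst a)); [|exact: cst_continuous].
have M0 : 0 <= M.
  by have := le_trans (normr_ge0 _) (fM 0); rewrite pmulr_lge0// ew_gt0.
exists (M * expR (`|a| / 2)) => s; apply: le_trans (fM _) _.
rewrite -mulrA; apply: ler_wpM2l => //; rewrite /ew -expRD ler_expR.
have := ler_normB (s + a) a; rewrite addrK; lra.
Qed.

Lemma adm_opp f : adm f -> adm (fun s => f (- s)).
Proof.
move=> [cf [M fM]]; split.
  move=> x; apply: (@continuous_comp _ _ _ (@GRing.opp R) f); last exact: cf.
  exact: opp_continuous.
by exists M => s; rewrite (le_trans (fM _))// /ew normrN.
Qed.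

(** The substitution rules above are for nonnegative integrands, and both [|f| + f] and [|f|] are
    nonnegative. *)
Lemma lint_posneg f : adm f ->
  lint f = lint (fun s => `|f s| + f s) - lint (fun s => `|f s|).
Proof.
move=> af; rewrite -lintB; [|exact/admD/af/adm_norm|exact: adm_norm].
by apply: eq_lint => s; ring.
Qed.

Lemma lint_shift a f : adm f -> lint (fun s => f (s + a)) = lint f.
Proof.
move=> af; rewrite (lint_posneg (adm_shift a af)) (lint_posneg af).
have [cn _] := adm_norm af; have [cf _] := admD (adm_norm af) af.
rewrite !lintE /Rintegral (@ge0_integral_shift a (fun s => `|f s| + f s)) //.
  by rewrite (@ge0_integral_shift a (fun s => `|f s|)).
by move=> x; have := ler_norm (- f x); rewrite normrN; lra.
Qed.

Lemma lint_opp f : adm f -> lint (fun s => f (- s)) = lint f.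
Proof.
move=> af; rewrite (lint_posneg (adm_opp af)) (lint_posneg af).
have [cn _] := adm_norm af; have [cf _] := admD (adm_norm af) af.
rewrite !lintE /Rintegral (@ge0_integral_opp (fun s => `|f s| + f s)) //.
  by rewrite (@ge0_integral_opp (fun s => `|f s|)).
by move=> x; have := ler_norm (- f x); rewrite normrN; lra.
Qed.

End line_integral.

(** * The Poisson kernel of the strip *)

Section complex_norm.
Context {R : realType}.
Import ComplexField.Normc.
Local Notation Re := (@complex.Re _).
Local Notation Im := (@complex.Im _).
Implicit Types (z w : R[i]).

Lemma normc_ge0 z : 0 <= normc z.
Proof. by case: z => a b /=; exact: sqrtr_ge0. Qed.

Lemma normcD z w : normc (z + w) <= normc z + normc w.
Proof. by rewrite -lecR rmorphD; exact: ComplexField.lec_normD. Qed.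

Lemma normcN z : normc (- z) = normc z.
Proof. by case: z => a b /=; rewrite !sqrrN. Qed.

Lemma normc_sqr z : normc z ^+ 2 = Re z ^+ 2 + Im z ^+ 2.
Proof. by case: z => a b /=; rewrite sqr_sqrtr// addr_ge0// sqr_ge0. Qed.

Lemma normc_Re z : `|Re z| <= normc z.
Proof.
rewrite -ler_sqr ?nnegrE ?normc_ge0// normc_sqr real_normK ?num_real//.
by rewrite lerDl sqr_ge0.
Qed.

Lemma normc_Im z : `|Im z| <= normc z.
Proof.
rewrite -ler_sqr ?nnegrE ?normc_ge0// normc_sqr real_normK ?num_real//.
by rewrite lerDr sqr_ge0.
Qed.

Lemma normc_le z : normc z <= `|Re z| + `|Im z|.
Proof.
rewrite -ler_sqr ?nnegrE ?normc_ge0 ?addr_ge0// normc_sqr.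
have -> : Re z ^+ 2 = `|Re z| ^+ 2 by rewrite real_normK ?num_real.
have -> : Im z ^+ 2 = `|Im z| ^+ 2 by rewrite real_normK ?num_real.
have := normr_ge0 (Re z); have := normr_ge0 (Im z); nra.
Qed.

Lemma normcX z n : normc (z ^+ n) = normc z ^+ n.
Proof. by elim: n => [|n IH]; rewrite ?expr0 ?normc1// !exprS normcM IH. Qed.

Lemma normc_gt0 z : z != 0 -> 0 < normc z.
Proof.
move=> z0; rewrite lt_def normc_ge0 andbT; apply: contra z0 => /eqP.
by move/eq0_normc => ->.
Qed.

End complex_norm.

Section complex_taylor.
Context {R : realType}.
Import ComplexField.Normc.
Local Notation Re := (@complex.Re _).
Local Notation Im := (@complex.Im _).
Implicit Types (a b s y : R).
Local Open Scope complex_scope.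

(** [cosh(s + i y)], and below [sinh(s + i y)], by real and imaginary parts. *)
Definition ccosh s y : R[i] := (cosh s * cos y) +i* (sinh s * sin y).
Definition csinh s y : R[i] := (sinh s * cos y) +i* (cosh s * sin y).

Lemma ccoshD s y a b :
  ccosh (s + a) (y + b) = ccosh s y * ccosh a b + csinh s y * csinh a b.
Proof.
apply/eqP; rewrite eq_complex /= coshD sinhD cosD sinD; apply/andP; split; apply/eqP; ring.
Qed.

Lemma peano_small (f : R -> R) (l q eta : R) : peano f l q -> 0 < eta ->
  exists2 rho, 0 < rho & forall t N, `|t| <= rho -> t ^+ 2 <= N ->
    `|f t - f 0 - l * t - q * t ^+ 2| <= eta * N.
Proof.
move=> fp e0; have [rho r0 H] := fp _ e0; exists rho => // t N tr tN.
by apply: le_trans (H t tr) _; rewrite ler_pM2l.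
Qed.

Lemma normM_le (u v p q : R) : `|u| <= p -> `|v| <= q -> `|u * v| <= p * q.
Proof. by move=> up vq; rewrite normrM ler_pM. Qed.

(** The expansions [cosh d = 1 + d^2/2 + o(|d|^2)] and [sinh d = d + o(|d|^2)], obtained by
    multiplying those of [cosh a], [sinh a], [cos b], [sin b]. *)
Lemma ccosh_csinh_peano eta : 0 < eta <= 1 -> exists2 rho, 0 < rho <= eta &
  forall a b, `|a| <= rho -> `|b| <= rho ->
   let d : R[i] := a +i* b in let N := a ^+ 2 + b ^+ 2 in
   normc (ccosh a b - 1 - d ^+ 2 / 2) <= 12 * eta * N /\
   normc (csinh a b - d) <= 12 * eta * N.
Proof.
move=> /andP[e0 e1].
have [r1 r10 H1] := peano_small peano_cosh e0.
have [r2 r20 H2] := peano_small peano_sinh e0.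
have [r3 r30 H3] := peano_small peano_cos e0.
have [r4 r40 H4] := peano_small peano_sin e0.
exists (Num.min (eta / 2) (Num.min (Num.min r1 r2) (Num.min r3 r4))).
  rewrite !lt_min r10 r20 r30 r40 andbT ge_min divr_gt0//=.
  by apply/orP; left; lra.
move=> a b; rewrite !le_min => /andP[ae /andP[/andP[ar1 ar2] _]].
move=> /andP[be /andP[_ /andP[br3 br4]]] d N.
have a20 := sqr_ge0 a; have b20 := sqr_ge0 b.
have aN : a ^+ 2 <= N by rewrite /N lerDl.
have bN : b ^+ 2 <= N by rewrite /N lerDr.
have := H1 a N ar1 aN; have := H2 a N ar2 aN; have := H3 b N br3 bN; have := H4 b N br4 bN.
rewrite cosh0 sinh0 cos0 sin0 !mul0r !mul1r !subr0.
set e4 := sin b - b; set e3 := cos b - 1 - _; set e2 := sinh a - a; set e1' := cosh a - 1 - _.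
move=> h4 h3 h2 h1.
have N0 : 0 <= N by rewrite addr_ge0.
(* This makes products of two quadratically small quantities of size [eta N]. *)
have Ne : N <= eta.
  have -> : N = `|a| ^+ 2 + `|b| ^+ 2 by rewrite !real_normK ?num_real.
  have := normr_ge0 a; have := normr_ge0 b; clear -ae be e1; nra.
have eN : eta * N <= eta by clear -Ne e1 e0; nra.
have eN0 : 0 <= eta * N by clear -N0 e0; nra.
have NN : N * N <= eta * N by clear -N0 Ne; nra.
have c1 : `|cosh a - 1| <= 2 * N.
  have -> : cosh a - 1 = e1' + 2^-1 * a ^+ 2 by rewrite /e1'; ring.
  apply: le_trans (ler_normD _ _) _; rewrite (@ger0_norm _ (2^-1 * _)); last by rewrite mulr_ge0.
  clear -h1 aN a20 N0 e1 e0; nra.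
have c3 : `|cos b - 1| <= 2 * N.
  have -> : cos b - 1 = e3 + - 2^-1 * b ^+ 2 by rewrite /e3; ring.
  apply: le_trans (ler_normD _ _) _; rewrite mulNr normrN (@ger0_norm _ (2^-1 * _)); last by rewrite mulr_ge0.
  clear -h3 bN b20 N0 e1 e0; nra.
have K1 : `|(cosh a - 1) * (cos b - 1)| <= 4 * eta * N.
  by apply: le_trans (normM_le c1 c3) _; clear -NN; nra.
have K2 : `|e2 * e4| <= eta * N by apply: le_trans (normM_le h2 h4) _; clear -N0 Ne e0 e1 eN eN0 NN; nra.
have K3 : `|a * e4| <= eta * N.
  by apply: le_trans (normM_le ae h4) _; clear -N0 Ne e0 e1 eN eN0 NN; nra.
have K4 : `|b * e2| <= eta * N.
  by apply: le_trans (normM_le be h2) _; clear -N0 Ne e0 e1 eN eN0 NN; nra.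
have K5 : `|a * (cos b - 1)| <= eta * N.
  by apply: le_trans (normM_le ae c3) _; clear -N0 Ne e0 e1 eN eN0 NN; nra.
have K6 : `|b * (cosh a - 1)| <= eta * N.
  by apply: le_trans (normM_le be c1) _; clear -N0 Ne e0 e1 eN eN0 NN; nra.
have K7 : `|e2 * (cos b - 1)| <= 2 * eta * N.
  by apply: le_trans (normM_le h2 c3) _; clear -N0 Ne e0 e1 eN eN0 NN; nra.
have K8 : `|e4 * (cosh a - 1)| <= 2 * eta * N.
  by apply: le_trans (normM_le h4 c1) _; clear -N0 Ne e0 e1 eN eN0 NN; nra.
split.
  have -> : ccosh a b - 1 - d ^+ 2 / 2 =
     (e1' + e3 + (cosh a - 1) * (cos b - 1)) +i* (a * e4 + b * e2 + e2 * e4).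
    rewrite expr2 (_ : 2^-1 = (2^-1)%:C); last by rewrite fmorphV rmorph_nat.
    by apply/eqP; rewrite eq_complex /= /e1' /e2 /e3 /e4; apply/andP; split; apply/eqP; field.
  apply: le_trans (normc_le _) _ => /=.
  have := ler_normD (e1' + e3) ((cosh a - 1) * (cos b - 1)); have := ler_normD e1' e3.
  have := ler_normD (a * e4 + b * e2) (e2 * e4); have := ler_normD (a * e4) (b * e2).
  clear -K1 K2 K3 K4 h1 h3 eN0; nra.
have -> : csinh a b - d = (a * (cos b - 1) + e2 * (cos b - 1) + e2) +i*
    (b * (cosh a - 1) + e4 * (cosh a - 1) + e4).
  apply/eqP; rewrite eq_complex /= /e2 /e4; apply/andP; split; apply/eqP; ring.
apply: le_trans (normc_le _) _ => /=.
have := ler_normD (a * (cos b - 1) + e2 * (cos b - 1)) e2.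
have := ler_normD (a * (cos b - 1)) (e2 * (cos b - 1)).
have := ler_normD (b * (cosh a - 1) + e4 * (cosh a - 1)) e4.
have := ler_normD (b * (cosh a - 1)) (e4 * (cosh a - 1)).
clear -K5 K6 K7 K8 h2 h4 eN0; nra.
Qed.

End complex_taylor.

(** Sum of the Poisson kernels of the two edges of the strip [|y| < pi/2], which carry the same
    data; the denominator is [|cosh(s + i y)|^2]. *)
HB.lock Definition kap {R : realType} (y s : R) : R :=
  cosh s * cos y / (sinh s ^+ 2 + cos y ^+ 2) / pi.

Section kernel_taylor.
Context {R : realType}.
Import ComplexField.Normc.
Local Notation Re := (@complex.Re _).
Local Notation Im := (@complex.Im _).
Implicit Types (a b s y : R).
Local Open Scope complex_scope.

(** [cosh(z + d) = cosh z (cosh d + T sinh d)] with [T = tanh z]. The constant [K] depends on [T]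
    only through the bound [tau], which makes the expansion of [1 / cosh] uniform along horizontal
    lines. *)
Lemma csech_taylor (tau : R) : 0 <= tau -> exists2 K, 0 < K & forall eta, 0 < eta <= 1 ->
  exists2 rho, 0 < rho & forall (T : R[i]) a b, normc T <= tau -> `|a| <= rho -> `|b| <= rho ->
    let d : R[i] := a +i* b in let E := ccosh a b + T * csinh a b in
    E != 0 /\
    normc (E^-1 - (1 - T * d + (T ^+ 2 - 2^-1) * d ^+ 2)) <= K * eta * (a ^+ 2 + b ^+ 2).
Proof.
move=> t0; pose sg := tau ^+ 2 + 1.
pose K := 2 * ((1 + tau + sg) * (1 + tau) * 12 + 2 * (tau * sg + tau / 2) + sg).
have t20 := sqr_ge0 tau.
have sg0 : 1 <= sg by rewrite /sg; lra.
have K0 : 0 < K by rewrite /K; nra.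
exists K => // eta /andP[e0 e1].
(* With [e (1 + tau) <= 1/32], the quantity [E] differs from 1 by at most 1/2. *)
pose e := Num.min eta (32 * (1 + tau))^-1.
have ee : e <= eta by rewrite ge_min lexx.
have et : e * (1 + tau) <= 32^-1.
  have : e <= (32 * (1 + tau))^-1 by rewrite ge_min lexx orbT.
  have t1 : 0 < 1 + tau by lra.
  move=> /(ler_wpM2r (ltW t1)) /le_trans; apply.
  by rewrite invfM -mulrA mulVf ?mulr1// gt_eqF.
have e0' : 0 < e by rewrite lt_min e0 invr_gt0; lra.
have e1' : e <= 1 by lra.
have [rho /andP[r0 re] H] := @ccosh_csinh_peano R e (introT andP (conj e0' e1')).
exists rho => // T a b Tt ar br d E.
have [] := H a b ar br; rewrite -/d.
set N := a ^+ 2 + b ^+ 2; set r1 := ccosh a b - 1 - _; set r2 := csinh a b - _ => h1 h2.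
set n := normc d.
have nN : n ^+ 2 = N by rewrite /n normc_sqr.
have n0 : 0 <= n := normc_ge0 d.
have n2e : n <= 2 * e by apply: le_trans (normc_le d) _ => /=; lra.
have N0 : 0 <= N by rewrite -nN sqr_ge0.
have e32 : e <= 32^-1 by nra.
have tn : tau * n <= 16^-1 by nra.
have n16 : n <= 16^-1 by lra.
have Nn : N <= 16^-1 * n by rewrite -nN expr2; nra.
have eN : e * N <= 512^-1 by nra.
have EE : E = 1 + T * d + d ^+ 2 / 2 + (r1 + T * r2) by rewrite /E /r1 /r2; ring.
have nr : normc (r1 + T * r2) <= (1 + tau) * (12 * e * N).
  apply: le_trans (normcD _ _) _; rewrite normcM mulrDl mul1r; apply: lerD => //.
  by apply: ler_pM => //; exact: normc_ge0.
have nhalf : normc (2^-1 : R[i]) = 2^-1.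
  rewrite normcV; congr (_^-1); rewrite (_ : 2 = 2%:C); last by rewrite rmorph_nat.
  by rewrite /= expr0n addr0 sqrtr_sqr ger0_norm.
have nE1 : normc (E - 1) <= 2^-1.
  have -> : E - 1 = T * d + d ^+ 2 / 2 + (r1 + T * r2) by rewrite EE; ring.
  apply: le_trans (normcD _ _) _; have := normcD (T * d) (d ^+ 2 / 2).
  rewrite !normcM ?normcX nhalf -/n ?nN -?expr2 ?nN.
  have : normc T * n <= tau * n by rewrite ler_wpM2r.
  have : (1 + tau) * (12 * e * N) <= 12 * 512^-1 by have := ler_wpM2r N0 et; clear -Nn n16; lra.
  clear -tn Nn n16 nr; lra.
have nE : 2^-1 <= normc E.
  have := normcD E (1 - E); rewrite addrCA subrr addr0 normc1.
  by rewrite -[normc (1 - E)]normcN opprB; clear -nE1; lra.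
have E0 : E != 0 by apply/eqP => E0; move: nE; rewrite E0 normc0; clear; lra.
split => //.
set Q := 1 - _ + _.
have ns : normc (T ^+ 2 - 2^-1) <= sg.
  apply: le_trans (normcD _ _) _; rewrite normcN nhalf normcX /sg.
  have := normc_ge0 T; clear -Tt t0; nra.
have nQ : normc Q <= 1 + tau + sg.
  rewrite /Q; apply: le_trans (normcD _ _) _; have := normcD 1 (- (T * d)).
  rewrite normcN normc1 !normcM -/n -?expr2 ?normcX -/n nN.
  have : normc T * n <= tau * n by rewrite ler_wpM2r.
  have := ler_pM (normc_ge0 _) N0 ns (lexx N).
  have sN : sg * N <= sg by rewrite ler_piMr//; clear -sg0 Nn n16 N0; lra.
  have tn1 : tau * n <= tau by rewrite ler_piMr//; clear -n16; lra.
  clear -sN tn1; lra.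
(* Expand [1 - E Q]: the terms up to order two cancel, leaving the remainder of [E] and terms of
   orders three and four. *)
have -> : E^-1 - Q = - (Q * (r1 + T * r2) + (d ^+ 2 * d) * (T * (T ^+ 2 - 2^-1) - T / 2)
     + (d ^+ 2 * d ^+ 2) * ((T ^+ 2 - 2^-1) / 2)) / E.
  apply: (mulIf E0); by rewrite divfK// mulrBl mulVf// {1}EE /Q; field.
rewrite normcM normcN normcV.
have iE : (normc E)^-1 <= 2 by rewrite -[leRHS]invrK lef_pV2// posrE ?invr_gt0//; clear -nE; lra.
have q1 : normc (Q * (r1 + T * r2)) <= (1 + tau + sg) * ((1 + tau) * (12 * e * N)).
  by rewrite normcM; apply: ler_pM => //; exact: normc_ge0.
have nT0 := normc_ge0 T.
have q2 : normc ((d ^+ 2 * d) * (T * (T ^+ 2 - 2^-1) - T / 2)) <= N * (2 * e) * (tau * sg + tau / 2).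
  rewrite normcM; apply: ler_pM; rewrite ?normc_ge0//.
    by rewrite !normcM -/n -expr2 nN ler_wpM2l.
  apply: le_trans (normcD _ _) _; rewrite normcN !normcM nhalf.
  have := ler_pM nT0 (normc_ge0 _) Tt ns; clear -Tt; lra.
have q3 : normc ((d ^+ 2 * d ^+ 2) * ((T ^+ 2 - 2^-1) / 2)) <= N * e * sg.
  rewrite !normcM -/n (_ : n * n = N) ?nhalf; last by rewrite -expr2.
  have -> : N * N * (normc (T ^+ 2 - 2^-1) / 2) = N * (N / 2) * normc (T ^+ 2 - 2^-1) by ring.
  apply: ler_pM => //; rewrite ?normc_ge0 ?mulr_ge0//.
  by rewrite ler_wpM2l//; clear -Nn n2e e0'; lra.
have q : normc (Q * (r1 + T * r2) + (d ^+ 2 * d) * (T * (T ^+ 2 - 2^-1) - T / 2)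
     + (d ^+ 2 * d ^+ 2) * ((T ^+ 2 - 2^-1) / 2)) <= (K / 2) * e * N.
  apply: le_trans (normcD _ _) _.
  have := normcD (Q * (r1 + T * r2)) ((d ^+ 2 * d) * (T * (T ^+ 2 - 2^-1) - T / 2)).
  rewrite /K; clear -q1 q2 q3; lra.
have := ler_pM (normc_ge0 _) _ q iE; rewrite invr_ge0 normc_ge0 => /(_ isT) /le_trans; apply.
have -> : K / 2 * e * N * 2 = K * e * N by field.
by rewrite ler_wpM2r// ler_wpM2l// ltW.
Qed.

Definition ctanh s y : R[i] := csinh s y / ccosh s y.

(** Coefficients of the expansion below: [kap1] and [kap2] are the derivatives in [s] and in [y],
    [kap3] is half the second derivative in [s] and minus half the one in [y], and [kap4] is the
    mixed derivative. *)
Definition kap1 y s : R := - Re (ctanh s y / ccosh s y) / pi.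
Definition kap2 y s : R := Im (ctanh s y / ccosh s y) / pi.
Definition kap3 y s : R := Re ((ctanh s y ^+ 2 - 2^-1) / ccosh s y) / pi.
Definition kap4 y s : R := - 2 * Im ((ctanh s y ^+ 2 - 2^-1) / ccosh s y) / pi.

Lemma normc_ccosh s y : normc (ccosh s y) ^+ 2 = sinh s ^+ 2 + cos y ^+ 2.
Proof. by rewrite normc_sqr /= !exprMn cosh2 sin2cos2; ring. Qed.

Lemma kapE y s : kap y s = Re (ccosh s y)^-1 / pi.
Proof.
rewrite kap.unlock /=; congr (_ / _ / _); rewrite !exprMn cosh2 sin2cos2; ring.
Qed.

Lemma ccosh_ge y s : 0 < cos y -> cos y * cosh s <= normc (ccosh s y).
Proof.
move=> y0; rewrite -ler_sqr ?nnegrE ?normc_ge0 ?mulr_ge0 ?(ltW y0) ?(ltW (cosh_gt0 _))//.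
rewrite normc_ccosh exprMn cosh2; have := cos2Dsin2 y.
have := sqr_ge0 (sin y); have := sqr_ge0 (sinh s); nra.
Qed.

Lemma ccosh_neq0 y s : 0 < cos y -> ccosh s y != 0.
Proof.
move=> y0; apply/eqP => E; have := ccosh_ge s y0; rewrite E normc0.
by have := mulr_gt0 y0 (cosh_gt0 s); lra.
Qed.

Lemma normc_ccoshV y s : 0 < cos y ->
  normc (ccosh s y)^-1 <= (cos y)^-1 / cosh s.
Proof.
move=> y0; rewrite normcV -invfM lef_pV2 ?posrE ?mulr_gt0 ?cosh_gt0//.
  exact: ccosh_ge.
exact/normc_gt0/ccosh_neq0.
Qed.

(** [|sinh(s + i y)| <= cosh s], while [|cosh(s + i y)| >= cos y cosh s]. *)
Lemma normc_ctanh y s : 0 < cos y -> normc (ctanh s y) <= (cos y)^-1.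
Proof.
move=> y0; rewrite /ctanh normcM.
apply: le_trans (_ : cosh s * ((cos y)^-1 / cosh s) <= _).
  apply: ler_pM; rewrite ?normc_ge0//; last exact: normc_ccoshV.
  rewrite -ler_sqr ?nnegrE ?normc_ge0 ?(ltW (cosh_gt0 _))// normc_sqr /= !exprMn cosh2.
  have := cos2Dsin2 y; have := sqr_ge0 (sin y); have := sqr_ge0 (sinh s); nra.
by rewrite mulrCA divff ?mulr1// gt_eqF// cosh_gt0.
Qed.

(* [kap y s] is [Re (1 / cosh (s + i y)) / pi]; its second order expansion is uniform
   relative to the weight [1 / cosh s] since [tanh (s + i y)] is bounded in [s]. *)
Lemma kap_taylor y : 0 < cos y -> forall eta, 0 < eta -> exists2 rho, 0 < rho &
  forall a b s, `|a| <= rho -> `|b| <= rho ->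
  `|kap (y + b) (s + a) - kap y s - a * kap1 y s - b * kap2 y s
     - (a ^+ 2 - b ^+ 2) * kap3 y s - a * b * kap4 y s|
    <= eta * (a ^+ 2 + b ^+ 2) * (cosh s)^-1.
Proof.
move=> y0 eta e0.
have iy0 : 0 < (cos y)^-1 by rewrite invr_gt0.
have [K K0 H] := csech_taylor (ltW iy0).
pose e := Num.min 1 (eta * pi * cos y / K).
have e01 : 0 < e <= 1 by rewrite lt_min ge_min lexx ltr01 divr_gt0// !mulr_gt0// pi_gt0.
have [rho r0 {}H] := H e e01; exists rho => // a b s ar br.
have [] := H (ctanh s y) a b (normc_ctanh s y0) ar br.
set d : R[i] := a +i* b; set E := ccosh a b + _; set T := ctanh s y => E0 h.
set C := ccosh s y; have C0 : C != 0 by exact: ccosh_neq0.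
have CE : ccosh (s + a) (y + b) = C * E.
  by rewrite ccoshD /E /T /ctanh mulrDr mulrA [C * (_ / _)]mulrC divfK.
set Q := 1 - T * d + _ in h.
rewrite !kapE CE /kap1 /kap2 /kap3 /kap4 -/T -/C.
have -> : Re (C * E)^-1 / pi - Re C^-1 / pi - a * (- Re (T / C) / pi) - b * (Im (T / C) / pi) -
    (a ^+ 2 - b ^+ 2) * (Re ((T ^+ 2 - 2^-1) / C) / pi) -
    a * b * (-2 * Im ((T ^+ 2 - 2^-1) / C) / pi) = Re (C^-1 * (E^-1 - Q)) / pi.
  have -> : C^-1 * (E^-1 - Q) = (C * E)^-1 - C^-1 + (T / C) * d
      - ((T ^+ 2 - 2^-1) / C) * d ^+ 2.
    by rewrite invfM /Q; ring.
  rewrite expr2 /d; case: (T / C) => t1 t2; case: ((T ^+ 2 - 2^-1) / C) => u1 u2.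
  case: (C * E)^-1 => w1 w2; case: C^-1 => v1 v2 /=; ring.
rewrite normrM (@gtr0_norm _ pi^-1) ?invr_gt0 ?pi_gt0// ler_pdivrMr ?pi_gt0//.
apply: le_trans (normc_Re _) _; rewrite normcM.
apply: le_trans (ler_pM (normc_ge0 _) (normc_ge0 _) (normc_ccoshV s y0) h) _.
have KE : K * e <= eta * pi * cos y.
  rewrite mulrC -ler_pdivlMr//; by rewrite ge_min lexx orbT.
have N0 : 0 <= a ^+ 2 + b ^+ 2 by rewrite addr_ge0// sqr_ge0.
have c0 : 0 < (cosh s)^-1 by rewrite invr_gt0 cosh_gt0.
have := ler_wpM2r N0 KE.
move=> /(ler_wpM2l (ltW iy0)) /(ler_wpM2l (ltW c0)) F.
rewrite [leLHS](_ : _ = (cosh s)^-1 * ((cos y)^-1 * (K * e * (a ^+ 2 + b ^+ 2)))); last by ring.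
apply: le_trans F _; rewrite le_eqVlt; apply/orP; left; apply/eqP; field.
by rewrite gt_eqF ?cosh_gt0 ?gt_eqF.
Qed.

Definition ccont (f : R -> R[i]) := continuous (Re \o f) /\ continuous (Im \o f).

Lemma ccontM f g : ccont f -> ccont g -> ccont (fun s => f s * g s).
Proof.
move=> [f1 f2] [g1 g2]; split => x.
- rewrite (_ : _ \o _ = (fun s => Re (f s) * Re (g s) - Im (f s) * Im (g s))); last first.
    by apply/funext => s /=; case: (f s) => ? ?; case: (g s).
  apply: (@continuousB _ _ _ (fun s => Re (f s) * Re (g s)) (fun s => Im (f s) * Im (g s))).
    by apply: (@continuousM _ _ (Re \o f) (Re \o g)); [exact: f1|exact: g1].
  by apply: (@continuousM _ _ (Im \o f) (Im \o g)); [exact: f2|exact: g2].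
- rewrite (_ : _ \o _ = (fun s => Re (f s) * Im (g s) + Im (f s) * Re (g s))); last first.
    by apply/funext => s /=; case: (f s) => ? ?; case: (g s).
  apply: (@continuousD _ _ _ (fun s => Re (f s) * Im (g s)) (fun s => Im (f s) * Re (g s))).
    by apply: (@continuousM _ _ (Re \o f) (Im \o g)); [exact: f1|exact: g2].
  by apply: (@continuousM _ _ (Im \o f) (Re \o g)); [exact: f2|exact: g1].
Qed.

Lemma ccontBr f (c : R[i]) : ccont f -> ccont (fun s => f s - c).
Proof.
move=> [f1 f2]; split => x.
- rewrite (_ : _ \o _ = (fun s => Re (f s) - Re c)); last first.
    by apply/funext => s /=; case: (f s) => ? ?; case: (c).
  by apply: (@continuousB _ _ _ (Re \o f) (cst (Re c))); [exact: f1|exact: cst_continuous].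
- rewrite (_ : _ \o _ = (fun s => Im (f s) - Im c)); last first.
    by apply/funext => s /=; case: (f s) => ? ?; case: (c).
  by apply: (@continuousB _ _ _ (Im \o f) (cst (Im c))); [exact: f2|exact: cst_continuous].
Qed.

Lemma ccontV f : (forall s, f s != 0) -> ccont f -> ccont (fun s => (f s)^-1).
Proof.
move=> f0 [f1 f2].
pose n s := Re (f s) ^+ 2 + Im (f s) ^+ 2.
have n0 s : n s != 0 by rewrite /n -normc_sqr sqrf_eq0 gt_eqF// normc_gt0.
have cn : continuous (fun s => (n s)^-1).
  move=> x; apply: (@continuousV _ _ n); first exact: n0.
  by apply: (@continuousD _ _ _ (fun s => Re (f s) ^+ 2) (fun s => Im (f s) ^+ 2));
    apply: (@continuous_comp _ _ _ _ (fun x : R => x ^+ 2));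
      [exact: f1|exact: exprn_continuous|exact: f2|exact: exprn_continuous].
split => x.
- rewrite (_ : _ \o _ = (fun s => Re (f s) * (n s)^-1)); last first.
    by apply/funext => s /=; rewrite /n; case: (f s).
  by apply: (@continuousM _ _ (Re \o f)); [exact: f1|exact: cn].
- rewrite (_ : _ \o _ = (fun s => - (Im (f s) * (n s)^-1))); last first.
    by apply/funext => s /=; rewrite /n; case: (f s) => ? ? /=; ring.
  apply: (@continuousN _ _ _ (fun s => Im (f s) * (n s)^-1)).
  by apply: (@continuousM _ _ (Im \o f)); [exact: f2|exact: cn].
Qed.

Lemma ccont_ccosh y : ccont (ccosh ^~ y).
Proof.
split => x.
- by apply: (@continuousM _ _ cosh (cst (cos y))); [exact: continuous_cosh|exact: cst_continuous].
- by apply: (@continuousM _ _ sinh (cst (sin y))); [exact: continuous_sinh|exact: cst_continuous].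
Qed.

Lemma ccont_csinh y : ccont (csinh ^~ y).
Proof.
split => x.
- by apply: (@continuousM _ _ sinh (cst (cos y))); [exact: continuous_sinh|exact: cst_continuous].
- by apply: (@continuousM _ _ cosh (cst (sin y))); [exact: continuous_cosh|exact: cst_continuous].
Qed.

Definition decay (f : R -> R) := continuous f /\ exists M, forall s, `|f s| <= M / cosh s.

Lemma decay_ccosh y (f : R -> R[i]) M : 0 < cos y -> ccont f -> (forall s, normc (f s) <= M) ->
  decay (fun s => Re (f s / ccosh s y)) /\ decay (fun s => Im (f s / ccosh s y)).
Proof.
move=> y0 cf fM.
have [c1 c2] := ccontM cf (ccontV (fun s => @ccosh_neq0 y s y0) (ccont_ccosh y)).
have M0 : 0 <= M := le_trans (normc_ge0 _) (fM 0).
have H s : normc (f s / ccosh s y) <= M * (cos y)^-1 / cosh s.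
  rewrite normcM -mulrA; apply: ler_pM; rewrite ?normc_ge0//; exact: normc_ccoshV.
split; split => //; exists (M * (cos y)^-1) => s; apply: le_trans (H s).
  exact: normc_Re.
exact: normc_Im.
Qed.

Lemma decayZ k f : decay f -> decay (fun s => k * f s).
Proof.
move=> [cf [M fM]]; split.
  by move=> x; apply: (@continuousM _ _ (cst k) f); [exact: cst_continuous|exact: cf].
by exists (`|k| * M) => s; rewrite normrM -mulrA ler_wpM2l.
Qed.

Lemma decay_kap y : 0 < cos y ->
  [/\ decay (kap y), decay (kap1 y), decay (kap2 y), decay (kap3 y) & decay (kap4 y)].
Proof.
move=> y0.
have cT : ccont (ctanh ^~ y).
  exact: ccontM (ccont_csinh y) (ccontV (fun s => @ccosh_neq0 y s y0) (ccont_ccosh y)).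
have [d1 d2] := decay_ccosh y0 cT (fun s => normc_ctanh s y0).
have cT2 : ccont (fun s => ctanh s y ^+ 2 - 2^-1).
  by apply: ccontBr; under eq_fun do rewrite expr2; exact: ccontM.
have [|d3 d4] := @decay_ccosh y (fun s => ctanh s y ^+ 2 - 2^-1) ((cos y)^-1 ^+ 2 + normc (- 2^-1 : R[i])) y0 cT2.
  move=> s; apply: le_trans (normcD _ _) _; rewrite lerD2r normcX.
  rewrite ler_sqr ?nnegrE ?normc_ge0 ?invr_ge0 ?(ltW y0)//; exact: normc_ctanh.
have [||d0 _] := @decay_ccosh y (fun=> 1) 1 y0.
- by split => x; exact: cst_continuous.
- by move=> s; rewrite normc1.
split.
- rewrite (_ : kap y = (fun s => pi^-1 * Re (1 / ccosh s y))); first exact: decayZ.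
  by apply/funext => s; rewrite kapE mulrC div1r.
- rewrite (_ : kap1 y = (fun s => - pi^-1 * Re (ctanh s y / ccosh s y))); first exact: decayZ.
  by apply/funext => s; rewrite /kap1 mulrC mulrN mulNr.
- rewrite (_ : kap2 y = (fun s => pi^-1 * Im (ctanh s y / ccosh s y))); first exact: decayZ.
  by apply/funext => s; rewrite /kap2 mulrC.
- rewrite (_ : kap3 y = (fun s => pi^-1 * Re ((ctanh s y ^+ 2 - 2^-1) / ccosh s y))); first exact: decayZ.
  by apply/funext => s; rewrite /kap3 mulrC.
- rewrite (_ : kap4 y = (fun s => (- 2 / pi) * Im ((ctanh s y ^+ 2 - 2^-1) / ccosh s y))); first exact: decayZ.
  by apply/funext => s; rewrite /kap4 mulrAC.
Qed.

End kernel_taylor.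

(** * Extension of boundary values to the strip *)

Section strip_extension.
Context {R : realType}.
Implicit Types (a b s x y u : R) (phi g : R -> R).

(** Quadratic growth covers both [|s|^p] for [p <= 2] and the comparison function [s^2]. *)
Definition wadm phi := continuous phi /\ exists M, forall s, `|phi s| <= M * (1 + s ^+ 2).

(** [1 + s^2 <= 8 exp(|s|/2)] by the second-order term of the exponential series, and
    [1 / cosh s <= 2 exp(-|s|)]. *)
Lemma sqr_cosh_ew s : (1 + s ^+ 2) / cosh s <= 16 * ew s.
Proof.
have h1 : 1 + s ^+ 2 <= 8 * expR (`|s| / 2).
  have := @expR_ge1Dxn R (`|s| / 2) 1; rewrite divr_ge0// => /(_ isT).
  rewrite exprMn real_normK ?num_real// (_ : 2%N`!%:R = 2)//; have := sqr_ge0 s; lra.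
have h2 := cosh_ge_exp s.
have e0 := expR_gt0 (`|s| / 2).
have E : expR `|s| = expR (`|s| / 2) ^+ 2 by rewrite expr2 -expRD; congr expR; field.
rewrite ler_pdivrMr ?cosh_gt0// /ew expRN.
apply: le_trans h1 _; rewrite -mulrA.
have -> : 16 * ((expR (`|s| / 2))^-1 * cosh s) = (16 * cosh s) / expR (`|s| / 2) by field; rewrite gt_eqF.
rewrite ler_pdivlMr//; move: h2; rewrite E expr2; lra.
Qed.

Lemma adm_wdecay phi g x : wadm phi -> decay g -> adm (fun u => phi (u + x) * g u).
Proof.
move=> [cp [M pM]] [cg [N gN]]; split.
  move=> u; apply: (@continuousM _ _ (fun u => phi (u + x)) g); last exact: cg.
  apply: (@continuous_comp _ _ _ (fun u => u + x) phi); last exact: cp.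
  by apply: (@continuousD _ _ _ id (cst x)); [|exact: cst_continuous].
have M0 : 0 <= M.
  by have := le_trans (normr_ge0 _) (pM 0); rewrite expr0n addr0 mulr1.
have N0 : 0 <= N.
  by have := le_trans (normr_ge0 _) (gN 0); rewrite cosh0 divr1.
exists (M * (2 * (1 + x ^+ 2)) * N * 16) => u; rewrite normrM.
apply: le_trans (ler_pM (normr_ge0 _) (normr_ge0 _) (pM _) (gN _)) _.
have h : 1 + (u + x) ^+ 2 <= 2 * (1 + x ^+ 2) * (1 + u ^+ 2).
  have := sqr_ge0 (u - x); have := sqr_ge0 (u * x); nra.
have c0 := cosh_gt0 u.
apply: le_trans (_ : _ <= M * (2 * (1 + x ^+ 2)) * N * ((1 + u ^+ 2) / cosh u)) _.
  rewrite (_ : M * (2 * (1 + x ^+ 2)) * N * ((1 + u ^+ 2) / cosh u) =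
      M * (2 * (1 + x ^+ 2) * (1 + u ^+ 2)) * (N / cosh u)); last by ring.
  by rewrite ler_wpM2r ?divr_ge0 ?(ltW c0)// ler_wpM2l.
rewrite -[leRHS]mulrA; apply: ler_wpM2l; last exact: sqr_cosh_ew.
by rewrite !mulr_ge0// addr_ge0// sqr_ge0.
Qed.

(* Poisson extension to the strip [|y| < pi/2] of the boundary values [phi] on [y = pi/2] and [y = -pi/2]. *)
Definition W phi x y := lint (fun u => phi (u + x) * kap y u).

Lemma cos_near y : 0 < cos y -> exists2 rho, 0 < rho & forall b, `|b| <= rho -> 0 < cos (y + b).
Proof.
move=> y0; have := @continuous_cos R y => /cvgrPdist_lt /(_ _ y0) /nbhs_ballP[rho /= r0 H].
exists (rho / 2); first by rewrite divr_gt0.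
move=> b br; have := H (y + b); rewrite /ball/= opprD addrA subrr add0r normrN.
have -> : `|b| < rho by lra.
by move=> /(_ isT); rewrite ltr_norml => /andP[_]; lra.
Qed.

(** [phi] need not be differentiable, so the increment in [x] is moved to the kernel. *)
Lemma W_shift phi x y a : wadm phi -> 0 < cos y ->
  W phi (x + a) y = lint (fun u => phi (u + x) * kap y (u - a)).
Proof.
move=> wp y0; have [dk _ _ _ _] := decay_kap y0.
rewrite /W -(lint_shift (- a) (adm_wdecay (x + a) wp dk)).
apply: eq_lint => u; congr (phi _ * _); ring.
Qed.

Lemma decay_coshV : decay (fun s : R => (cosh s)^-1).
Proof.
split; last by exists 1 => s; rewrite mul1r ger0_norm// invr_ge0 ltW// cosh_gt0.
move=> s; apply: (@continuousV _ _ cosh); first by rewrite gt_eqF// cosh_gt0.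
exact: continuous_cosh.
Qed.

Lemma wadm_norm phi : wadm phi -> wadm (fun s => `|phi s|).
Proof.
move=> [cp [M pM]]; split; last by exists M => s; rewrite normr_id.
by move=> x; apply: continuous_comp; [exact: cp|exact: norm_continuous].
Qed.

(** Differentiation under the integral sign: the remainder of the kernel is small relative to
    [1 / cosh], which is integrable against [|phi|]. The same [A] in front of [a^2] and [- b^2] is
    the harmonicity of the extension. *)
Lemma W_taylor phi x y : wadm phi -> 0 < cos y ->
  exists W1 W2 A B, forall eta, 0 < eta -> exists2 rho, 0 < rho &
    forall a b, `|a| <= rho -> `|b| <= rho ->
    `|W phi (x + a) (y + b) - W phi x y - W1 * a - W2 * b - A * (a ^+ 2 - b ^+ 2) - B * (a * b)|
    <= eta * (a ^+ 2 + b ^+ 2).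
Proof.
move=> wp y0; have [d0 d1 d2 d3 d4] := decay_kap y0.
pose L g := lint (fun u => phi (u + x) * g u).
exists (- L (kap1 y)), (L (kap2 y)), (L (kap3 y)), (- L (kap4 y)) => eta e0.
pose J := lint (fun u => `|phi (u + x)| * (cosh u)^-1).
have J0 : 0 <= J by apply: lint_ge0 => u; rewrite mulr_ge0// invr_ge0 ltW// cosh_gt0.
(* [J + 1] rather than [J] keeps the divisor positive. *)
have e0' : 0 < eta / (J + 1) by rewrite divr_gt0//; lra.
have [r1 r10 H] := kap_taylor y0 e0'.
have [r2 r20 H2] := cos_near y0.
exists (Num.min r1 r2); first by rewrite lt_min r10.
move=> a b; rewrite !le_min => /andP[a1 a2] /andP[b1 b2].
have yb := H2 b b2; have [d0' _ _ _ _] := decay_kap yb.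
rewrite (W_shift _ _ wp yb).
have aS : adm (fun u => phi (u + x) * kap (y + b) (u - a)).
  have := adm_shift (- a) (adm_wdecay (x + a) wp d0').
  by congr adm; apply/funext => u; congr (phi _ * _); ring.
have ad g : decay g -> adm (fun u => phi (u + x) * g u) by exact: adm_wdecay.
have Z c g : decay g -> adm (fun u => c * (phi (u + x) * g u)) by move=> /ad; exact: admZ.
have A0 := admB aS (ad _ d0); have A1 := admB A0 (Z (- a) _ d1); have A2 := admB A1 (Z b _ d2).
have A3 := admB A2 (Z (a ^+ 2 - b ^+ 2) _ d3); have A4 := admB A3 (Z (- a * b) _ d4).
have -> : lint (fun u => phi (u + x) * kap (y + b) (u - a)) - W phi x y - - L (kap1 y) * a - L (kap2 y) * b -
    L (kap3 y) * (a ^+ 2 - b ^+ 2) - - L (kap4 y) * (a * b) =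
  lint (fun u => phi (u + x) * kap (y + b) (u - a) - phi (u + x) * kap y u
     - - a * (phi (u + x) * kap1 y u) - b * (phi (u + x) * kap2 y u)
     - (a ^+ 2 - b ^+ 2) * (phi (u + x) * kap3 y u) - (- a * b) * (phi (u + x) * kap4 y u)).
  rewrite (lintB A3 (Z _ _ d4)) (lintB A2 (Z _ _ d3)) (lintB A1 (Z _ _ d2)) (lintB A0 (Z _ _ d1)) (lintB aS (ad _ d0)).
  rewrite (lintZ _ (ad _ d1)) (lintZ _ (ad _ d2)) (lintZ _ (ad _ d3)) (lintZ _ (ad _ d4)) /W /L.
  by move: (lint _) (lint _) (lint _) (lint _) (lint _) (lint _) => ? ? ? ? ? ?; ring.
apply: le_trans (normr_lint A4) _.
have aJ : adm (fun u => `|phi (u + x)| * (cosh u)^-1).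
  by apply: (@adm_wdecay (fun s => `|phi s|)); [exact: wadm_norm|exact: decay_coshV].
apply: le_trans (_ : lint (fun u => (eta / (J + 1) * (a ^+ 2 + b ^+ 2)) * (`|phi (u + x)| * (cosh u)^-1)) <= _).
  apply: le_lint; [|exact: admZ|].
    exact: adm_norm A4.
  move=> u.
  have -> : phi (u + x) * kap (y + b) (u - a) - phi (u + x) * kap y u
     - - a * (phi (u + x) * kap1 y u) - b * (phi (u + x) * kap2 y u)
     - (a ^+ 2 - b ^+ 2) * (phi (u + x) * kap3 y u) - (- a * b) * (phi (u + x) * kap4 y u) =
    phi (u + x) * (kap (y + b) (u + - a) - kap y u - - a * kap1 y u - b * kap2 y u
     - ((- a) ^+ 2 - b ^+ 2) * kap3 y u - - a * b * kap4 y u) by rewrite sqrrN; ring.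
  rewrite normrM [leRHS]mulrCA; apply: ler_wpM2l => //.
  by have := H (- a) b u; rewrite normrN sqrrN; apply.
rewrite lintZ// -/J.
have N0 : 0 <= a ^+ 2 + b ^+ 2 by rewrite addr_ge0// sqr_ge0.
rewrite mulrAC; apply: ler_wpM2r => //.
rewrite mulrAC ler_pdivrMr; last by lra.
by rewrite ler_wpM2l ?ltW//; lra.
Qed.

End strip_extension.

Section strip_kernel.
Context {R : realType}.
Implicit Types (a b s x y u : R) (phi g : R -> R).

Lemma kapN y s : kap y (- s) = kap y s.
Proof. by rewrite kap.unlock coshN sinhN sqrrN. Qed.

Lemma kapNy y s : kap (- y) s = kap y s.
Proof. by rewrite kap.unlock cosN. Qed.

Lemma kap_den_gt0 y s : 0 < cos y -> 0 < sinh s ^+ 2 + cos y ^+ 2.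
Proof. by move=> y0; rewrite ltr_wpDl ?sqr_ge0// exprn_gt0. Qed.

Lemma kap_ge0 y s : 0 < cos y -> 0 <= kap y s.
Proof.
move=> y0; rewrite kap.unlock divr_ge0 ?pi_ge0// divr_ge0 ?(ltW (kap_den_gt0 _ _))//.
by rewrite mulr_ge0 ?(ltW y0)// ltW// cosh_gt0.
Qed.

Lemma sinh_ge_half s : 0 <= s -> s / 2 <= sinh s.
Proof.
move=> s0; rewrite sinhE; have := expR_ge1Dx s; have : expR (- s) <= 1.
  by rewrite expR_le1 oppr_le0.
lra.
Qed.

Lemma sinh_sqr_ge s : s ^+ 2 <= 4 * sinh s ^+ 2.
Proof.
have [s0|s0] := leP 0 s; first by have := sinh_ge_half s0; nra.
have : 0 <= - s by lra.
by move=> /sinh_ge_half; rewrite sinhN; nra.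
Qed.

(** [atan(sinh s / cos y) / pi] is a primitive; it vanishes at 0 and tends to 1/2. *)
Lemma lint_kap y : 0 < cos y -> lint (kap y) = 1.
Proof.
move=> y0.
have [[ck _] _ _ _ _] := decay_kap y0.
pose F (s : R) := atan (sinh s / cos y) / pi.
have dF (s : R) : is_derive s 1 F (kap y s).
  have dt : is_derive s 1 (fun s => sinh s / cos y) (cosh s / cos y).
    have dd := is_derive_sinh s.
    by apply: is_derive_eq; rewrite /GRing.scale/=; field; rewrite gt_eqF.
  have da : is_derive s 1 (atan \o (fun s => sinh s / cos y)) ((1 + (sinh s / cos y) ^+ 2)^-1 * (cosh s / cos y)).
    exact: is_derive1_comp.
  rewrite /F (_ : (fun s => atan (sinh s / cos y) / pi) = (fun s => pi^-1 *: (atan \o (fun s => sinh s / cos y)) s)); last first.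
    by apply/funext => t; rewrite /GRing.scale/= mulrC.
  apply: is_derive_eq; rewrite kap.unlock /GRing.scale/=.
  move: (@pi R) (pi_gt0 R) (kap_den_gt0 s y0) => P P0 h1; field.
  by rewrite !gt_eqF.
have cF : continuous F.
  by move=> x; apply: differentiable_continuous; apply/derivable1_diffP; case: (dF x).
have p0 := pi_gt0 R.
rewrite lintE /Rintegral ge0_symfun_integralT//.
- rewrite -set_itvcy (@ge0_continuous_FTC2y R _ F 0 (2^-1)).
  + by rewrite /F sinh0 mul0r atan0 mul0r -EFinB -EFinM/=; field.
  + by move=> x _; exact: kap_ge0.
  + exact: continuous_subspaceT.
  + rewrite (_ : 2^-1 = pi / 2 / pi :> R); last by rewrite mulrAC divff ?mul1r ?gt_eqF.
    apply: cvgM; last exact: cvg_cst.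
    apply: (@cvg_comp _ _ _ (fun s : R => sinh s / cos y) atan _ _ _ _ (@cvgy_atan R)).
    apply: gt0_cvgMly; first by rewrite invr_gt0.
    apply: (@ger_cvgy _ _ _ _ (fun s : R => s * 2^-1)).
      by near=> s; apply: sinh_ge_half; near: s; apply: nbhs_pinfty_ge; rewrite num_real.
    by apply: gt0_cvgMly => //; exact: cvg_id.
  + by move=> x _; case: (dF x).
  + by apply: cvg_at_right_filter; exact: cF.
  + by move=> x _; rewrite derive1E; case: (dF x).
- by move=> x; exact: kap_ge0.
- by move=> x; rewrite /= kapN.
Unshelve. all: by end_near. Qed.

Lemma wadm_cst c : wadm (cst c : R -> R).
Proof.
split; first exact: cst_continuous.
by exists `|c| => s /=; rewrite ler_peMr// lerDl sqr_ge0.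
Qed.

Lemma wadm_sqr : wadm (fun s : R => s ^+ 2).
Proof.
split; first exact: exprn_continuous.
by exists 1 => s; rewrite ger0_norm ?sqr_ge0//; lra.
Qed.

Lemma wadm_powR p : 1 <= p <= 2 -> wadm (fun s : R => `|s| `^ p).
Proof.
move=> p12; split; first by apply: continuous_powR; lra.
by exists 1 => s; rewrite ger0_norm ?powR_ge0// mul1r; exact: powR_le_1sqr.
Qed.

Lemma WNy phi x y : W phi x (- y) = W phi x y.
Proof. by apply: eq_lint => u; rewrite kapNy. Qed.

Lemma adm_W phi x y : wadm phi -> 0 < cos y -> adm (fun u => phi (u + x) * kap y u).
Proof. by move=> wp y0; have [d _ _ _ _] := decay_kap y0; exact: adm_wdecay. Qed.

Lemma W_reflect phi x y : wadm phi -> 0 < cos y ->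
  W phi x y = lint (fun u => phi (- u + x) * kap y u).
Proof.
move=> wp y0; rewrite /W -(lint_opp (adm_W x wp y0)).
by apply: eq_lint => u; rewrite kapN.
Qed.

Lemma adm_W_reflect phi x y : wadm phi -> 0 < cos y -> adm (fun u => phi (- u + x) * kap y u).
Proof.
move=> wp y0; have := adm_opp (adm_W x wp y0).
by congr adm; apply/funext => u; rewrite kapN.
Qed.

(** The kernel is even, so the data may be averaged over [x + u] and [x - u]; convexity and Clarkson
    bounds apply to such sums. *)
Lemma W_sym2 phi x y : wadm phi -> 0 < cos y ->
  2 * W phi x y = lint (fun u => (phi (x + u) + phi (x - u)) * kap y u).
Proof.
move=> wp y0; rewrite (_ : 2 * _ = W phi x y + W phi x y); last by ring.
rewrite {2}(W_reflect _ wp y0) -lintD; [|exact: adm_W|exact: adm_W_reflect].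
by apply: eq_lint => u; rewrite mulrDl [x + u]addrC [x - u]addrC.
Qed.

Lemma W_even phi x y : (forall s, phi (- s) = phi s) -> wadm phi -> 0 < cos y ->
  W phi (- x) y = W phi x y.
Proof.
move=> pe wp y0; rewrite (W_reflect x wp y0); apply: eq_lint => u.
by rewrite -[in RHS]pe opprD opprK.
Qed.

Lemma W_continuous phi x y : wadm phi -> 0 < cos y -> forall eta, 0 < eta ->
  exists2 rho, 0 < rho & forall a b, `|a| <= rho -> `|b| <= rho ->
    `|W phi (x + a) (y + b) - W phi x y| <= eta.
Proof.
move=> wp y0 eta e0; have [W1 [W2 [A [B H]]]] := W_taylor x wp y0.
have [r1 r10 {}H] := H 1 ltr01.
pose M := `|W1| + `|W2| + `|A| * 2 + `|B| + 2.
have M0 : 0 < M by rewrite /M; have := normr_ge0 W1; have := normr_ge0 W2; have := normr_ge0 A; have := normr_ge0 B; lra.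
exists (Num.min r1 (Num.min 1 (eta / M))); first by rewrite !lt_min r10 ltr01 divr_gt0.
move=> a b; rewrite !le_min => /and3P[a1 a2 a3] /and3P[b1 b2 b3].
have := H a b a1 b1.
set t := eta / M in a3 b3; have tM : t * M = eta by rewrite /t divfK// gt_eqF.
have t0 : 0 < t by rewrite divr_gt0.
have aa : `|a| * `|a| <= t by have := normr_ge0 a; nra.
have bb : `|b| * `|b| <= t by have := normr_ge0 b; nra.
have ab : `|a| * `|b| <= t by have := normr_ge0 a; have := normr_ge0 b; nra.
set D := W phi (x + a) (y + b) - W phi x y; set E := D - _ - _ - _ - _ => hE.
have -> : D = E + W1 * a + W2 * b + A * (a ^+ 2 - b ^+ 2) + B * (a * b) by rewrite /E; ring.
apply: le_trans (ler_normD _ _) _.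
have := ler_normD (E + W1 * a + W2 * b) (A * (a ^+ 2 - b ^+ 2)).
have := ler_normD (E + W1 * a) (W2 * b); have := ler_normD E (W1 * a).
rewrite !normrM -tM /M.
have : `|a ^+ 2 - b ^+ 2| <= t * 2.
  by apply: le_trans (ler_normB _ _) _; rewrite !normrX !expr2; lra.
move=> hab.
have := ler_wpM2l (normr_ge0 W1) a3; have := ler_wpM2l (normr_ge0 W2) b3.
have := ler_wpM2l (normr_ge0 A) hab; have := ler_wpM2l (normr_ge0 B) ab.
have : 1 * (a ^+ 2 + b ^+ 2) <= t * 2.
  have -> : 1 * (a ^+ 2 + b ^+ 2) = `|a| ^+ 2 + `|b| ^+ 2 by rewrite !real_normK ?num_real// mul1r.
  by rewrite !expr2; lra.
lra.
Qed.

Lemma W_continuous_y phi x y : wadm phi -> 0 < cos y -> {for y, continuous (W phi x)}.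
Proof.
move=> wp y0; apply/cvgrPdist_le => eta e0.
have [rho r0 H] := W_continuous x wp y0 e0.
apply/nbhs_ballP; exists rho => // z; rewrite /ball/= => yz.
have := H 0 (z - y); rewrite normr0 addr0 (addrC y) subrK distrC => H'.
by rewrite distrC H'// ltW.
Qed.

(** The second-order coefficients in [x] and in [y] are opposite, so the sign of one gives the sign
    of the other. *)
Lemma W_taylor_y phi x y : wadm phi -> 0 < cos y ->
  exists A, [/\ forall eta, 0 < eta -> exists2 rho, 0 < rho &
      forall a, `|a| <= rho -> `|W phi (x + a) y + W phi (x - a) y - 2 * W phi x y - 2 * A * a ^+ 2| <= eta * a ^+ 2,
    sdge (fun b => W phi x (y + b)) (- (2 * A)) & sdge (fun b => - W phi x (y + b)) (2 * A)].
Proof.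
move=> wp y0; have [W1 [W2 [A [B H]]]] := W_taylor x wp y0.
exists A.
have pe : peano (fun b => W phi x (y + b)) W2 (- A).
  move=> eta e0; have [rho r0 {}H] := H eta e0; exists rho => // b br.
  have := H 0 b; rewrite normr0 (ltW r0) => /(_ isT br); rewrite !addr0 expr0n/=.
  rewrite add0r; congr (`|_| <= _); ring.
split.
- move=> eta e0; have e20 : 0 < eta / 2 by lra.
  have [rho r0 {}H] := H _ e20; exists rho => // a ar.
  have := H a 0; have := H (- a) 0; rewrite normrN normr0 (ltW r0) ar => /(_ isT isT) h1 /(_ isT isT) h2.
  move: h1 h2; rewrite !addr0 sqrrN expr0n/= !addr0 => h1 h2.
  have := lerD h2 h1; rewrite (_ : eta / 2 * a ^+ 2 + eta / 2 * a ^+ 2 = eta * a ^+ 2); last by field.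
  move=> /(le_trans (ler_normD _ _)).
  congr (`|_| <= _); ring.
- by have := peano_sdge pe; rewrite mulrN.
- by have := peano_sdge (peanoN pe); rewrite opprK.
Qed.

Lemma W_taylor_convex phi x y : wadm phi -> 0 < cos y ->
  (forall s t, 2 * phi s <= phi (s + t) + phi (s - t)) ->
  forall a, 2 * W phi x y <= W phi (x + a) y + W phi (x - a) y.
Proof.
move=> wp y0 cv a; rewrite /W -lintZ; last exact: adm_W.
rewrite -lintD; [|exact: adm_W|exact: adm_W].
apply: le_lint; [exact/admZ/adm_W|by apply: admD; exact: adm_W|] => u.
rewrite mulrA -mulrDl ler_wpM2r ?kap_ge0// !addrA; exact: cv.
Qed.

Lemma limit_ge0 (A : R) (f : R -> R) :
  (forall eta, 0 < eta -> exists2 rho, 0 < rho & forall a, `|a| <= rho ->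
     `|f a - 2 * A * a ^+ 2| <= eta * a ^+ 2) -> (forall a, 0 <= f a) -> 0 <= A.
Proof.
move=> H f0; rewrite leNgt; apply/negP => A0.
have nA : 0 < - A by lra.
have [rho r0 {}H] := H _ nA.
have := H rho; rewrite ger0_norm ?(ltW r0)// lexx => /(_ isT).
rewrite ler_norml => /andP[_]; have := f0 rho; have : 0 < rho ^+ 2 by rewrite exprn_gt0.
nra.
Qed.

(* For midpoint convex boundary values the extension is convex in [x], hence, being harmonic, concave in [y]. *)
Lemma W_le_y phi x y z : wadm phi -> (forall s t, 2 * phi s <= phi (s + t) + phi (s - t)) ->
  `|y| <= z -> z < pi / 2 -> W phi x z <= W phi x y.
Proof.
move=> wp cv yz zp.
have z0 : 0 <= z := le_trans (normr_ge0 y) yz.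
have c0 t : - z <= t <= z -> 0 < cos t by move=> /andP[? ?]; apply: cos_gt0_pihalf; apply/andP; split; lra.
have [z00|zn0] := eqVneq z 0.
  have -> : y = 0 by apply/eqP; rewrite -normr_eq0 eq_le normr_ge0 andbT -z00.
  by rewrite z00.
have zp0 : 0 < z by rewrite lt_def zn0.
rewrite -lerN2; apply: (@max_principle1 R (fun t => - W phi x t) z) => //.
- apply: (@continuous_in_subspaceT) => t; rewrite inE/= in_itv/= => /c0 ct.
  by apply: (@continuousN _ _ _ (W phi x)); exact: W_continuous_y.
- move=> t /andP[t1 t2]; have ct : 0 < cos t by apply: c0; lra.
  have [A [h1 _ h3]] := W_taylor_y x wp ct.
  apply: sdge_weaken h3; suff : 0 <= A by lra.
  apply: (limit_ge0 h1) => a; have := W_taylor_convex x wp ct cv a; lra.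
- by rewrite WNy.
- by rewrite -ler_norml.
Qed.

(** [(x + u)^2 + (x - u)^2 = 2 x^2 + 2 u^2], and the kernel has mass 1. *)
Lemma W_sqr x y : 0 < cos y -> W (fun s => s ^+ 2) x y = x ^+ 2 + W (fun s => s ^+ 2) 0 y.
Proof.
move=> y0; have H (z : R) := W_sym2 z wadm_sqr y0.
suff : 2 * W (fun s => s ^+ 2) x y - 2 * W (fun s => s ^+ 2) 0 y = 2 * x ^+ 2 by lra.
have ak : adm (kap y).
  have := adm_W 0 (wadm_cst 1) y0; congr adm; apply/funext => u; by rewrite /= mul1r.
have as_ z : adm (fun u => ((z + u) ^+ 2 + (z - u) ^+ 2) * kap y u).
  have := admD (adm_W z wadm_sqr y0) (adm_W_reflect z wadm_sqr y0).
  congr adm; apply/funext => u; ring.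
rewrite !H -lintB//; transitivity (lint (fun u => (2 * x ^+ 2) * kap y u)).
  by apply: eq_lint => u; ring.
by rewrite lintZ// lint_kap// mulr1.
Qed.

(* [x^2 - y^2] and [W sqr] are harmonic with the same dependence on [x]. *)
Lemma W_sqr_y y : `|y| < pi / 2 -> W (fun s => s ^+ 2) 0 y = W (fun s => s ^+ 2) 0 0 - y ^+ 2.
Proof.
pose q (s : R) := s ^+ 2; rewrite -/q.
wlog y0 : y / 0 < y.
  move=> H yp; have [y0|y0|->] := ltgtP y 0; last by rewrite expr0n subr0.
    by have := H (- y); rewrite oppr_gt0 normrN WNy sqrrN; exact.
  exact: H.
rewrite gtr0_norm// => yp.
have c0 t : - y <= t <= y -> 0 < cos t by move=> /andP[? ?]; apply: cos_gt0_pihalf; apply/andP; split; lra.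
have sdq (t k : R) : peano (fun h => k * (t + h) ^+ 2) (2 * k * t) k.
  move=> eta e0; exists 1 => // h _.
  rewrite (_ : _ - _ = 0) ?normr0; last by rewrite addr0; ring.
  by rewrite mulr_ge0 ?sqr_ge0// ltW.
(* By [W_sqr] the second difference in [x] is exactly [2 a^2], which forces [A = 1]. *)
have A1 t : 0 < cos t -> exists A, [/\ A = 1, sdge (fun b => W q 0 (t + b)) (- (2 * A)) & sdge (fun b => - W q 0 (t + b)) (2 * A)].
  move=> ct; have [A [h1 h2 h3]] := W_taylor_y 0 wadm_sqr ct; exists A; split => //.
  have h (a : R) : W q (0 + a) t + W q (0 - a) t - 2 * W q 0 t = 2 * a ^+ 2.
    by rewrite (W_sqr (0 + a))// (W_sqr (0 - a))// add0r sub0r sqrrN; ring.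
  apply/eqP; rewrite eq_le; apply/andP; split.
    rewrite -subr_ge0; apply: (@limit_ge0 _ (fun=> 0)) => // eta e0.
    have [rho r0 {}h1] := h1 eta e0; exists rho => // a /h1; rewrite h sub0r normrN.
    congr (_ <= _); congr `|_|; ring.
  rewrite -subr_ge0; apply: (@limit_ge0 _ (fun=> 0)) => // eta e0.
  have [rho r0 {}h1] := h1 eta e0; exists rho => // a /h1; rewrite h sub0r normrN.
  congr (_ <= _); rewrite -normrN; congr `|_|; ring.
have cont (e : R) : {within `[- y, y], continuous (fun t => e * W q 0 t + e * t ^+ 2)}.
  apply: (@continuous_in_subspaceT) => t; rewrite inE/= in_itv/= => /c0 ct.
  apply: (@continuousD _ _ _ (fun t => e * W q 0 t) (fun t => e * t ^+ 2)).
    apply: (@continuousM _ _ (cst e) (W q 0)); first exact: cst_continuous.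
    by apply: W_continuous_y => //; exact: wadm_sqr.
  apply: (@continuousM _ _ (cst e) (fun t : R => t ^+ 2)); first exact: cst_continuous.
  exact: exprn_continuous.
(* [W q 0 t + t^2] and its negative both have second-order coefficient 0 and take equal values at
   [y] and [- y]; the maximum principle for each gives the two inequalities at 0. *)
apply/eqP; rewrite eq_le; apply/andP; split.
  have := @max_principle1 R (fun t => -1 * W q 0 t + -1 * t ^+ 2) y (- W q 0 y - y ^+ 2) y0 (cont (-1)).
  have h : forall x : R, - y < x < y -> sdge (fun h => - 1 * W q 0 (x + h) + - 1 * (x + h) ^+ 2) 0.
    move=> t /andP[t1 t2]; have ct : 0 < cos t by apply: c0; lra.
    have [A [E _ h3]] := A1 t ct.
    have := sdgeD h3 (peano_sdge (sdq t (-1))).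
    rewrite E (_ : 2 * 1 + 2 * -1 = 0 :> R); last by ring.
    by congr sdge; apply/funext => h; rewrite mulN1r.
  move=> /(_ h); rewrite WNy sqrrN; have -> : - 1 * W q 0 y + - 1 * y ^+ 2 = - W q 0 y - y ^+ 2 by ring.
  move=> /(_ (lexx _) (lexx _) 0); rewrite expr0n/= => H.
  suff : -1 * W q 0 0 + -1 * 0 <= - W q 0 y - y ^+ 2 by lra.
  by apply: H; apply/andP; split; lra.
have := @max_principle1 R (fun t => 1 * W q 0 t + 1 * t ^+ 2) y (W q 0 y + y ^+ 2) y0 (cont 1).
have h : forall x : R, - y < x < y -> sdge (fun h => 1 * W q 0 (x + h) + 1 * (x + h) ^+ 2) 0.
  move=> t /andP[t1 t2]; have ct : 0 < cos t by apply: c0; lra.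
  have [A [E h2 _]] := A1 t ct.
  have := sdgeD h2 (peano_sdge (sdq t 1)).
  rewrite E (_ : - (2 * 1) + 2 * 1 = 0 :> R); last by ring.
  by congr sdge; apply/funext => h; rewrite !mul1r.
move=> /(_ h); rewrite WNy sqrrN; have -> : 1 * W q 0 y + 1 * y ^+ 2 = W q 0 y + y ^+ 2 by ring.
move=> /(_ (lexx _) (lexx _) 0); rewrite expr0n/= => H.
suff : 1 * W q 0 0 + 1 * 0 <= W q 0 y + y ^+ 2 by lra.
by apply: H; apply/andP; split; lra.
Qed.

(** The bound [s^2 <= 4 sinh(s)^2] cancels the singularity that the kernel develops at [s = 0] as
    [cos y] tends to 0. *)
Lemma W_sqr_small : exists M, forall y, 0 < cos y -> W (fun s : R => s ^+ 2) 0 y <= M * cos y.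
Proof.
pose J := lint (fun s : R => (1 + (s + 0) ^+ 2) * (cosh s)^-1).
have wJ : wadm (fun s : R => 1 + s ^+ 2).
  split; last by exists 1 => s; rewrite mul1r ger0_norm// addr_ge0// sqr_ge0.
  by move=> x; apply: cvgD; [exact: cvg_cst|exact: exprn_continuous].
have aJ : adm (fun s : R => (1 + (s + 0) ^+ 2) * (cosh s)^-1).
  exact: (@adm_wdecay R (fun s => 1 + s ^+ 2) _ 0 wJ decay_coshV).
exists (4 / pi * J) => y y0.
have p0 := pi_gt0 R.
rewrite mulrAC -lintZ//; apply: le_lint; [exact: adm_W wadm_sqr y0|exact: admZ|].
move=> s /=; rewrite addr0 kap.unlock.
have c0 := cosh_gt0 s; have d0 := kap_den_gt0 s y0.
have -> : s ^+ 2 * (cosh s * cos y / (sinh s ^+ 2 + cos y ^+ 2) / pi) =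
  cos y / pi * (s ^+ 2 * cosh s / (sinh s ^+ 2 + cos y ^+ 2)).
  by move: (@pi R) p0 => P P0; field; rewrite !gt_eqF.
have -> : 4 / pi * cos y * ((1 + s ^+ 2) / cosh s) = cos y / pi * (4 * (1 + s ^+ 2) / cosh s).
  by move: (@pi R) p0 => P P0; field; rewrite !gt_eqF.
apply: ler_wpM2l; first by rewrite divr_ge0// ltW.
rewrite ler_pdivrMr// [leRHS]mulrAC ler_pdivlMr// -mulrA -expr2 cosh2.
have := sinh_sqr_ge s; have := sqr_ge0 s; have := sqr_ge0 (cos y); nra.
Qed.

End strip_kernel.

(** * Comparison of the kernels on the diagonal and at the centre *)

Section diagonal.
Context {R : realType}.
Implicit Types (s t x y X Y : R).

(** The product is 1 at 0 with slope 0, and its second derivative [- 2 sin t sinh t] is negative on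
    the interval. *)
Lemma cos_cosh_lt1 t : 0 < t < pi / 2 -> cos t * cosh t < 1.
Proof.
move=> /andP[t0 tp].
have d1 (s : R) : is_derive s 1 (fun s => cos s * cosh s) (cos s * sinh s - sin s * cosh s).
  have dd := is_derive_cosh s.
  by apply: is_derive_eq; rewrite /GRing.scale/=; ring.
have d2 (s : R) : is_derive s 1 (fun s => cos s * sinh s - sin s * cosh s) (- 2 * (sin s * sinh s)).
  have dd := is_derive_cosh s; have dd' := is_derive_sinh s.
  by apply: is_derive_eq; rewrite /GRing.scale/=; ring.
have cw (f df : R -> R) (a b : R) : (forall s : R, is_derive s 1 f (df s)) -> {within `[a, b], continuous f}.
  by move=> fd; apply: derivable_within_continuous => s _; case: (fd s).
have [c] := MVT t0 (fun s _ => d1 s) (cw _ _ 0 t d1).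
rewrite in_itv/= => /andP[c0 ct]; rewrite cos0 cosh0 mulr1 subr0 => E1.
have [d] := MVT c0 (fun s _ => d2 s) (cw _ _ 0 c d2).
rewrite in_itv/= => /andP[d0 dc]; rewrite sin0 sinh0 mulr0 mul0r !subr0 => E2.
have sd : 0 < sin d by apply: sin_gt0_pihalf; apply/andP; split; lra.
have hd := sinh_gt0 d0.
have : 0 < sin d * sinh d * c * t by rewrite !mulr_gt0.
move=> h; rewrite -subr_lt0 E1 E2.
have -> : -2 * (sin d * sinh d) * c * t = - 2 * (sin d * sinh d * c * t) by ring.
lra.
Qed.

Lemma sinh_ler x y : x <= y -> sinh x <= sinh y.
Proof.
move=> xy; rewrite !sinhE; have := xy; rewrite -ler_expR => h1.
have h2 : expR (- y) <= expR (- x) by rewrite ler_expR; lra.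
lra.
Qed.

Lemma sinh_sqr_le x y : x ^+ 2 <= y ^+ 2 -> sinh x ^+ 2 <= sinh y ^+ 2.
Proof.
have sn (z : R) : sinh z ^+ 2 = sinh `|z| ^+ 2.
  by case: (ger0P z) => // z0; rewrite sinhN sqrrN.
rewrite (sn x) (sn y) -(real_normK (num_real x)) -(real_normK (num_real y)).
rewrite !ler_sqr ?nnegrE ?normr_ge0 ?sinh_ge0//; exact: sinh_ler.
Qed.

(** Transfers a threshold for [sinh(s)^2], the variable of the quadratic, to one for [s^2], the
    variable of the concave power. *)
Lemma sinh_sqr_surj X : 0 < X -> exists2 Y, 0 < Y & forall s,
  (s ^+ 2 <= Y -> sinh s ^+ 2 <= X) /\ (Y <= s ^+ 2 -> X <= sinh s ^+ 2).
Proof.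
move=> X0; pose y := Num.sqrt X; have y0 : 0 < y by rewrite sqrtr_gt0.
have yX : y ^+ 2 = X by rewrite sqr_sqrtr// ltW.
pose r := Num.sqrt (1 + X); have rX : r ^+ 2 = 1 + X by rewrite sqr_sqrtr//; lra.
have r0 : 0 < r by rewrite sqrtr_gt0; lra.
(* The inverse hyperbolic sine of [y]. *)
pose a := ln (y + r).
have sa : sinh a = y.
  have z0 : 0 < y + r by rewrite addr_gt0.
  rewrite sinhE expRN lnK ?posrE//.
  have -> : (y + r)^-1 = r - y.
    have zn : y + r != 0 by rewrite gt_eqF.
    by apply: (mulIf zn); rewrite mulVf//; nra.
  by field.
have a0 : a != 0 by apply/eqP => a0; move: sa y0; rewrite a0 sinh0 => <-; rewrite ltxx.
exists (a ^+ 2); first by rewrite lt_def sqrf_eq0 a0 sqr_ge0.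
by move=> s; split => /sinh_sqr_le; rewrite sa yX.
Qed.

(** The discriminant is [(2 a X0 - b)^2] plus [4 a] times the value at [X0], hence positive. *)
Lemma quadratic_factor (a b c X0 : R) : 0 < a -> 0 < - a * X0 ^+ 2 + b * X0 + c ->
  exists r1 r2, [/\ r1 < r2, X0 < r2 &
    forall X, - a * X ^+ 2 + b * X + c = - a * ((X - r1) * (X - r2))].
Proof.
move=> a0 h; pose D := b ^+ 2 + 4 * a * c.
have DE : D = (2 * a * X0 - b) ^+ 2 + 4 * a * (- a * X0 ^+ 2 + b * X0 + c) by rewrite /D; ring.
have h4 : 0 < 4 * a * (- a * X0 ^+ 2 + b * X0 + c) by rewrite !mulr_gt0.
have D0 : 0 < D by rewrite DE; have := sqr_ge0 (2 * a * X0 - b); lra.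
pose d := Num.sqrt D; have d0 : 0 < d by rewrite sqrtr_gt0.
have dD : d ^+ 2 = D by rewrite sqr_sqrtr// ltW.
exists ((b - d) / (2 * a)), ((b + d) / (2 * a)); split.
- by rewrite ltr_pM2r ?invr_gt0 ?mulr_gt0//; lra.
- rewrite ltr_pdivlMr ?mulr_gt0//.
  suff : `|2 * a * X0 - b| < d by rewrite ltr_norml => /andP[_]; lra.
  by rewrite -ltr_sqr ?nnegrE ?(ltW d0)// real_normK ?num_real// dD DE; lra.
- move=> X; have -> : c = (d ^+ 2 - b ^+ 2) / (4 * a) by rewrite dD /D; field; rewrite gt_eqF.
  by field; rewrite gt_eqF.
Qed.

(* If the quadratic is positive exactly on [r1, r2], the concave function [Y `^ (p/2)] of [Y = s^2]
   is compared with its chord over the corresponding interval. *)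
Lemma concave_chord (a b c p : R) : 0 < a -> 1 <= p <= 2 ->
  exists A B, forall s, let X := sinh s ^+ 2 in
    0 <= (`|s| `^ p - A - B * s ^+ 2) * (- a * X ^+ 2 + b * X + c).
Proof.
move=> a0 p12; set q := fun X => - a * X ^+ 2 + b * X + c.
have al : 0 < p / 2 <= 1 by lra.
have [qn|/existsNP[X0 /not_implyP[X00 /negP]]] := pselect (forall X, 0 <= X -> q X <= 0).
  (* The quadratic is nowhere positive on the half line: take the tangent of [Y^(p/2)] at [Y = 1],
     which lies above the power. *)
  exists (1 - p / 2), (p / 2) => s /=; rewrite -/(q _).
  have h1 := qn _ (sqr_ge0 (sinh s)).
  have := powR_le_tangent1 (sqr_ge0 s) al; rewrite -powR_sqr => h2.
  by apply: mulr_le0 => //; lra.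
rewrite -ltNge => qX0.
have [r1 [r2 [r12 X0r2 qE]]] := quadratic_factor a0 qX0.
have r20 : 0 < r2 by apply: le_lt_trans X0r2.
have [Y2 Y20 H2] := sinh_sqr_surj r20.
have zero : (0 : R) `^ (p / 2) = 0 by rewrite powR0//; lra.
(* If [r1 <= 0], only the sign change at [r2] is visible for [X >= 0], and the chord starts at the
   origin. *)
have [r10|r10] := leP r1 0.
  exists 0, (Y2 `^ (p / 2) / Y2) => s /=; rewrite qE subr0 powR_sqr.
  set X := sinh s ^+ 2; set Y := s ^+ 2.
  have X00' : 0 <= X - r1 by rewrite subr_ge0 (le_trans r10)// sqr_ge0.
  have -> : (Y `^ (p / 2) - Y2 `^ (p / 2) / Y2 * Y) * (- a * ((X - r1) * (X - r2))) =
     (a * (X - r1) / Y2) * ((Y2 * Y `^ (p / 2) - Y * Y2 `^ (p / 2)) * (r2 - X)).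
    by field; rewrite gt_eqF.
  apply: mulr_ge0; first by rewrite divr_ge0 ?mulr_ge0// ltW.
  have Y0 : 0 <= Y by exact: sqr_ge0.
  have [YY|YY] := leP Y Y2.
    have h := (H2 s).1 YY.
    have := @powR_concave3 _ 0 Y Y2 (p / 2); rewrite lexx Y0 zero mulr0 !subr0 add0r => /(_ isT YY al) h2.
    by apply: mulr_ge0; rewrite subr_ge0.
  have h := (H2 s).2 (ltW YY).
  have := @powR_concave3 _ 0 Y2 Y (p / 2); rewrite lexx (ltW Y20) zero mulr0 !subr0 add0r => /(_ isT (ltW YY) al) h2.
  by apply: mulr_le0; rewrite subr_le0.
have [Y1 Y10 H1] := sinh_sqr_surj r10.
have Y12 : Y1 < Y2.
  rewrite ltNge; apply/negP => YY.
  have := (H2 (Num.sqrt Y2)).2; have := (H1 (Num.sqrt Y2)).1.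
  by rewrite sqr_sqrtr ?(ltW Y20)// YY lexx => /(_ isT) h1 /(_ isT) h2; lra.
(* Slope of the chord over [[Y1, Y2]], which is [[r1, r2]] expressed in the variable [s^2]. *)
pose B := (Y2 `^ (p / 2) - Y1 `^ (p / 2)) / (Y2 - Y1).
exists (Y1 `^ (p / 2) - B * Y1), B => s /=; rewrite qE powR_sqr.
set X := sinh s ^+ 2; set Y := s ^+ 2.
have d0 : 0 < Y2 - Y1 by lra.
have -> : (Y `^ (p / 2) - (Y1 `^ (p / 2) - B * Y1) - B * Y) * (- a * ((X - r1) * (X - r2))) =
  (a / (Y2 - Y1)) * (((Y2 - Y1) * Y `^ (p / 2) - (Y2 - Y) * Y1 `^ (p / 2) - (Y - Y1) * Y2 `^ (p / 2)) * ((X - r1) * (r2 - X))).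
  by rewrite /B; field; rewrite gt_eqF.
apply: mulr_ge0; first by rewrite divr_ge0// ltW.
have Y0 : 0 <= Y by exact: sqr_ge0.
have [YY|YY] := leP Y Y1.
  have h1 : X <= r1 := (H1 s).1 YY.
  have h2 : X <= r2 by lra.
  have := @powR_concave3 _ Y Y1 Y2 (p / 2); rewrite Y0 YY => /(_ isT (ltW Y12) al) h3.
  by apply: mulr_le0; [lra|apply: mulr_le0_ge0; lra].
have h1 : r1 <= X := (H1 s).2 (ltW YY).
have [YY2|YY2] := leP Y Y2.
  have h2 : X <= r2 := (H2 s).1 YY2.
  have := @powR_concave3 _ Y1 Y Y2 (p / 2); rewrite (ltW Y10) (ltW YY) => /(_ isT YY2 al) h3.
  by apply: mulr_ge0; [lra|apply: mulr_ge0; lra].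
have h2 : r2 <= X := (H2 s).2 (ltW YY2).
have := @powR_concave3 _ Y1 Y2 Y (p / 2); rewrite (ltW Y10) (ltW Y12) => /(_ isT (ltW YY2) al) h3.
by apply: mulr_le0; [lra|apply: mulr_ge0_le0; lra].
Qed.

(** Over a common denominator the numerator is a quadratic in [sinh(s)^2], the form that
    [concave_chord] takes; [cos_cosh_lt1] makes the leading coefficient negative. *)
Lemma kap_diag t s : 0 < cos t ->
  let k := cos t in let C := cosh t in let m := k ^+ 2 + sinh t ^+ 2 in let X := sinh s ^+ 2 in
  kap t (s - t) + kap t (s + t) - 2 * kap 0 s =
  (2 / pi / cosh s / ((m - X) ^+ 2 + 4 * k ^+ 2 * C ^+ 2 * X)) *
    (- (1 - k * C) * X ^+ 2 + (k * C * (1 + m) + 2 * m - 4 * k ^+ 2 * C ^+ 2) * X + (k * C * m - m ^+ 2)).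
Proof.
move=> t0 k C m X; rewrite kap.unlock cos0 expr1n mulr1 coshD sinhD [cosh (s + t)]coshD [sinh (s + t)]sinhD.
have h1 := kap_den_gt0 (s - t) t0; have h2 := kap_den_gt0 (s + t) t0.
move: h1 h2; rewrite coshN sinhN !sinhD coshN sinhN -/k -/C.
have := cosh2 s; have := cosh2 t; rewrite -/C /m /X.
have := cosh_gt0 s; have := cosh_gt0 t; rewrite -/C.
move: (@pi R) (pi_gt0 R) => P P0.
move: (cosh s) (sinh s) (sinh t) => c sg S C0 c0 C2 c2 h1 h2.
have E : (sg * C + c * - S) ^+ 2 + k ^+ 2 > 0 by [].
(* The product of the two shifted denominators depends on [s] only through [sinh(s)^2]. *)
have PE : ((sg * C + c * - S) ^+ 2 + k ^+ 2) * ((sg * C + c * S) ^+ 2 + k ^+ 2) =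
  (k ^+ 2 + S ^+ 2 - sg ^+ 2) ^+ 2 + 4 * k ^+ 2 * C ^+ 2 * sg ^+ 2.
  have -> : ((sg * C + c * - S) ^+ 2 + k ^+ 2) * ((sg * C + c * S) ^+ 2 + k ^+ 2) =
    (sg ^+ 2 * C ^+ 2 - c ^+ 2 * S ^+ 2) ^+ 2 + 2 * k ^+ 2 * (sg ^+ 2 * C ^+ 2 + c ^+ 2 * S ^+ 2) + k ^+ 4 by ring.
  by rewrite C2 c2; ring.
rewrite -PE.
apply: (mulfI (_ : P * c * (((sg * C + c * - S) ^+ 2 + k ^+ 2) * ((sg * C + c * S) ^+ 2 + k ^+ 2)) != 0)).
  by rewrite !mulf_neq0// gt_eqF.
transitivity (c * ((c * C + sg * - S) * k * ((sg * C + c * S) ^+ 2 + k ^+ 2) +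
   (c * C + sg * S) * k * ((sg * C + c * - S) ^+ 2 + k ^+ 2))
   - 2 * (c ^+ 2 / (sg ^+ 2 + 1)) * (((sg * C + c * - S) ^+ 2 + k ^+ 2) * ((sg * C + c * S) ^+ 2 + k ^+ 2))).
  have h3 : 0 < sg ^+ 2 + 1 by have := sqr_ge0 sg; lra.
  by field; rewrite !gt_eqF.
rewrite {1}c2 addrC [1 + _]addrC divff ?mulr1; last by have := sqr_ge0 sg; lra.
transitivity (2 * (- (1 - k * C) * (sg ^+ 2) ^+ 2 + (k * C * (1 + (k ^+ 2 + S ^+ 2)) + 2 * (k ^+ 2 + S ^+ 2) - 4 * k ^+ 2 * C ^+ 2) * sg ^+ 2 +
   (k * C * (k ^+ 2 + S ^+ 2) - (k ^+ 2 + S ^+ 2) ^+ 2))); last first.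
  by field; rewrite !gt_eqF.
rewrite PE.
have -> : c * ((c * C + sg * - S) * k * ((sg * C + c * S) ^+ 2 + k ^+ 2) + (c * C + sg * S) * k * ((sg * C + c * - S) ^+ 2 + k ^+ 2)) =
  2 * k * C * c ^+ 2 * (k ^+ 2 + sg ^+ 2 * C ^+ 2 + c ^+ 2 * S ^+ 2 - 2 * sg ^+ 2 * S ^+ 2) by ring.
by rewrite C2 c2; ring.
Qed.

End diagonal.

(** * The majorant *)

Section taylor_convex.
Context {R : realType} (phi : R -> R).
Hypothesis wp : wadm phi.

Lemma W_taylor_ge0 (x y : R) : 0 < cos y ->
  (forall s t, 2 * phi s <= phi (s + t) + phi (s - t)) ->
  exists W1 W2 A B, 0 <= A /\
  forall eta, 0 < eta -> exists2 rho, 0 < rho & forall a b, `|a| <= rho -> `|b| <= rho ->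
    `|W phi (x + a) (y + b) - W phi x y - W1 * a - W2 * b - A * (a ^+ 2 - b ^+ 2) - B * (a * b)|
    <= eta * (a ^+ 2 + b ^+ 2).
Proof.
move=> ct cv; have [W1 [W2 [A [B H]]]] := W_taylor x wp ct.
exists W1, W2, A, B; split => //.
apply: (@limit_ge0 _ _ (fun a => W phi (x + a) y + W phi (x - a) y - 2 * W phi x y)); last first.
  by move=> a; have := W_taylor_convex x wp ct cv a; lra.
move=> eta e0; have e20 : 0 < eta / 2 by lra.
have [rho r0 {}H] := H _ e20; exists rho => // a ar.
have := H a 0; have := H (- a) 0; rewrite normrN normr0 (ltW r0) ar => /(_ isT isT) h1 /(_ isT isT) h2.
move: h1 h2; rewrite !addr0 sqrrN expr0n/= !addr0 => h1 h2.
have := lerD h2 h1; rewrite (_ : eta / 2 * a ^+ 2 + eta / 2 * a ^+ 2 = eta * a ^+ 2); last by field.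
move=> /(le_trans (ler_normD _ _)); congr (`|_| <= _); ring.
Qed.

End taylor_convex.

Section majorant.
Context {R : realType} (p : R) (hp : 1 <= p <= 2).
Implicit Types (s t x y a b : R).

Let p0 : 0 < p. Proof. by move: hp => /andP[]; lra. Qed.

Definition Wp := W (fun s : R => `|s| `^ p).

Let wp : wadm (fun s : R => `|s| `^ p). Proof. exact: wadm_powR. Qed.

Lemma powR_abs_convex s t : 2 * `|s| `^ p <= `|s + t| `^ p + `|s - t| `^ p.
Proof. by apply: powR_convex_sym; move: hp => /andP[]. Qed.

Lemma adm_cst_kap c y : 0 < cos y -> adm (fun u => c * kap y u).
Proof. by move=> y0; exact: (adm_W 0 (wadm_cst c) y0). Qed.

Lemma lint_cst_kap c y : 0 < cos y -> lint (fun u => c * kap y u) = c.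
Proof.
move=> y0; rewrite lintZ; first by rewrite lint_kap// mulr1.
by have := adm_cst_kap 1 y0; congr adm; apply/funext => u; rewrite mul1r.
Qed.

(** Jensen's inequality for a symmetric kernel of mass 1, where midpoint convexity is enough. *)
Lemma Wp_ge x y : 0 < cos y -> `|x| `^ p <= Wp x y.
Proof.
move=> y0; have := W_sym2 x wp y0; rewrite -/(Wp x y) => E.
suff : 2 * `|x| `^ p <= 2 * Wp x y by lra.
rewrite E -[leLHS](lint_cst_kap _ y0); apply: le_lint; first exact: adm_cst_kap.
  have := admD (adm_W x wp y0) (adm_W_reflect x wp y0).
  by congr adm; apply/funext => u; rewrite -mulrDl ![_ + x]addrC.
by move=> s; rewrite ler_wpM2r ?kap_ge0// powR_abs_convex.
Qed.

(** The bound [powR_clarkson] integrated against the kernel. *)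
Lemma Wp_le x y : 0 < cos y -> Wp x y <= `|x| `^ p + Wp 0 y.
Proof.
move=> y0; have := W_sym2 x wp y0; rewrite -/(Wp x y) => E.
suff : 2 * Wp x y <= 2 * `|x| `^ p + 2 * Wp 0 y by lra.
rewrite E -[X in _ <= X + _](lint_cst_kap _ y0) /Wp /W -(lintZ 2 (adm_W 0 wp y0)).
have aK := admZ 2 (adm_W 0 wp y0).
rewrite -lintD//; last exact: adm_cst_kap.
apply: le_lint.
- have := admD (adm_W x wp y0) (adm_W_reflect x wp y0).
  by congr adm; apply/funext => u; rewrite -mulrDl ![_ + x]addrC.
- by apply: admD => //; exact: adm_cst_kap.
- move=> s; rewrite addr0 mulrA -mulrDl ler_wpM2r ?kap_ge0// -mulrDr; exact: powR_clarkson.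
Qed.

Lemma Wp_center_le y : `|y| < pi / 2 -> Wp 0 y <= Wp 0 0.
Proof.
by move=> yp; have := W_le_y 0 wp powR_abs_convex (_ : `|0| <= `|y|) yp;
  rewrite normr0 => /(_ (normr_ge0 _)); rewrite /Wp; case: (ger0P y) => //; rewrite WNy.
Qed.

Lemma cos_gt0_norm y : `|y| < pi / 2 -> 0 < cos y.
Proof. by rewrite ltr_norml => h; exact: cos_gt0_pihalf. Qed.

(** The power is at most a small constant plus a multiple of [s^2], and the second moment of the
    kernel is of order [cos y]. *)
Lemma Wp_center_small eta : 0 < eta -> exists2 rho, 0 < rho &
  forall y, 0 < cos y -> cos y <= rho -> Wp 0 y <= eta.
Proof.
move=> e0; have [M HM] := @W_sqr_small R.
(* From [|s|^p <= |s| + s^2] and [|s| <= eta/2 + s^2 / (2 eta)]. *)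
pose K := 1 + (2 * eta)^-1.
have K0 : 0 < K.
  rewrite /K; have : 0 < (2 * eta)^-1 by rewrite invr_gt0 mulr_gt0.
  lra.
exists (eta / 2 / (K * (`|M| + 1))).
  by rewrite !divr_gt0// mulr_gt0//; have := normr_ge0 M; lra.
move=> y y0 yr.
have h1 : Wp 0 y <= eta / 2 + K * W (fun s : R => s ^+ 2) 0 y.
  rewrite -[X in _ <= X + _](lint_cst_kap _ y0) /Wp /W -(lintZ K (adm_W 0 wadm_sqr y0)).
  have aK := admZ K (adm_W 0 (@wadm_sqr R) y0).
  rewrite -lintD//; last exact: adm_cst_kap.
  apply: le_lint; [exact: (adm_W 0 wp y0)|by apply: admD => //; exact: adm_cst_kap|].
  move=> s; rewrite !addr0 mulrA -mulrDl ler_wpM2r ?kap_ge0//.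
  have s2 : `|s| ^+ 2 = s ^+ 2 by rewrite real_normK ?num_real.
  have h : `|s| `^ p <= `|s| + s ^+ 2.
    have [s1|s1] := leP `|s| 1.
      have [->|s0] := eqVneq s 0; first by rewrite normr0 powR0 ?gt_eqF// expr0n addr0.
      apply: le_trans (_ : `|s| <= _); last by rewrite lerDl sqr_ge0.
      by apply: ge1r_powR; [rewrite normr_gt0 s0|move: hp => /andP[]].
    apply: le_trans (_ : s ^+ 2 <= _); last by rewrite lerDr.
    rewrite -s2 -powR_mulrn//; apply: ler_powR; first exact: ltW.
    by move: hp => /andP[].
  apply: le_trans h _.
  have h3 : `|s| <= eta / 2 + (2 * eta)^-1 * s ^+ 2.
    have : 0 <= (2 * eta)^-1 * (`|s| - eta) ^+ 2 by rewrite mulr_ge0 ?sqr_ge0// invr_ge0 mulr_ge0// ltW.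
    have -> : (2 * eta)^-1 * (`|s| - eta) ^+ 2 = (2 * eta)^-1 * `|s| ^+ 2 - `|s| + eta / 2 by field; rewrite gt_eqF.
    by rewrite s2; lra.
  by rewrite /K; lra.
have h2 := HM y y0.
have MM : M * cos y <= (`|M| + 1) * cos y.
  by rewrite ler_pM2r//; have := ler_norm M; lra.
have M0 : 0 < `|M| + 1 by have := normr_ge0 M; lra.
have : K * ((`|M| + 1) * cos y) <= eta / 2.
  by move: yr; rewrite ler_pdivlMr ?mulr_gt0// => h; rewrite mulrA mulrC.
have := ler_wpM2l (ltW K0) (le_trans h2 MM); lra.
Qed.

(* Both [|t + X_t|^2] and [|X_0|^2] have mean [(pi/2)^2], where [X_y] has density [kap y]; the former is
   less spread out, so the concave power [p/2] of it has the larger mean. *)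
Lemma Wp_diag t : 0 <= t < pi / 2 -> Wp 0 0 <= Wp t t.
Proof.
move=> /andP[]; rewrite le_eqVlt => /predU1P[<-//|t0] tp.
have ct : 0 < cos t by apply: cos_gt0_norm; rewrite gtr0_norm.
have c0 : 0 < cos (0 : R) by rewrite cos0.
have a1 : 0 < 1 - cos t * cosh t by have := @cos_cosh_lt1 R t; rewrite t0 tp => /(_ isT); lra.
pose m := cos t ^+ 2 + sinh t ^+ 2.
have [A [B HAB]] := concave_chord (cos t * cosh t * (1 + m) + 2 * m - 4 * cos t ^+ 2 * cosh t ^+ 2)
   (cos t * cosh t * m - m ^+ 2) a1 hp.
pose D s := kap t (s - t) + kap t (s + t) - 2 * kap 0 s.
pose L (phi : R -> R) := lint (fun s => phi s * D s).
have [dk _ _ _ _] := decay_kap ct.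
have aS (phi : R -> R) : wadm phi -> adm (fun s => phi s * kap t (s - t)).
  move=> wph; have := adm_shift (- t) (adm_wdecay t wph dk).
  by congr adm; apply/funext => s; rewrite subrK.
have aS' (phi : R -> R) : wadm phi -> adm (fun s => phi s * kap t (s + t)).
  move=> wph; have := adm_shift t (adm_wdecay (- t) wph dk).
  by congr adm; apply/funext => s; rewrite addrK.
have a0 (phi : R -> R) : wadm phi -> adm (fun s => phi s * kap 0 s).
  move=> wph; have := adm_W 0 wph c0.
  by congr adm; apply/funext => s; rewrite addr0.
have aL (phi : R -> R) : wadm phi -> adm (fun s => phi s * D s).
  move=> wph; have := admB (admD (aS _ wph) (aS' _ wph)) (admZ 2 (a0 _ wph)).
  by congr adm; apply/funext => s; rewrite /D; ring.
have LE (phi : R -> R) : wadm phi -> (forall s, phi (- s) = phi s) -> L phi = 2 * W phi t t - 2 * W phi 0 0.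
  move=> wph ev.
  have e1 : W phi t t = lint (fun s => phi s * kap t (s - t)).
    by rewrite -[t in W _ t _]add0r (W_shift _ _ wph ct); apply: eq_lint => s; rewrite addr0.
  have e2 : W phi t t = lint (fun s => phi s * kap t (s + t)).
    rewrite e1 -(lint_opp (aS _ wph)); apply: eq_lint => s.
    by rewrite ev -kapN opprB opprK [t + s]addrC.
  have e3 : W phi 0 0 = lint (fun s => phi s * kap 0 s).
    by apply: eq_lint => s; rewrite addr0.
  rewrite e3 -(lintZ 2 (a0 _ wph)).
  rewrite [2 * _](_ : _ = lint (fun s => phi s * kap t (s - t)) + lint (fun s => phi s * kap t (s + t))); last first.
    by rewrite -e1 -e2; ring.
  rewrite -lintD; [|exact: aS|exact: aS'].
  rewrite -lintB; [|by apply: admD; [exact: aS|exact: aS']|exact/admZ/a0].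
  by apply: eq_lint => s; rewrite /D; ring.
(* Masses and second moments agree, so any [A + B s^2] may be subtracted under [L]. *)
have L1 : L (cst 1) = 0.
  rewrite LE//; last exact: wadm_cst.
  have w1 y : 0 < cos y -> forall x, W (cst 1) x y = 1.
    by move=> y0 x; rewrite -[RHS](lint_kap y0); apply: eq_lint => s; rewrite /= mul1r.
  by rewrite !w1//; ring.
have L2 : L (fun s => s ^+ 2) = 0.
  rewrite LE//; last 2 first.
  - exact: wadm_sqr.
  - by move=> s; rewrite sqrrN.
  by rewrite W_sqr// W_sqr_y ?gtr0_norm//; ring.
have L3 : L (fun s => `|s| `^ p) = 2 * Wp t t - 2 * Wp 0 0.
  by rewrite LE// => s; rewrite normrN.
suff : 0 <= L (fun s => `|s| `^ p) by rewrite L3; lra.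
have -> : L (fun s => `|s| `^ p) = lint (fun s => (`|s| `^ p - A - B * s ^+ 2) * D s).
  transitivity (L (fun s => `|s| `^ p) - A * L (cst 1) - B * L (fun s => s ^+ 2)).
    by rewrite L1 L2; ring.
  have b1 := aL _ (wadm_cst 1); have b2 := aL _ (@wadm_sqr R); have b3 := aL _ wp.
  rewrite /L -(lintZ A b1) -(lintZ B b2) -(lintB b3 (admZ A b1)) -(lintB (admB b3 (admZ A b1)) (admZ B b2)).
  by apply: eq_lint => s; rewrite /=; ring.
(* By [kap_diag], [D] is a nonnegative factor times the quadratic of [HAB]. *)
apply: lint_ge0 => s; rewrite /D kap_diag// mulrCA; apply: mulr_ge0; last exact: HAB.
have ch := cosh_gt0 s.
apply: divr_ge0; first by rewrite !divr_ge0// ?pi_ge0// ltW.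
have h1 := mulr_ge0 (mulr_ge0 (sqr_ge0 (cos t)) (sqr_ge0 (cosh t))) (sqr_ge0 (sinh s)).
have h2 := sqr_ge0 (cos t ^+ 2 + sinh t ^+ 2 - sinh s ^+ 2); lra.
Qed.

Definition What x y := if `|y| < pi / 2 then Wp x y else `|x| `^ p.

Lemma What_ge x y : `|x| `^ p <= What x y.
Proof. by rewrite /What; case: ifPn => // yp; exact/Wp_ge/cos_gt0_norm. Qed.

Lemma Wp_center_ge0 : 0 <= Wp 0 0.
Proof.
by apply: le_trans (Wp_ge 0 _); rewrite ?powR_ge0// cos0.
Qed.

Lemma What_le x y : What x y <= `|x| `^ p + Wp 0 0.
Proof.
rewrite /What; case: ifPn => yp; last by rewrite lerDl Wp_center_ge0.
have ct := cos_gt0_norm yp.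
by apply: le_trans (Wp_le x ct) _; rewrite lerD2l; exact: Wp_center_le.
Qed.

(** Let [t] tend to [pi/2] in [Wp_diag]: the value at [(t, t)] is at most [t^p + Wp 0 t], and the
    second term tends to 0. *)
Lemma Wp_center_le_pihalf : Wp 0 0 <= (pi / 2) `^ p.
Proof.
have q0 : 0 < pi / 2 :> R by rewrite divr_gt0// pi_gt0.
apply/ler_addgt0Pl => e e0.
have [rho r0 H] := Wp_center_small e0.
have := @continuous_cos R (pi / 2) => /cvgrPdist_le /(_ _ r0) /nbhs_ballP[d /= d0 Hd].
pose t := pi / 2 - Num.min (d / 2) (pi / 4).
have mn : 0 < Num.min (d / 2) (pi / 4) :> R by rewrite lt_min !divr_gt0// pi_gt0.
have mp : Num.min (d / 2) (pi / 4) <= pi / 4 :> R by rewrite ge_min lexx orbT.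
have md : Num.min (d / 2) (pi / 4) <= d / 2 :> R by rewrite ge_min lexx.
have t0 : 0 <= t by rewrite /t; lra.
have tp : t < pi / 2 by rewrite /t; lra.
have ct : 0 < cos t by apply: cos_gt0_norm; rewrite ger0_norm.
apply: le_trans (Wp_diag (introT andP (conj t0 tp))) _.
apply: le_trans (Wp_le t ct) _; rewrite addrC; apply: lerD.
  apply: H => //; have := Hd t; rewrite /ball/= cos_pihalf sub0r normrN (gtr0_norm ct); apply.
  by rewrite /t opprB addrCA subrr addr0 gtr0_norm//; lra.
by rewrite ger0_norm//; apply: ge0_ler_powR; rewrite ?nnegrE ?(ltW p0)// ltW.
Qed.

(** For [|x| < pi/2], pass from the centre to the diagonal by [Wp_diag], then from height [|x|] to
    the lower height [|y|] by [W_le_y]. For [|x| >= pi/2] the term [|x|^p] is already large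
    enough. *)
Lemma What_center_le x y : `|y| <= `|x| -> Wp 0 0 <= What x y.
Proof.
move=> yx.
have [xp|xp] := leP (pi / 2) `|x|.
  apply: le_trans (What_ge x y); apply: le_trans Wp_center_le_pihalf _.
  by apply: ge0_ler_powR; rewrite ?nnegrE ?(ltW p0)// divr_ge0 ?pi_ge0.
rewrite /What (le_lt_trans yx xp).
apply: le_trans (Wp_diag (introT andP (conj (normr_ge0 x) xp))) _.
have h := @W_le_y _ (fun s => `|s| `^ p) `|x| y `|x| wp powR_abs_convex yx xp.
apply: le_trans h _; rewrite /Wp; case: (ger0P x) => // x0.
rewrite W_even//; first by move=> s; rewrite normrN.
exact: cos_gt0_norm (le_lt_trans yx xp).
Qed.

(** Near an edge the extension lies between [|x|^p] and [|x|^p + Wp 0 y], whose last term tends to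
    0. *)
Lemma What_continuous x y eta : 0 < eta -> exists2 rho, 0 < rho &
  forall a b, `|a| <= rho -> `|b| <= rho -> `|What (x + a) (y + b) - What x y| <= eta.
Proof.
move=> e0; have [yp|yp] := ltP `|y| (pi / 2).
  have [rho r0 H] := W_continuous x wp (cos_gt0_norm yp) e0.
  exists (Num.min rho ((pi / 2 - `|y|) / 2)); first by rewrite lt_min r0 divr_gt0// subr_gt0.
  move=> a b; rewrite !le_min => /andP[a1 _] /andP[b1 b2].
  have yb : `|y + b| < pi / 2 by have := ler_normD y b; lra.
  by rewrite /What yp yb; exact: H.
have e2 : 0 < eta / 2 by lra.
have cpow : (fun z : R => `|z| `^ p) @ x --> `|x| `^ p by exact: continuous_powR.
move/cvgrPdist_le : cpow => /(_ _ e2) /nbhs_ballP[d /= d0 Hd].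
have [rho r0 H] := Wp_center_small e2.
have := @continuous_cos R y => /cvgrPdist_le /(_ _ r0) /nbhs_ballP[d' /= d'0 Hd'].
(* A point strictly outside the strip keeps its neighbours outside, so a neighbour inside forces
   [|y| = pi/2]. *)
pose d3 := if pi / 2 < `|y| then (`|y| - pi / 2) / 2 else 1.
have d30 : 0 < d3 by rewrite /d3; case: ifPn => // h; lra.
exists (Num.min (d / 2) (Num.min (d' / 2) d3)); first by rewrite !lt_min d30 !divr_gt0.
move=> a b; rewrite !le_min => /and3P[a1 a2 a3] /and3P[b1 b2 b3].
have ha : `| `|x| `^ p - `|x + a| `^ p| <= eta / 2.
  by apply: Hd; rewrite /ball/= opprD addrA subrr add0r normrN; lra.
rewrite /What (ltNge `|y|) yp /=; case: ifPn => yb; last by rewrite distrC; lra.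
have cb := cos_gt0_norm yb.
have hw : Wp 0 (y + b) <= eta / 2.
  apply: H => //.
  have yE : `|y| = pi / 2.
    apply/eqP; rewrite eq_le yp andbT leNgt; apply/negP => h.
    move: b3; rewrite /d3 h => b3; have := ler_normB (y + b) b; rewrite addrK; lra.
  have cy : cos y = 0 by rewrite -cos_norm yE cos_pihalf.
  have := Hd' (y + b); rewrite /ball/= opprD addrA subrr add0r normrN cy sub0r normrN (gtr0_norm cb).
  by apply; lra.
have h1 := Wp_ge (x + a) cb; have h2 := Wp_le (x + a) cb.
move: ha; rewrite !ler_norml => /andP[? ?]; apply/andP; split; lra.
Qed.

Lemma Wp_taylor x y : `|y| < pi / 2 -> exists W1 W2 A B, 0 <= A /\
  forall eta, 0 < eta -> exists2 rho, 0 < rho & forall a b, `|a| <= rho -> `|b| <= rho ->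
    `|Wp (x + a) (y + b) - Wp x y - W1 * a - W2 * b - A * (a ^+ 2 - b ^+ 2) - B * (a * b)|
    <= eta * (a ^+ 2 + b ^+ 2).
Proof. by move=> yp; apply: W_taylor_ge0 => //; [exact: cos_gt0_norm|exact: powR_abs_convex]. Qed.

(** Only [[1, 2]] is kept, where [|s|^p >= 1] and the kernel is at least [1 / (pi cosh 2)]. *)
Lemma Wp_center_gt0 : 0 < Wp 0 0.
Proof.
have c0 : 0 < cos (0 : R) by rewrite cos0.
have af := adm_W 0 wp c0.
pose k := (pi * cosh 2)^-1 : R.
have k0 : 0 < k by rewrite invr_gt0 mulr_gt0 ?pi_gt0 ?cosh_gt0.
rewrite /Wp /W lintE /Rintegral.
rewrite -lte_fin fineK; last exact: (integrable_fin_num _ (adm_integrable af)).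
apply: (@lt_le_trans _ _ (\int[@lebesgue_measure R]_(s in `[1%R, 2%R]) k%:E)%E).
  rewrite integral_cst//= lebesgue_measure_itv/= lte_fin ifT; last by lra.
  by rewrite -EFinD -EFinM lte_fin mulr_gt0//; lra.
apply: (@le_trans _ _ (\int[@lebesgue_measure R]_(s in `[1%R, 2%R]) (`|s + 0| `^ p * kap 0 s)%:E)%E).
  apply: ge0_le_integral => //.
  - by move=> s _; rewrite lee_fin ltW.
  - apply/measurable_EFinP; apply: measurable_funTS; apply: continuous_measurable_fun; exact: af.1.
  - move=> s /=; rewrite in_itv/= => /andP[s1 s2]; rewrite lee_fin addr0.
    have h1 : 1 <= `|s| `^ p.
      rewrite ger0_norm; last by lra.
      by rewrite -[leLHS](congr1 (fun f => f p) (powR1 R)); apply: ge0_ler_powR; rewrite ?nnegrE ?(ltW p0)//; lra.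
    apply: le_trans (_ : 1 * k <= _); first by rewrite mul1r.
    apply: ler_pM => //; rewrite ?(ltW k0)//.
    rewrite kap.unlock cos0 expr1n mulr1 addrC -cosh2 expr2 invfM mulrA divff ?mul1r; last by rewrite gt_eqF// cosh_gt0.
    rewrite /k invfM mulrC ler_pM2r ?invr_gt0 ?pi_gt0// lef_pV2 ?posrE ?cosh_gt0//.
    rewrite -ler_sqr ?nnegrE ?(ltW (cosh_gt0 _))// !cosh2 lerD2l.
    by apply: sinh_sqr_le; rewrite ler_sqr ?nnegrE//; lra.
apply: ge0_subset_integral => //.
  by apply/measurable_EFinP; apply: continuous_measurable_fun; exact: af.1.
by move=> s _; rewrite lee_fin mulr_ge0 ?powR_ge0 ?kap_ge0.
Qed.

End majorant.

(** * The maximum principle *)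

Section euclidean.
Context {R : realType} {n : nat}.
Local Notation Rn := 'rV[R]_n.
Implicit Types (x y z c : Rn) (f g h : Rn -> R).

(** The norm on row vectors is the maximum norm, so Euclidean balls and spheres are handled as level
    sets of this function. *)
Definition nsq c x : R := \sum_(i < n) (x 0 i - c 0 i) ^+ 2.

Lemma coord_cont (i : 'I_n) : continuous (fun x : Rn => x 0 i).
Proof. exact: coord_continuous. Qed.

Lemma nsq_continuous c : continuous (nsq c).
Proof.
rewrite /nsq; elim: (index_enum _) => [|i s IH] x.
  rewrite (_ : (fun _ => _) = cst 0); first exact: cst_continuous.
  by apply/funext => y; rewrite big_nil.
rewrite (_ : (fun _ => _) = (fun y : Rn => (y 0 i - c 0 i) ^+ 2 + \sum_(j <- s) (y 0 j - c 0 j) ^+ 2)); last first.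
  by apply/funext => y; rewrite big_cons.
apply: (@continuousD _ _ _ (fun y : Rn => (y 0 i - c 0 i) ^+ 2)); last exact: IH.
apply: (@continuous_comp _ _ _ (fun x : Rn => x 0 i - c 0 i) (fun t : R => t ^+ 2)).
  by apply: (@continuousB _ _ _ (fun x : Rn => x 0 i) (cst (c 0 i))); [exact: coord_cont|exact: cst_continuous].
exact: exprn_continuous.
Qed.

Lemma nsq_ge0 c x : 0 <= nsq c x.
Proof. by apply: sumr_ge0 => i _; exact: sqr_ge0. Qed.

Lemma nsq_coord c x i : (x 0 i - c 0 i) ^+ 2 <= nsq c x.
Proof.
by rewrite /nsq (bigD1 i)//= lerDl sumr_ge0// => j _; exact: sqr_ge0.
Qed.

Lemma open_eball c r : open (eball c r).
Proof.
rewrite (_ : eball c r = nsq c @^-1` [set t : R | t < r ^+ 2])//.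
by apply: open_comp; [move=> x _; exact: nsq_continuous|exact: open_lt].
Qed.

Lemma closed_ecball c r : closed (ecball c r).
Proof.
rewrite (_ : ecball c r = nsq c @^-1` [set t : R | t <= r ^+ 2])//.
by apply: closed_comp; [move=> x _; exact: nsq_continuous|exact: closed_le].
Qed.

Lemma mxnorm_lt x e : 0 < e -> (forall i, `|x 0 i| < e) -> `|x| < e.
Proof.
move=> e0 H; rewrite [`|x|]mx_normrE bigmax_lt//= => -[i j] _ /=.
by rewrite (ord1 i).
Qed.

Lemma coord_le_norm x i : `|x 0 i| <= `|x|.
Proof.
rewrite [`|x|]mx_normrE; exact: (le_bigmax _ (fun ij : 'I_1 * 'I_n => `|x ij.1 ij.2|) (0, i)).
Qed.

Lemma bounded_ecball c r : bounded_set (ecball c r).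
Proof.
pose M := `|c| + `|r| + 1.
have M0 : 0 < M by rewrite /M; have := normr_ge0 c; have := normr_ge0 r; lra.
exists M; split; first by rewrite num_real.
move=> N MN x /= xc; apply/ltW/mxnorm_lt; first exact: lt_trans MN.
move=> i; apply: le_lt_trans MN.
have := le_trans (nsq_coord c x i) xc.
rewrite -ler_sqrt ?sqr_ge0// !sqrtr_sqr => h.
have := ler_normD (x 0 i - c 0 i) (c 0 i); rewrite subrK.
have := coord_le_norm c i; rewrite /M; lra.
Qed.

Lemma compact_ecball c r : compact (ecball c r).
Proof. by apply: bounded_closed_compact; [exact: bounded_ecball|exact: closed_ecball]. Qed.

Lemma nsq_line c x i (t : R) :
  nsq c (x + t *: basis_vec R i) = nsq c x + 2 * t * (x 0 i - c 0 i) + t ^+ 2.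
Proof.
rewrite /nsq (bigD1 i)//= [in RHS](bigD1 i)//=.
rewrite (eq_bigr (fun j => (x 0 j - c 0 j) ^+ 2)).
  by rewrite /basis_vec !mxE !eqxx/= mulr1; ring.
by move=> j ji; rewrite /basis_vec !mxE (negbTE ji) andbF mulr0 addr0.
Qed.

Lemma line_continuous x (v : Rn) : continuous (fun t : R => x + t *: v).
Proof.
move=> t; apply: cvgD; first exact: cvg_cst.
by apply: (@cvgZr_tmp _ _ _ _ _ _ _ v); exact: cvg_id.
Qed.

Lemma near_line (U : set Rn) x (v : Rn) : open U -> U x ->
  exists2 rho : R, 0 < rho & forall t, `|t| < rho -> U (x + t *: v).
Proof.
move=> oU Ux.
have : nbhs (0 : R) ((fun t : R => x + t *: v) @^-1` U).
  apply: line_continuous; rewrite scale0r addr0; exact: open_nbhs_nbhs.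
move=> /nbhs_ballP[rho /= r0 H]; exists rho => // t tr; apply: H.
by rewrite /ball/= sub0r normrN.
Qed.

Lemma is_derive_line f x (v : Rn) (t : R) : derivable f (x + t *: v) v ->
  is_derive t 1 (fun s : R => f (x + s *: v)) ('D_v f (x + t *: v)).
Proof.
move=> df.
have E : (fun h : R => h^-1 *: (((fun s : R => f (x + s *: v)) \o shift t) (h *: (1 : R)) - f (x + t *: v)))
   = (fun h : R => h^-1 *: ((f \o shift (x + t *: v)) (h *: v) - f (x + t *: v))).
  apply/funext => h /=; congr (_ *: (f _ - _)).
  by rewrite [h%:A]/GRing.scale/= mulr1 scalerDl addrCA.
split; first by rewrite /derivable E.
by rewrite /derive E.
Qed.

Lemma harmonic_peano (U : set Rn) h x i : harmonic_on U h -> U x ->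
  peano (fun t => h (x + t *: basis_vec R i)) (partial i h x) (partial i (partial i h) x / 2).
Proof.
move=> [oU [dU _]] Ux.
have [rho r0 Hr] := near_line (basis_vec R i) oU Ux.
have d1 (s : R) : `|s| < rho -> is_derive s 1 (fun t => h (x + t *: basis_vec R i)) (partial i h (x + s *: basis_vec R i)).
  by move=> /Hr /dU[dh _]; apply: is_derive_line; exact: diff_derivable.
have d2 : is_derive (0:R) 1 (fun s : R => partial i h (x + s *: basis_vec R i)) (partial i (partial i h) x).
  have := @is_derive_line (partial i h) x (basis_vec R i) 0.
  rewrite scale0r addr0; apply; apply: diff_derivable; exact: (dU _ Ux).2.
have := peano_derive r0 d1 d2; by rewrite scale0r addr0.
Qed.

Lemma sdge_ge0 (f : R -> R) a : sdge f a -> 0 < a -> ~ (exists2 rho, 0 < rho & forall t, `|t| < rho -> f t <= f 0).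
Proof.
move=> fa a0 [r r0 H]; have a2 : 0 < a / 2 by lra.
have [r1 r10 K] := fa _ a2.
pose t := Num.min r1 (r / 2).
have t0 : 0 < t by rewrite lt_min r10 divr_gt0.
have t1 : t <= r1 by rewrite ge_min lexx.
have t2 : t <= r / 2 by rewrite ge_min lexx orbT.
have := K t; rewrite t0 t1 => /(_ isT).
have := H t; have := H (- t); rewrite normrN gtr0_norm//.
have -> : t < r by lra.
move=> /(_ isT) h1 /(_ isT) h2; have : 0 < t ^+ 2 by rewrite exprn_gt0.
nra.
Qed.

(** A pointwise form of a nonnegative Laplacian that makes sense where [g] has no derivatives. *)
Definition sub_lap g x := exists cf : 'I_n -> R,
  (forall i, sdge (fun t => g (x + t *: basis_vec R i)) (cf i)) /\ 0 <= \sum_i cf i.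

(* Maximum principle: at an interior maximum of [g + h + e |x - c|^2] all second differences would be <= 0. *)
Lemma sub_lap_add_harmonic_le0 g h c r : (0 < n)%N -> 0 < r ->
  {within ecball c r, continuous g} -> {within ecball c r, continuous h} ->
  harmonic_on (eball c r) h -> (forall x, eball c r x -> sub_lap g x) ->
  (forall y, esphere c r y -> g y + h y <= 0) -> forall y, eball c r y -> g y + h y <= 0.
Proof.
move=> n0 r0 cg ch hh sg gh y yB; rewrite leNgt; apply/negP => hg.
(* On the sphere [F] is then at most [(g y + h y) / 2], less than its value at [y]. *)
pose e := (g y + h y) / (2 * r ^+ 2).
have r20 : 0 < r ^+ 2 by rewrite exprn_gt0.
have e0 : 0 < e by rewrite divr_gt0 ?mulr_gt0.
have er : e * r ^+ 2 = (g y + h y) / 2 by rewrite /e; field; rewrite gt_eqF.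
pose F x := g x + h x + e * nsq c x.
have bB x : eball c r x -> ecball c r x by exact: ltW.
have [|||z] := @EVT_max_rV R n F (ecball c r).
- by exists y; exact: bB.
- exact: compact_ecball.
- move=> x; apply: cvgD; first by apply: cvgD; [exact: cg|exact: ch].
  apply: cvgM; first exact: cvg_cst.
  by apply: (@continuous_subspaceT _ _ _ (nsq c)); exact: nsq_continuous.
move=> zB zmax.
have Fy : F y <= F z by apply: zmax; rewrite inE; exact: bB.
have zb : eball c r z.
  have : nsq c z <= r ^+ 2 by move: zB; rewrite inE.
  rewrite le_eqVlt => /predU1P[zE|//].
  have := gh z zE; move: Fy; rewrite /F zE er; have := nsq_ge0 c y.
  by move=> /(mulr_ge0 (ltW e0)); lra.
have [cf [scf cf0]] := sg z zb.
pose d i := partial i (partial i h) z.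
have d0 : \sum_i d i = 0 := hh.2.2.2 z zb.
(* These numbers add up to at least [2 e n], so one of them is positive. *)
have [i ci] : exists i, 0 < cf i + d i + 2 * e.
  apply/not_existsP => H.
  have : \sum_i (cf i + d i + 2 * e) <= 0.
    by apply: sumr_le0 => i _; rewrite leNgt; apply/negP; exact: H.
  rewrite !big_split/= d0 addr0 sumr_const card_ord -[X in _ + X <= _ -> _]mulr_natr.
  have : 0 < 2 * e * n%:R by apply: mulr_gt0; [exact: mulr_gt0|rewrite ltr0n].
  lra.
have sh := peano_sdge (harmonic_peano i hh zb).
have sn : sdge (fun t => e * nsq c (z + t *: basis_vec R i)) (2 * e).
  move=> eta eta0; exists 1 => // t _; rewrite scale0r addr0 !nsq_line.
  have := sqr_ge0 t; nra.
have sF := sdgeD (sdgeD (scf i) sh) sn.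
have E : cf i + 2 * (partial i (partial i h) z / 2) + 2 * e = cf i + d i + 2 * e by rewrite /d; field.
rewrite E in sF.
apply: (sdge_ge0 sF ci).
have [rho rho0 H] := near_line (basis_vec R i) (open_eball (c := c) (r := r)) zb.
exists rho => // t /H tB; rewrite scale0r addr0.
by have := zmax (z + t *: basis_vec R i); rewrite inE; apply; exact: bB.
Qed.

End euclidean.

(** * Composition of the majorant with a harmonic pair *)

Section composition.
Context {R : realType}.

(** Second-order chain rule for [F] whose quadratic part has the harmonic shape
    [A (a^2 - b^2) + B a b]; this shape reappears with the slopes [u1] and [v1]. *)
Lemma peano_comp (F : R -> R -> R) (u v : R -> R) (W1 W2 A B u1 u2 v1 v2 : R) :
  peano u u1 u2 -> peano v v1 v2 ->
  (forall eta, 0 < eta -> exists2 rho, 0 < rho & forall a b, `|a| <= rho -> `|b| <= rho ->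
    `|F (u 0 + a) (v 0 + b) - F (u 0) (v 0) - W1 * a - W2 * b - A * (a ^+ 2 - b ^+ 2) - B * (a * b)|
    <= eta * (a ^+ 2 + b ^+ 2)) ->
  peano (fun t => F (u t) (v t)) (W1 * u1 + W2 * v1)
    (W1 * u2 + W2 * v2 + A * (u1 ^+ 2 - v1 ^+ 2) + B * (u1 * v1)).
Proof.
move=> pu pv HF eps eps0.
pose M := `|u1| + `|u2| + `|v1| + `|v2| + 1.
have M1 : 1 <= M by rewrite /M; have := normr_ge0 u1; have := normr_ge0 u2; have := normr_ge0 v1; have := normr_ge0 v2; lra.
(* Total of the constants in front of [e t^2] in the error terms below. *)
pose K := `|W1| + `|W2| + 4 * M ^+ 2 * `|A| + 2 * M ^+ 2 * `|B| + 2 * M ^+ 2.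
have M20 : 1 <= M ^+ 2 by rewrite expr2; nra.
have nA := normr_ge0 A; have nB := normr_ge0 B; have nW1 := normr_ge0 W1; have nW2 := normr_ge0 W2.
have K0 : 0 < K by rewrite /K; nra.
have [e [e0 e1 eK]] : exists e, [/\ 0 < e, e <= 1 & e * K <= eps].
  exists (Num.min 1 (eps / K)); split; [by rewrite lt_min ltr01 divr_gt0|by rewrite ge_min lexx|].
  by rewrite -ler_pdivlMr// ge_min lexx orbT.
have [r1 r10 H1] := pu e e0; have [r2 r20 H2] := pv e e0; have [r3 r30 H3] := HF e e0.
exists (Num.min (Num.min r1 r2) (Num.min e (r3 / M))).
  by rewrite !lt_min r10 r20 e0 divr_gt0//; lra.
move=> t; rewrite !le_min => /andP[/andP[t1 t2] /andP[te t3]].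
pose a := u t - u 0; pose b := v t - v 0.
have t0 := normr_ge0 t.
have tt : `|t| * `|t| = t ^+ 2 by rewrite -expr2 real_normK ?num_real.
have hu : `|a - u1 * t - u2 * t ^+ 2| <= e * t ^+ 2 := H1 t t1.
have hv : `|b - v1 * t - v2 * t ^+ 2| <= e * t ^+ 2 := H2 t t2.
have t20 := sqr_ge0 t.
have lin (w w1 w2 : R) : `|w - w1 * t - w2 * t ^+ 2| <= e * t ^+ 2 -> `|w1| + `|w2| + 1 <= M ->
   `|w - w1 * t| <= M * t ^+ 2 /\ `|w| <= M * `|t|.
  move=> h hM; have h1 : `|w - w1 * t| <= (`|w2| + 1) * t ^+ 2.
    have := ler_normD (w - w1 * t - w2 * t ^+ 2) (w2 * t ^+ 2); rewrite subrK normrM (ger0_norm t20).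
    by have := ler_wpM2r t20 e1; clear -h; lra.
  have nw1 := normr_ge0 w1; split; first by clear -h1 hM nw1 t20; nra.
  have := ler_normD (w - w1 * t) (w1 * t); rewrite subrK normrM -tt in h1 *.
  have tle : `|t| <= 1 by exact: le_trans te e1.
  have nw2 := normr_ge0 w2.
  have : (`|w2| + 1) * (`|t| * `|t|) <= (`|w2| + 1) * `|t|.
    by rewrite ler_wpM2l ?addr_ge0// ler_piMl.
  clear -h1 hM t0 nw1 nw2; nra.
have [|a1 a2] := lin a u1 u2 hu; first by clear; rewrite /M; have := normr_ge0 v1; have := normr_ge0 v2; lra.
have [|b1 b2] := lin b v1 v2 hv; first by clear; rewrite /M; have := normr_ge0 u1; have := normr_ge0 u2; lra.
have Mt : M * `|t| <= r3 by rewrite mulrC -ler_pdivlMr//; clear -M1; lra.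
have := H3 a b (le_trans a2 Mt) (le_trans b2 Mt).
have -> : u 0 + a = u t by rewrite /a; ring.
have -> : v 0 + b = v t by rewrite /b; ring.
set D := F (u t) (v t) - F (u 0) (v 0); set E := D - _ - _ - _ - _ => hE.
have sq (w w' : R) : `|w| <= M * `|t| -> `|w'| <= M * t ^+ 2 -> `|w * w'| <= M ^+ 2 * e * t ^+ 2.
  move=> h h'; rewrite normrM; apply: le_trans (ler_pM (normr_ge0 _) (normr_ge0 _) h h') _.
  have : M ^+ 2 * t ^+ 2 * `|t| <= M ^+ 2 * t ^+ 2 * e by rewrite ler_wpM2l// mulr_ge0//; clear -M20; lra.
  clear; lra.
have u1t : `|u1 * t| <= M * `|t|.
  by rewrite normrM ler_wpM2r// /M; clear; have := normr_ge0 u2; have := normr_ge0 v1; have := normr_ge0 v2; lra.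
have v1t : `|v1 * t| <= M * `|t|.
  by rewrite normrM ler_wpM2r// /M; clear; have := normr_ge0 u2; have := normr_ge0 u1; have := normr_ge0 v2; lra.
have q1 := sq _ _ a2 a1; have q2 := sq _ _ u1t a1; have q3 := sq _ _ b2 b1; have q4 := sq _ _ v1t b1.
have q5 := sq _ _ b2 a1; have q6 := sq _ _ u1t b1.
have aN : a ^+ 2 <= M ^+ 2 * t ^+ 2.
  rewrite -(real_normK (num_real a)) -tt -expr2 -exprMn ler_sqr ?nnegrE//; exact: le_trans a2.
have bN : b ^+ 2 <= M ^+ 2 * t ^+ 2.
  rewrite -(real_normK (num_real b)) -tt -expr2 -exprMn ler_sqr ?nnegrE//; exact: le_trans b2.
(* [a^2 - (u1 t)^2], [b^2 - (v1 t)^2] and [a b - u1 v1 t^2] become sums of products in which one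
   factor is quadratically small in [t]. *)
have -> : D - (W1 * u1 + W2 * v1) * t - (W1 * u2 + W2 * v2 + A * (u1 ^+ 2 - v1 ^+ 2) + B * (u1 * v1)) * t ^+ 2 =
  E + W1 * (a - u1 * t - u2 * t ^+ 2) + W2 * (b - v1 * t - v2 * t ^+ 2)
  + A * ((a * (a - u1 * t) + u1 * t * (a - u1 * t)) - (b * (b - v1 * t) + v1 * t * (b - v1 * t)))
  + B * (b * (a - u1 * t) + u1 * t * (b - v1 * t)) by rewrite /E; ring.
set P1 := a * (a - u1 * t) in q1 *; set P2 := u1 * t * (a - u1 * t) in q2 *.
set P3 := b * (b - v1 * t) in q3 *; set P4 := v1 * t * (b - v1 * t) in q4 *.
set P5 := b * (a - u1 * t) in q5 *; set P6 := u1 * t * (b - v1 * t) in q6 *.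
have A1 : `|A * ((P1 + P2) - (P3 + P4))| <= `|A| * (4 * (M ^+ 2 * e * t ^+ 2)).
  rewrite normrM ler_wpM2l//.
  have := ler_normB (P1 + P2) (P3 + P4); have := ler_normD P1 P2; have := ler_normD P3 P4; clear -q1 q2 q3 q4; lra.
have B1 : `|B * (P5 + P6)| <= `|B| * (2 * (M ^+ 2 * e * t ^+ 2)).
  rewrite normrM ler_wpM2l//; have := ler_normD P5 P6; clear -q5 q6; lra.
have C1 : `|W1 * (a - u1 * t - u2 * t ^+ 2)| <= `|W1| * (e * t ^+ 2) by rewrite normrM ler_wpM2l.
have C2 : `|W2 * (b - v1 * t - v2 * t ^+ 2)| <= `|W2| * (e * t ^+ 2) by rewrite normrM ler_wpM2l.
have E1 : `|E| <= e * (2 * (M ^+ 2 * t ^+ 2)).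
  by apply: le_trans hE _; rewrite ler_wpM2l ?(ltW e0)//; clear -aN bN; lra.
apply: le_trans (ler_normD _ _) _.
apply: le_trans (lerD (le_trans (ler_normD _ _) (lerD (le_trans (ler_normD _ _) (lerD (ler_normD _ _) (lexx _))) (lexx _))) (lexx _)) _.
have := ler_wpM2r t20 eK; rewrite /K; clear -A1 B1 C1 C2 E1; lra.
Qed.

Lemma sdge_minor (f g : R -> R) c : sdge g c -> (forall t, g t <= f t) -> g 0 = f 0 -> sdge f c.
Proof.
move=> gc gf g0 eta e0; have [rho r0 H] := gc eta e0; exists rho => // t tr.
by apply: le_trans (H t tr) _; rewrite -g0; have := gf t; have := gf (- t); lra.
Qed.

Lemma peanoZ (f : R -> R) b c k : peano f b c -> peano (fun t => k * f t) (k * b) (k * c).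
Proof.
move=> fp eta e0.
have k1 : 0 < `|k| + 1 by have := normr_ge0 k; lra.
have [|rho r0 H] := fp (eta / (`|k| + 1)); first by rewrite divr_gt0.
exists rho => // t tr.
have -> : k * f t - k * f 0 - k * b * t - k * c * t ^+ 2 = k * (f t - f 0 - b * t - c * t ^+ 2) by ring.
rewrite normrM; apply: le_trans (ler_wpM2l (normr_ge0 k) (H t tr)) _.
rewrite mulrA; apply: ler_wpM2r; first exact: sqr_ge0.
rewrite mulrCA ler_piMr ?(ltW e0)// ler_pdivrMr// mul1r; lra.
Qed.

End composition.

Section harmonic_pair.
Context {R : realType} {n : nat} (p : R) (hp : 1 <= p <= 2).
Local Notation Rn := 'rV[R]_n.
Variables (D : set Rn) (u v : Rn -> R) (k : R).
Hypotheses (hu : harmonic_on D u) (hv : harmonic_on D v).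

Let ui x i := partial i u x.
Let vi x i := partial i v x.

Lemma sum_lap0 (h : Rn -> R) x : harmonic_on D h -> D x ->
  \sum_(i < n) partial i (partial i h) x / 2 = 0.
Proof. by move=> hh Dx; rewrite -mulr_suml (hh.2.2.2 x Dx) mul0r. Qed.

(** Summed over the axes, the slopes of [F] multiply the Laplacians of [u] and [v], [B] multiplies
    [grad_dot], and [A] multiplies the difference of the squared gradients; only the last term
    survives. *)
Lemma sub_lap_comp (F : R -> R -> R) (x : Rn) (W1 W2 A B : R) : D x ->
  0 <= A * (grad_norm2 u x - grad_norm2 v x) -> grad_dot u v x = 0 ->
  (forall eta, 0 < eta -> exists2 rho, 0 < rho & forall a b, `|a| <= rho -> `|b| <= rho ->
    `|F (k * u x + a) (k * v x + b) - F (k * u x) (k * v x) - W1 * a - W2 * b - A * (a ^+ 2 - b ^+ 2) - B * (a * b)|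
    <= eta * (a ^+ 2 + b ^+ 2)) ->
  sub_lap (fun z => F (k * u z) (k * v z)) x.
Proof.
move=> Dx Ag dot HF.
pose cf i := 2 * (W1 * (k * (partial i (partial i u) x / 2)) + W2 * (k * (partial i (partial i v) x / 2))
  + A * ((k * ui x i) ^+ 2 - (k * vi x i) ^+ 2) + B * (k * ui x i * (k * vi x i))).
exists cf; split.
  move=> i; have pu := peanoZ k (harmonic_peano i hu Dx); have pv := peanoZ k (harmonic_peano i hv Dx).
  apply: peano_sdge.
  have := @peano_comp R F _ _ W1 W2 A B _ _ _ _ pu pv.
  by rewrite !scale0r !addr0; exact.
have key (S S1 S2 S3 G : R) : S = 2 * (W1 * k * S1 + W2 * k * S2 + k ^+ 2 * G + B * k ^+ 2 * S3) ->
    S1 = 0 -> S2 = 0 -> S3 = 0 -> 0 <= G -> 0 <= S.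
  move=> -> -> -> -> G0; rewrite !mulr0 !add0r addr0.
  by apply: mulr_ge0 => //; apply: mulr_ge0 => //; exact: sqr_ge0.
have E : \sum_i cf i = 2 * (W1 * k * (\sum_(i < n) partial i (partial i u) x / 2)
   + W2 * k * (\sum_(i < n) partial i (partial i v) x / 2)
   + k ^+ 2 * (A * (grad_norm2 u x - grad_norm2 v x)) + B * k ^+ 2 * grad_dot u v x).
  rewrite /grad_norm2 /grad_dot -sumrB !mulr_sumr -!big_split/= mulr_sumr.
  apply: eq_bigr => i _; rewrite /cf /ui /vi.
  by move: (partial i (partial i u) x) (partial i (partial i v) x) (partial i u x) (partial i v x) => c1 c2 c3 c4; ring.
have su := sum_lap0 hu Dx; have sv := sum_lap0 hv Dx.
exact: (key _ _ _ _ _ E su sv dot Ag).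
Qed.

(* Where [|k v| >= pi/2], [What] is touched from below by an affine function of [u]. *)
Lemma What_sub_lap x : D x -> grad_norm2 v x <= grad_norm2 u x -> grad_dot u v x = 0 ->
  sub_lap (fun z => What p (k * u z) (k * v z)) x.
Proof.
move=> Dx sub dot.
have [vp|vp] := ltP `|k * v x| (pi / 2).
  have [W1 [W2 [A [B [A0 HW]]]]] := Wp_taylor hp (k * u x) vp.
  apply: (@sub_lap_comp _ _ W1 W2 A B) => //.
    by rewrite mulr_ge0// subr_ge0.
  move=> eta e0; have [rho r0 H] := HW eta e0.
  exists (Num.min rho ((pi / 2 - `|k * v x|) / 2)); first by rewrite lt_min r0 divr_gt0// subr_gt0.
  move=> a b; rewrite !le_min => /andP[a1 _] /andP[b1 b2].
  have yb : `|k * v x + b| < pi / 2 by have := ler_normD (k * v x) b; lra.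
  by rewrite /What vp yb; exact: H.
have p1 : 1 <= p by move: hp => /andP[].
have [m Hm] := powR_support (k * u x) p1.
exists (fun i => 2 * (m * (k * (partial i (partial i u) x / 2)))); split.
  move=> i; have pu := peano_sdge (peanoZ m (peanoZ k (harmonic_peano i hu Dx))).
  pose w (t : R) := u (x + t *: basis_vec R i).
  apply: (@sdge_minor _ _ (fun t => (`|k * u x| `^ p - m * (k * u x)) + m * (k * w t))).
  - move=> eta e0; have [rho r0 H] := pu eta e0; exists rho => // t tr.
    by apply: le_trans (H t tr) _; rewrite /w; lra.
  - move=> t; apply: le_trans (What_ge hp _ _); have := Hm (k * w t); rewrite /w; lra.
  - by rewrite /w scale0r addr0 /What ltNge vp /=; ring.
by rewrite -!mulr_sumr sum_lap0// !mulr0.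
Qed.

(** Gradients of equal length make the composition harmonic, so that its negative qualifies too. *)
Lemma Wp_sub_lapN x : D x -> grad_norm2 v x = grad_norm2 u x -> grad_dot u v x = 0 ->
  `|k * v x| < pi / 2 -> sub_lap (fun z => - Wp p (k * u z) (k * v z)) x.
Proof.
move=> Dx sub dot vp.
have [W1 [W2 [A [B [A0 HW]]]]] := Wp_taylor hp (k * u x) vp.
apply: (@sub_lap_comp (fun s t => - Wp p s t) _ (- W1) (- W2) (- A) (- B)) => //.
  by rewrite sub subrr mulr0.
move=> eta e0; have [rho r0 H] := HW eta e0; exists rho => // a b a1 b1.
by rewrite -normrN; have := H a b a1 b1; congr (`|_| <= _); ring.
Qed.

End harmonic_pair.

(** * The upper bound *)

Section borel.
Context {R : realType} {n : nat}.
Local Notation Rn := 'rV[R]_n.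

Lemma open_borel (U : set Rn) : open U -> measurable (U : set (Rn_borel R n)).
Proof. exact: sub_sigma_algebra. Qed.

Lemma closed_borel (U : set Rn) : closed U -> measurable (U : set (Rn_borel R n)).
Proof. by move=> cU; rewrite -[U]setCK; apply: measurableC; apply: open_borel; exact: closed_openC. Qed.

Lemma continuous_borel (f : Rn -> R) : continuous f ->
  measurable_fun [set: Rn_borel R n] (f : Rn_borel R n -> R).
Proof.
move=> cf; apply: (measurability _ (RGenOpens.measurableE R)).
move=> _ [_ [a [b ->] <-]]; rewrite setTI; apply: open_borel.
by apply: open_comp; [move=> x _; exact: cf|exact: interval_open].
Qed.

Lemma bdry_closed (U : set Rn) : open U -> closed (bdry U).
Proof. by move=> oU; apply: closedI; [exact: closed_closure|exact: open_closedC]. Qed.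

Lemma closure_bounded (U : set Rn) : bounded_set U -> bounded_set (closure U).
Proof.
move=> [M [Mr HM]]; exists (M + 1); split; first exact: num_real.
move=> N MN x /= xU; apply/ler_addgt0Pr => e e0.
have [y [Uy]] := xU _ (nbhsx_ballx x e e0).
rewrite -ball_normE/= => xy.
have := HM (N - 1) (ltac:(lra)) y Uy => /= yN.
have := ler_normD (x - y) y; rewrite subrK; lra.
Qed.

Lemma closure_compact (U : set Rn) : bounded_set U -> compact (closure U).
Proof.
by move=> bU; apply: bounded_closed_compact; [exact: closure_bounded|exact: closed_closure].
Qed.

(** Tietze's theorem; the bound makes the extension integrable against harmonic measure. *)
Lemma compact_extension (K : set Rn) (w : Rn -> R) : compact K -> {in K, continuous w} ->
  exists g, [/\ continuous g, forall x, K x -> g x = w x & exists M, forall x, `|g x| <= M].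
Proof.
move=> cK cw.
have cw' : {within K, continuous w} by exact: continuous_in_subspaceT.
have [M0 [_ HM]] := compact_bounded (continuous_compact cw' cK).
have wM x : K x -> `|w x| <= `|M0| + 1.
  by move=> Kx; apply: HM; [have := ler_norm M0; lra|exists x].
have M1 : 0 < `|M0| + 1 by have := normr_ge0 M0; lra.
have clK : closed K by apply: compact_closed => //; exact: norm_hausdorff.
have [g [gw cg gM]] := continuous_bounded_extension (@pseudometric_normal R Rn) clK M1 cw' wM.
exists g; split => //; last by exists (`|M0| + 1).
by move=> x Kx; rewrite gw// inE.
Qed.

Local Open Scope ereal_scope.
Import HBNNSimple.

(** The integrands come from functions that are arbitrary outside [D] and may fail to be measurable,
    so the comparison is made on the simple functions below them, cut down to [B]. *)
Lemma le_integral_carried d (T : measurableType d) (mu : {measure set T -> \bar R}) (B : set T)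
    (f g : T -> \bar R) : measurable B -> mu (~` B) = 0 ->
  (forall x, 0 <= f x) -> (forall x, 0 <= g x) -> (forall x, B x -> f x <= g x) ->
  \int[mu]_x f x <= \int[mu]_x g x.
Proof.
move=> mB B0 f0 g0 fg; rewrite !ge0_integralTE//.
apply: ge_ereal_sup => _ [h hf <-].
apply: ereal_sup_ubound; exists (proj_nnsfun h mB).
  move=> x; rewrite /= mindicE; case: (boolP (x \in B)) => /= xB; rewrite ?mulr1 ?mulr0//.
  by apply: le_trans (hf x) (fg x _); rewrite inE in xB.
have mC : measurable (~` B) by exact: measurableC.
have e1 (k : {nnsfun T >-> R}) : sintegral mu k = \int[mu]_(x in B) (k x)%:E.
  have := @integral_nnsfun _ T R mu setT measurableT k.
  rewrite patch_setT => <-.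
  rewrite (@ge0_negligible_integral _ T R mu setT (~` B))//.
  - by rewrite setTD setCK.
  - exact/measurable_EFinP.
  - by move=> x _; rewrite lee_fin.
rewrite !e1; apply: eq_integral => x xB /=.
by rewrite mindicE xB mulr1.
Qed.

End borel.

(** * Perron upper functions and harmonic measure *)

Section perron.
Context {R : realType} {n : nat} (n0 : (0 < n)%N).
Local Notation Rn := 'rV[R]_n.
Variables (U : set Rn).
Hypotheses (bU : bounded_set U).

(** [s] itself belongs to the upper class: the maximum principle for [- s + h] on balls is its
    superharmonicity. *)
Lemma perron_upper_le (s f : Rn -> R) x0 : U x0 ->
  {in closure U, continuous s} ->
  (forall x, U x -> sub_lap (fun z => - s z) x) ->
  (forall x, bdry U x -> f x <= s x) -> (perron_upper U f x0 <= (s x0)%:E)%E.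
Proof.
move=> Ux0 cs ss fs; apply: ereal_inf_lbound; exists (EFin \o s) => //.
have cU x : U x -> closure U x by exact: subset_closure.
have csU x : U x -> {for x, continuous s} by move=> Ux; apply: cs; rewrite inE; exact: cU.
split; [|split].
- split; [by []|split].
  + move=> x Ux [a| |] //=; last by move=> _; exists (fun _ _ => setT) => [i j|y _] /=; [exact: filterT|rewrite ltNyr].
    rewrite lte_fin => ax.
    have : \forall y \near x, a < s y := csU x Ux _ (lt_nbhsr ax).
    by apply: filterS => y; rewrite lte_fin.
  + move=> c r r0 cr h ch hh hs y yB; rewrite lee_fin.
    suff : - s y + h y <= 0 by lra.
    apply: (@sub_lap_add_harmonic_le0 R n (fun z => - s z) h c r) => //.
    * apply: continuous_in_subspaceT => x; rewrite inE => xB.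
      by apply: (@continuousN _ _ _ s); apply: csU; exact: cr.
    * by move=> x xB; apply: ss; apply: cr; exact: ltW.
    * by move=> z zS; have := hs z zS; rewrite lee_fin; lra.
- have [|||z _ zmin] := @EVT_min_rV R n s (closure U).
  + by exists x0; exact: cU.
  + exact: closure_compact.
  + exact: continuous_in_subspaceT.
  exists (s z) => x Ux; rewrite lee_fin; apply: zmin; rewrite inE; exact: cU.
- move=> y yb a /lt_le_trans /(_ (fs y yb)) ay.
  have : \forall x \near y, a < s x := cs y (mem_set yb.1) _ (lt_nbhsr ay).
  by apply: filterS => x ax _; rewrite lte_fin.
Qed.

Lemma sub_lap_cst (k : R) x : @sub_lap R n (fun=> k) x.
Proof.
exists (fun=> 0); split; last by rewrite sumr_const mul0rn.
by move=> i eta e0; exists 1 => // t _; have := sqr_ge0 t; nra.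
Qed.

Lemma sub_lapD_cst g (k : R) (x : Rn) : sub_lap g x -> sub_lap (fun z => g z + k) x.
Proof.
move=> [cf [scf cf0]]; exists cf; split => // i eta e0.
have [rho r0 H] := scf i eta e0; exists rho => // t tr; apply: le_trans (H t tr) _; lra.
Qed.

Variables (x0 : Rn) (mu : {measure set (Rn_borel R n) -> \bar R}).
Hypotheses (Ux0 : U x0) (hmu : harmonic_measure U x0 mu).

(** The constant 1 is an upper function for the boundary data 1. *)
Lemma harmonic_measure_le1 : (mu setT <= 1)%E.
Proof.
have := hmu.2 (cst 1) (@cst_continuous _ _ _).
have -> : (\int[mu]_(x in (setT : set (Rn_borel R n))) (cst 1 x)%:E)%E = mu setT.
  by have := integral_cst mu (@measurableT _ (Rn_borel R n)) 1%E; rewrite mul1e.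
move=> ->; apply: (@perron_upper_le (cst 1)) => //.
- by move=> x _; exact: cst_continuous.
- by move=> x _; exact: (sub_lap_cst (- 1)).
Qed.

Lemma bounded_integrable (f : Rn -> R) : continuous f -> (exists M, forall x, `|f x| <= M) ->
  mu.-integrable (setT : set (Rn_borel R n)) (EFin \o f).
Proof.
move=> cf [M HM]; apply: measurable_bounded_integrable => //.
- by apply: le_lt_trans harmonic_measure_le1 _; rewrite ltry.
- exact: continuous_borel.
- exists M; split; first exact: num_real.
  by move=> N MN x _ /=; apply: le_trans (HM x) (ltW MN).
Qed.

Lemma integral_le_superharmonic (s f : Rn -> R) : continuous f ->
  {in closure U, continuous s} ->
  (forall x, U x -> sub_lap (fun z => - s z) x) ->
  (forall x, bdry U x -> f x <= s x) ->
  (\int[mu]_(x in (setT : set (Rn_borel R n))) (f x)%:E <= (s x0)%:E)%E.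
Proof. by move=> cf cs ss fs; rewrite hmu.2//; exact: perron_upper_le. Qed.

End perron.

Section upper_bound.
Context {R : realType} {n : nat} (n0 : (0 < n)%N) (p : R) (hp : 1 <= p <= 2).
Local Notation Rn := 'rV[R]_n.

Lemma What_comp_continuous (T : topologicalType) (f g : T -> R) x :
  {for x, continuous f} -> {for x, continuous g} ->
  {for x, continuous (fun z => What p (f z) (g z))}.
Proof.
move=> cf cg; apply/cvgrPdist_le => /= e e0.
have [rho r0 H] := What_continuous hp (f x) (g x) e0.
have /cvgrPdist_le/(_ _ r0) := cf; have /cvgrPdist_le/(_ _ r0) := cg.
apply: filterS2 => z /= gz fz; rewrite distrC.
have -> : f z = f x + (f z - f x) by ring.
have -> : g z = g x + (g z - g x) by ring.
by apply: H; rewrite distrC.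
Qed.

Lemma powR_comp_continuous (T : topologicalType) (f : T -> R) x :
  {for x, continuous f} -> {for x, continuous (fun z => `|f z| `^ p)}.
Proof.
move=> cf; have p0 : 0 < p by move: hp => /andP[]; lra.
apply: (@continuous_comp _ _ _ f (fun t => `|t| `^ p)) => //; exact: continuous_powR.
Qed.

Variables (D : set Rn) (xi : Rn) (u v : Rn -> R).
Hypotheses (hu : harmonic_on D u) (hv : harmonic_on D v) (Dxi : D xi).
Hypotheses (sub0 : `|v xi| <= `|u xi|)
  (sub : forall x, D x -> grad_norm2 v x <= grad_norm2 u x)
  (dot : forall x, D x -> grad_dot u v x = 0).

Lemma harmonic_continuous w x : harmonic_on D w -> D x -> {for x, continuous w}.
Proof. by move=> hw Dx; apply: differentiable_continuous; exact: (hw.2.1 x Dx).1. Qed.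

Lemma weak_member_le (U : set Rn) (mu : {measure set (Rn_borel R n) -> \bar R}) (t : R) :
  0 < t -> admissible D xi U -> harmonic_measure U xi mu ->
  ((t `^ p)%:E * mu [set x | bdry U x /\ (t <= `|v x|)%R] <=
   ((pi / 2) `^ p / Wp p 0 0)%:E * \int[mu]_(x in (setT : set (Rn_borel R n))) (`|u x| `^ p)%:E)%E.
Proof.
move=> t0 [[oU _] [bU [Uxi UD]]] hmu.
have W0 := Wp_center_gt0 hp; have pi0 := pi_gt0 R.
have p0 : 0 <= p by move: hp => /andP[]; lra.
have cK := closure_compact bU.
(* [u] and [v] are controlled only on [D]; bounded continuous extensions from [closure U] give
   integrands that are continuous everywhere, as the definition of harmonic measure demands. *)
have [u' [cu uu [Mu uM]]] := compact_extension cK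
  (fun x xK => harmonic_continuous hu (UD x (set_mem xK))).
have [v' [cv vv [Mv vM]]] := compact_extension cK
  (fun x xK => harmonic_continuous hv (UD x (set_mem xK))).
pose k := pi / 2 / t; have k0 : 0 < k by rewrite !divr_gt0.
pose Q (x : Rn) : R := What p (k * u' x) (k * v' x); pose P (x : Rn) : R := `|k * u' x| `^ p.
have ckf w : continuous w -> continuous (fun x : Rn => k * w x).
  by move=> cw x; apply: (@continuousM _ _ (cst k) w); [exact: cst_continuous|exact: cw].
have cP : continuous P by move=> x; apply: (@powR_comp_continuous _ (fun x => k * u' x)); exact: ckf.
have cQ : continuous Q by move=> x; apply: (@What_comp_continuous _ (fun x => k * u' x) (fun x => k * v' x)); exact: ckf.
have PM x : `|P x| <= (k * Mu) `^ p.
  have h : `|k * u' x| <= k * Mu by rewrite normrM (gtr0_norm k0) ler_pM2l.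
  by rewrite ger0_norm ?powR_ge0// ge0_ler_powR// nnegrE// (le_trans _ h).
pose Q1 (x : Rn) : R := Wp p 0 0 - Q x.
have cQ1 : continuous Q1.
  by move=> x; apply: (@continuousB _ _ _ (cst (Wp p 0 0)) Q); [exact: cst_continuous|exact: cQ].
have Q1le x : - P x <= Q1 x by rewrite /Q1 /Q /P; have := What_le hp (k * u' x) (k * v' x); lra.
have Q1M x : `|Q1 x| <= Wp p 0 0 + (k * Mu) `^ p.
  have := What_ge hp (k * u' x) (k * v' x); have := PM x; have := Q1le x.
  rewrite ger0_norm ?powR_ge0// ler_norml /Q1 /Q /P; move: (powR_ge0 `|k * u' x| p); lra.
have iP : mu.-integrable (setT : set (Rn_borel R n)) (EFin \o P).
  by apply: (bounded_integrable n0 bU Uxi hmu cP); exists ((k * Mu) `^ p).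
have iQ1 : mu.-integrable (setT : set (Rn_borel R n)) (EFin \o Q1).
  by apply: (bounded_integrable n0 bU Uxi hmu cQ1); exists (Wp p 0 0 + (k * Mu) `^ p).
(* Defined through [v'], this set is closed; on the boundary of [U] it is the set where
   [|v| >= t]. *)
pose A : set (Rn_borel R n) := [set x | pi / 2 <= `|k * v' x|].
have mA : measurable A.
  apply: closed_borel.
  rewrite (_ : A = (fun x : Rn => `|k * v' x|) @^-1` [set s | pi / 2 <= s])//.
  apply: closed_comp; last exact: closed_ge.
  move=> x _; apply: (@continuous_comp _ _ _ (fun x : Rn => k * v' x) Num.norm); first exact: ckf.
  exact: norm_continuous.
have mB : measurable (bdry U : set (Rn_borel R n)) by apply: closed_borel; exact: bdry_closed.
have kE a : (pi / 2 <= k * a) = (t <= a).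
  by rewrite /k -mulrA -[X in X <= _]mulr1 ler_pM2l ?divr_gt0// ler_pdivlMl// mulr1.
have AE : mu [set x | bdry U x /\ (t <= `|v x|)%R] = mu ((bdry U : set (Rn_borel R n)) `&` A).
  congr (mu _); apply/seteqP; split => x [bx /= h]; split => //=; move: h;
    by rewrite /A/= (vv x bx.1) normrM (gtr0_norm k0) kE.
have muA : (mu [set x | bdry U x /\ (t <= `|v x|)%R] <= mu A)%E.
  by rewrite AE; apply: le_measure; rewrite ?inE//; exact: measurableI.
have iA : mu.-integrable (setT : set (Rn_borel R n)) (EFin \o (fun x => Wp p 0 0 * \1_A x)).
  apply: measurable_bounded_integrable => //.
  - by apply: le_lt_trans (harmonic_measure_le1 n0 bU Uxi hmu) _; rewrite ltry.
  - by apply: measurable_funM => //; exact: measurable_indic.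
  - exists (Wp p 0 0); split; first exact: num_real.
    move=> N MN x _ /=; rewrite indicE; apply: le_trans (ltW MN).
    by case: (x \in A); rewrite ?mulr1 ?mulr0 ?normr0 ?gtr0_norm// ltW.
have main : ((Wp p 0 0)%:E * mu A <= \int[mu]_(x in (setT : set (Rn_borel R n))) (P x)%:E)%E.
  have -> : ((Wp p 0 0)%:E * mu A = \int[mu]_(x in (setT : set (Rn_borel R n))) (Wp p 0 0 * \1_A x)%:E)%E.
    under eq_integral do rewrite EFinM.
    rewrite ge0_integralZl_EFin ?ltW// ?integral_indic ?setIT//.
      by apply/measurable_EFinP; exact: measurable_indic.
  have le1 : {in (setT : set (Rn_borel R n)), forall x,
      ((EFin \o (fun x => (Wp p 0 0 * \1_A x)%R)) x <= ((EFin \o P) x + (EFin \o Q1) x)%E)%E}.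
    move=> x _ /=; rewrite -EFinD lee_fin indicE /Q1 /Q /P.
    have hl := What_le hp (k * u' x) (k * v' x).
    case: (boolP (x \in A)) => [|_]; last by rewrite mulr0; lra.
    by rewrite inE /A/= mulr1 /What leNgt => /negbTE ->; lra.
  have := le_integral measurableT iA (integrableD measurableT iP iQ1) le1.
  rewrite (integralD_EFin measurableT iP iQ1) => h.
  apply: le_trans h _; rewrite -[leRHS]adde0; apply: leeD => //.
  have cs w : harmonic_on D w -> {in closure U, continuous (fun x => k * w x)}.
    move=> hw x; rewrite inE => xU; apply: (@continuousM _ _ (cst k) w); first exact: cst_continuous.
    by apply: harmonic_continuous => //; exact: UD.
  have h2 := @integral_le_superharmonic R n n0 U bU xi mu Uxi hmu
    (fun x => Wp p 0 0 - What p (k * u x) (k * v x)) Q1 cQ1.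
  apply: le_trans (h2 _ _ _) _.
  - move=> x xU; apply: (@continuousB _ _ _ (cst (Wp p 0 0)) (fun x => What p (k * u x) (k * v x))).
      exact: cst_continuous.
    by apply: What_comp_continuous; exact: cs.
  - move=> x Ux; have Dx : D x by apply: UD; exact: subset_closure.
    have := sub_lapD_cst (- Wp p 0 0) (What_sub_lap hp k hu hv Dx (sub Dx) (dot Dx)).
    by congr (sub_lap _ x); apply/funext => z; rewrite opprB.
  - by move=> x bx; rewrite /Q1 /Q (uu x bx.1) (vv x bx.1).
  (* By [sub0] the pair lies at [xi] in the cone where the majorant is at least its centre value, so
     the integral of [Q1] is at most 0. *)
  - rewrite lee_fin subr_le0; apply: What_center_le => //.
    by rewrite !normrM ler_wpM2l.
have PI : (\int[mu]_(x in (setT : set (Rn_borel R n))) (P x)%:E <=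
   (k `^ p)%:E * \int[mu]_(x in (setT : set (Rn_borel R n))) (`|u x| `^ p)%:E)%E.
  have -> : (\int[mu]_(x in (setT : set (Rn_borel R n))) (P x)%:E =
      (k `^ p)%:E * \int[mu]_(x in (setT : set (Rn_borel R n))) (`|u' x| `^ p)%:E)%E.
    under eq_integral do rewrite /P normrM powRM// (gtr0_norm k0) EFinM.
    rewrite ge0_integralZl_EFin ?powR_ge0//.
    by apply/measurable_EFinP; apply: continuous_borel => x; apply: powR_comp_continuous; exact: cu.
  apply: lee_wpmul2l; first by rewrite lee_fin powR_ge0.
  apply: (le_integral_carried mB hmu.1); rewrite ?lee_fin ?powR_ge0// => x bx.
  by rewrite (uu x bx.1).
(* Since [t k = pi/2], the final factor [t^p k^p / Wp p 0 0] does not depend on [t]. *)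
have E1 : (t `^ p)%:E = ((t `^ p / Wp p 0 0)%:E * (Wp p 0 0)%:E)%E by rewrite -EFinM divfK ?gt_eqF.
apply: (@le_trans _ _ ((t `^ p)%:E * mu A)%E).
  by apply: lee_wpmul2l => //; rewrite lee_fin powR_ge0.
rewrite E1 -muleA; apply: le_trans (lee_wpmul2l _ (le_trans main PI)) _.
  by rewrite lee_fin divr_ge0 ?powR_ge0// ltW.
rewrite muleA -EFinM.
have -> // : t `^ p / Wp p 0 0 * k `^ p = (pi / 2) `^ p / Wp p 0 0.
have -> : pi / 2 = t * k by rewrite /k [RHS]mulrC divfK ?gt_eqF.
by rewrite powRM// ?ltW// mulrAC.
Qed.

Lemma weak_norm_le : (weak_norm D xi p v <=
  (((pi / 2) `^ p / Wp p 0 0) `^ p^-1)%:E * strong_norm D xi p u)%E.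
Proof.
apply: ge_ereal_sup => _ [[t [U mu]] /= [t0 [adm hmu]] <-].
have p1 : 0 <= p^-1 by rewrite invr_ge0; move: hp => /andP[]; lra.
have C0 : 0 <= (pi / 2) `^ p / Wp p 0 0 by rewrite divr_ge0 ?powR_ge0// ltW// Wp_center_gt0.
have I0 : (0 <= \int[mu]_(x in (setT : set (Rn_borel R n))) (`|u x| `^ p)%:E)%E.
  by apply: integral_ge0 => x _; rewrite lee_fin powR_ge0.
apply: le_trans (gt0_ler_poweR p1 _ _ (weak_member_le t0 adm hmu)) _.
- by rewrite in_itv/= leey andbT mule_ge0// lee_fin powR_ge0.
- by rewrite in_itv/= leey andbT mule_ge0// lee_fin.
rewrite poweRM ?lee_fin// poweR_EFin; apply: lee_wpmul2l; first by rewrite lee_fin powR_ge0.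
by apply: ereal_sup_ubound; exists mu => //; exists U.
Qed.

End upper_bound.

(** * Holomorphic calculus on the plane *)

(** The differential of [f] is identified with that of [g] by uniqueness. This serves partial
    derivatives that agree with a formula only on an open set. *)
Lemma near_eq_differentiable {R : realType} (V W : normedModType R) (f g : V -> W) (z : V) :
  differentiable g z -> (\forall y \near z, f y = g y) -> differentiable f z.
Proof.
move=> dg fg; have fgz : f z = g z := nbhs_singleton fg.
have /diff_locallyP[cg eg] := dg.
have ef : f \o shift z = cst (f z) + 'd g z +o_ 0 id.
  apply/eqaddoP => eps e0; have /eqaddoP/(_ eps e0) := eg.
  have : \forall h \near (0 : V), f (h + z) = g (h + z).
    have : (fun h : V => h + z) @ 0 --> 0 + z by apply: cvgD; [exact: cvg_id|exact: cvg_cst].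
    by rewrite add0r => h; exact: h _ fg.
  by apply: filterS2 => h /= fgh; rewrite !fctE /= fgh fgz.
have E := diff_unique cg ef.
by apply/diff_locallyP; rewrite E.
Qed.

Section calculus.
Context {R : realType} {n : nat}.
Local Notation Rn := 'rV[R]_n.
Implicit Types (f g : Rn -> R) (z : Rn).

Lemma differentiable_coordinate (j : 'I_n) z : differentiable (fun y : Rn => y 0 j) z.
Proof. exact: differentiable_coord. Qed.

Lemma partial_coordinate (i j : 'I_n) z : partial i (fun y : Rn => y 0 j) z = (i == j)%:R.
Proof.
have /matrixP/(_ 0 j) := derive_mx (@derivable_id _ _ z (basis_vec R i)).
by rewrite derive_id !mxE eq_sym /partial => <-.
Qed.

Lemma partial_cst (i : 'I_n) (k : R) z : partial i (fun=> k) z = 0.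
Proof. exact: derive_cst. Qed.

Lemma partialD i f g z : differentiable f z -> differentiable g z ->
  partial i (fun y => f y + g y) z = partial i f z + partial i g z.
Proof. by move=> df dg; apply: deriveD; exact: diff_derivable. Qed.

Lemma partialM i f g z : differentiable f z -> differentiable g z ->
  partial i (fun y => f y * g y) z = f z * partial i g z + g z * partial i f z.
Proof. by move=> df dg; apply: deriveM; exact: diff_derivable. Qed.

Lemma partialB i f g z : differentiable f z -> differentiable g z ->
  partial i (fun y => f y - g y) z = partial i f z - partial i g z.
Proof. by move=> df dg; apply: deriveB; exact: diff_derivable. Qed.

Lemma partial_comp i (phi : R -> R) (d : R) f z : differentiable f z ->
  is_derive (f z) 1 phi d -> differentiable (phi \o f) z /\ partial i (phi \o f) z = d * partial i f z.
Proof.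
move=> df [dphi phid].
have dp : differentiable phi (f z) by apply/derivable1_diffP.
split; first exact: differentiable_comp.
rewrite /partial !deriveE//; last exact: differentiable_comp.
by rewrite diff_comp//= diff1E// derive1E phid /GRing.scale/= mulrC.
Qed.

End calculus.

Section cauchy_riemann.
Context {R : realType}.
Local Notation R2 := 'rV[R]_2.
Implicit Types (f g h k a b c d : R2 -> R) (z : R2) (U : set R2).

(* [f + i g] is holomorphic on [U], with complex derivative [a + i b]. *)
Definition cauchy_riemann U f g a b := forall z, U z ->
  [/\ differentiable f z /\ differentiable g z, partial 0 f z = a z, partial 1 f z = - b z,
      partial 0 g z = b z & partial 1 g z = a z].

Lemma ord2P (P : 'I_2 -> Prop) : P 0 -> P 1 -> forall i, P i.
Proof. by move=> P0 P1 [[|[|//]] i2]; [have -> // : Ordinal i2 = 0|have -> // : Ordinal i2 = 1]; exact/val_inj. Qed.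

Lemma sum2 (F : 'I_2 -> R) : \sum_(i < 2) F i = F 0 + F 1.
Proof.
by rewrite !big_ord_recl big_ord0 addr0; congr (_ + F _); exact/val_inj.
Qed.

Lemma cr_id U : cauchy_riemann U (fun z => z 0 0) (fun z => z 0 1) (cst 1) (cst 0).
Proof.
move=> z _; rewrite !partial_coordinate /= oppr0; split => //.
by split; exact: differentiable_coordinate.
Qed.

Lemma cr_cst U (x y : R) : cauchy_riemann U (fun=> x) (fun=> y) (cst 0) (cst 0).
Proof.
move=> z _; by rewrite !partial_cst /= oppr0.
Qed.

Lemma crD U f g a b h k c d : cauchy_riemann U f g a b -> cauchy_riemann U h k c d ->
  cauchy_riemann U (fun z => f z + h z) (fun z => g z + k z) (fun z => a z + c z) (fun z => b z + d z).
Proof.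
move=> H K z Uz; have [[df dg] f0 f1 g0 g1] := H z Uz; have [[dh dk] h0 h1 k0 k1] := K z Uz.
rewrite !partialD// f0 f1 g0 g1 h0 h1 k0 k1 opprD; split => //.
by split; apply: differentiableD.
Qed.

Lemma crM U f g a b h k c d : cauchy_riemann U f g a b -> cauchy_riemann U h k c d ->
  cauchy_riemann U (fun z => f z * h z - g z * k z) (fun z => f z * k z + g z * h z)
    (fun z => a z * h z - b z * k z + (f z * c z - g z * d z))
    (fun z => a z * k z + b z * h z + (f z * d z + g z * c z)).
Proof.
move=> H K z Uz; have [[df dg] f0 f1 g0 g1] := H z Uz; have [[dh dk] h0 h1 k0 k1] := K z Uz.
have d1 : differentiable (fun z => f z * h z) z by exact: differentiableM.
have d2 : differentiable (fun z => g z * k z) z by exact: differentiableM.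
have d3 : differentiable (fun z => f z * k z) z by exact: differentiableM.
have d4 : differentiable (fun z => g z * h z) z by exact: differentiableM.
rewrite !partialB// !partialD// !partialM// f0 f1 g0 g1 h0 h1 k0 k1; split; try ring.
by split; [exact: differentiableB|exact: differentiableD].
Qed.

(** [a + i b] is the first and [c + i d] the second complex derivative, so the second partial
    derivatives are [c] and [d] up to sign, and the two pure ones cancel. *)
Lemma cr_harmonic U f g a b c d : open U -> cauchy_riemann U f g a b ->
  cauchy_riemann U a b c d -> (forall z, U z -> {for z, continuous c} /\ {for z, continuous d}) ->
  harmonic_on U f /\ harmonic_on U g.
Proof.
move=> oU H K cc.
have near_U z (P : R2 -> Prop) : U z -> (forall y, U y -> P y) -> \forall y \near z, P y.
  by move=> Uz HP; apply: filterS HP _; exact: open_nbhs_nbhs.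
have dN (q : R2 -> R) z : differentiable q z -> differentiable (fun y => - q y) z by exact: differentiableN.
have pN (q : R2 -> R) i z : differentiable q z -> partial i (fun y => - q y) z = - partial i q z.
  by move=> dq; apply: deriveN; exact: diff_derivable.
have cN (q : R2 -> R) z : {for z, continuous q} -> {for z, continuous (fun y => - q y)}.
  by move=> cq; exact: (@continuousN _ _ _ q).
(* Common to [f] and [g]: the gradient is [(p0, p1)], and the matrix of second derivatives has
   diagonal [q0], [- q0] and both other entries [q1]. *)
have main F (p0 p1 q0 q1 : R2 -> R) :
    (forall z, U z -> [/\ differentiable F z, partial 0 F z = p0 z & partial 1 F z = p1 z]) ->
    (forall z, U z -> differentiable p0 z /\ differentiable p1 z) ->
    (forall z, U z -> [/\ partial 0 p0 z = q0 z, partial 1 p0 z = q1 z, partial 0 p1 z = q1 z & partial 1 p1 z = - q0 z]) ->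
    (forall z, U z -> {for z, continuous q0} /\ {for z, continuous q1}) -> harmonic_on U F.
  move=> HF Hp Hq Hc.
  have nF0 z : U z -> \forall y \near z, partial 0 F y = p0 y by move=> Uz; apply: near_U => // y /HF[].
  have nF1 z : U z -> \forall y \near z, partial 1 F y = p1 y by move=> Uz; apply: near_U => // y /HF[].
  have E0 i z : U z -> partial i (partial 0 F) z = partial i p0 z.
    by move=> Uz; apply: near_eq_derive; exact: nF0.
  have E1 i z : U z -> partial i (partial 1 F) z = partial i p1 z.
    by move=> Uz; apply: near_eq_derive; exact: nF1.
  have cont (F1 F2 : R2 -> R) z : U z -> (forall y, U y -> F1 y = F2 y) -> {for z, continuous F2} -> {for z, continuous F1}.
    move=> Uz F12 cF; rewrite /prop_for/= /continuous_at (F12 z Uz).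
    have nE : \forall y \near z, F2 y = F1 y by apply: near_U => // y /F12.
    exact: cvg_trans (near_eq_cvg nE) cF.
  split => //; split; [|split].
  - move=> z Uz; split; first by have [] := HF z Uz.
    have [d0 d1] := Hp z Uz.
    by apply: ord2P; [apply: near_eq_differentiable d0 (nF0 z Uz)|apply: near_eq_differentiable d1 (nF1 z Uz)].
  - apply: ord2P; apply: ord2P => z Uz; have [c0 c1] := Hc z Uz.
    + by apply: (cont _ q0) => // y Uy; rewrite E0//; have [] := Hq y Uy.
    + by apply: (cont _ q1) => // y Uy; rewrite E0//; have [] := Hq y Uy.
    + by apply: (cont _ q1) => // y Uy; rewrite E1//; have [] := Hq y Uy.
    + by apply: (cont _ (fun y => - q0 y)); [|move=> y Uy; rewrite E1//; have [] := Hq y Uy|exact: cN].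
  - move=> z Uz; rewrite sum2.
    by have [q00 _ _ q11] := Hq z Uz; rewrite E0// E1// q00 q11 subrr.
split.
  apply: (main f a (fun z => - b z) c (fun z => - d z)).
  - by move=> z /H[[]].
  - by move=> z /K[[da db] _ _ _ _]; split => //; exact: dN.
  - by move=> z /K[[da db] a0 a1 b0 b1]; rewrite !pN// a0 a1 b0 b1.
  - by move=> z /cc[c1 c2]; split => //; exact: cN.
apply: (main g b a d c).
- by move=> z /H[[]].
- by move=> z /K[[da db] _ _ _ _]; split.
- by move=> z /K[[da db] a0 a1 b0 b1]; rewrite a0 a1 b0 b1.
- by move=> z /cc[c1 c2].
Qed.

Lemma cr_grad U f g a b z : cauchy_riemann U f g a b -> U z ->
  grad_norm2 g z = grad_norm2 f z /\ grad_dot f g z = 0.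
Proof.
move=> H Uz; have [_ f0 f1 g0 g1] := H z Uz.
by rewrite /grad_norm2 /grad_dot !sum2 f0 f1 g0 g1; split; ring.
Qed.

End cauchy_riemann.

Section harmonic_polynomials.
Context {R : realType}.
Local Notation R2 := 'rV[R]_2.

(* Real and imaginary parts of [(x + i y)^m]. *)
Fixpoint cpow (m : nat) (z : R2) : R * R :=
  if m is m'.+1 then ((cpow m' z).1 * z 0 0 - (cpow m' z).2 * z 0 1,
                      (cpow m' z).1 * z 0 1 + (cpow m' z).2 * z 0 0) else (1, 0).

Lemma cpow_cr m : cauchy_riemann setT (fun z => (cpow m.+1 z).1) (fun z => (cpow m.+1 z).2)
  (fun z => m.+1%:R * (cpow m z).1) (fun z => m.+1%:R * (cpow m z).2).
Proof.
elim: m => [|m IH].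
  have := crM (cr_cst (U := setT) 1 0) (@cr_id R setT); congr cauchy_riemann; apply/funext => z /=; ring.
have := crM IH (@cr_id R setT).
have -> : (fun z => (m.+1%:R * (cpow m z).1) * z 0 0 - (m.+1%:R * (cpow m z).2) * z 0 1 + ((cpow m.+1 z).1 * cst 1 z - (cpow m.+1 z).2 * cst 0 z)) = (fun z => m.+2%:R * (cpow m.+1 z).1).
  by apply/funext => z /=; rewrite -[in RHS]natr1; ring.
have -> // : (fun z => (m.+1%:R * (cpow m z).1) * z 0 1 + (m.+1%:R * (cpow m z).2) * z 0 0 + ((cpow m.+1 z).1 * cst 0 z + (cpow m.+1 z).2 * cst 1 z)) = (fun z => m.+2%:R * (cpow m.+1 z).2).
by apply/funext => z /=; rewrite -[in RHS]natr1; ring.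
Qed.

Lemma cpow_continuous m : continuous (fun z => (cpow m z).1) /\ continuous (fun z => (cpow m z).2).
Proof.
case: m => [|m]; first by split; exact: cst_continuous.
by split => z; apply: differentiable_continuous; have [[]] := @cpow_cr m z I.
Qed.

End harmonic_polynomials.

(** * Fejer sums *)

Lemma two_pi_gt0 {R : realType} : 0 < 2 * pi :> R.
Proof. by rewrite mulr_gt0// pi_gt0. Qed.

Definition unif_angle {R : realType} := uniform_prob (@two_pi_gt0 R).

HB.lock Definition avg {R : realType} (g : R -> R) : R :=
  \int[@unif_angle R]_x g x.

Section average.
Context {R : realType}.
Notation P := (@unif_angle R).
Implicit Types (f g : R -> R) (m n N : nat) (s t : R).

Definition bcont g := continuous g /\ exists M, forall s, `|g s| <= M.

Lemma unif_angleT : P setT = 1%E.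
Proof. exact: (@probability_setT _ _ _ (uniform_prob (@two_pi_gt0 R))). Qed.

Lemma bcont_integrable g : bcont g -> P.-integrable setT (EFin \o g).
Proof.
move=> [cg [M gM]]; apply: measurable_bounded_integrable => //.
- by apply: (@le_lt_trans _ _ 1%E); [rewrite -unif_angleT|exact: ltry].
- exact: continuous_measurable_fun.
- exists M; split; first exact: num_real.
  by move=> K MK x _; exact: le_trans (gM x) (ltW MK).
Qed.

Lemma bcontD f g : bcont f -> bcont g -> bcont (fun s => f s + g s).
Proof.
move=> [cf [M fM]] [cg [K gK]]; split.
  by move=> x; apply: (@continuousD _ _ _ f g); [exact: cf|exact: cg].
by exists (M + K) => s; apply: le_trans (ler_normD _ _) _; exact: lerD.
Qed.

Lemma bcontM f g : bcont f -> bcont g -> bcont (fun s => f s * g s).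
Proof.
move=> [cf [M fM]] [cg [K gK]]; split.
  by move=> x; apply: (@continuousM _ _ f g); [exact: cf|exact: cg].
by exists (M * K) => s; rewrite normrM; exact: ler_pM.
Qed.

Lemma bcont_cst (k : R) : bcont (fun=> k).
Proof. by split; [exact: cst_continuous|exists `|k|]. Qed.

Lemma bcontZ (k : R) g : bcont g -> bcont (fun s => k * g s).
Proof. exact/bcontM/bcont_cst. Qed.

Lemma bcont_cos (k l : R) : bcont (fun s => cos (k * s + l)).
Proof.
split; last by exists 1 => s; exact: cos_max.
move=> s; apply: (@continuous_comp _ _ _ (fun s => k * s + l) cos); last exact: continuous_cos.
apply: (@continuousD _ _ _ (fun s => k * s) (cst l)); last exact: cst_continuous.
by apply: (@continuousM _ _ (cst k) id); [exact: cst_continuous|].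
Qed.

Lemma bcont_sin (k : R) : bcont (fun s => sin (k * s)).
Proof.
have := bcont_cos k (- (pi / 2)); under eq_fun do rewrite cosBpihalf; exact.
Qed.

Lemma avgE g : avg g = \int[P]_x g x. Proof. by rewrite avg.unlock. Qed.

Lemma avgD f g : bcont f -> bcont g -> avg (fun s => f s + g s) = avg f + avg g.
Proof. by move=> bf bg; rewrite !avgE RintegralD//; exact: bcont_integrable. Qed.

Lemma avgZ k g : bcont g -> avg (fun s => k * g s) = k * avg g.
Proof. by move=> bg; rewrite !avgE RintegralZl//; exact: bcont_integrable. Qed.

Lemma le_avg f g : bcont f -> bcont g -> (forall s, f s <= g s) -> avg f <= avg g.
Proof. by move=> bf bg fg; rewrite !avgE; apply: le_Rintegral => //; exact: bcont_integrable. Qed.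

Lemma avg_cst (k : R) : avg (fun=> k) = k.
Proof.
rewrite avgE /Rintegral; transitivity (fine (k%:E * P setT)); last by rewrite unif_angleT mule1.
by congr fine; exact: (integral_cst P measurableT k%:E).
Qed.

Lemma eq_avg f g : f =1 g -> avg f = avg g.
Proof. by move=> /funext->. Qed.

Lemma avg_FTC f F : continuous f -> (forall s, 0 <= f s) -> (forall s : R, is_derive s 1 F (f s)) ->
  avg f = (F (2 * pi) - F 0) / (2 * pi).
Proof.
move=> cf f0 dF; rewrite avgE /Rintegral integral_uniform//; last first.
  by apply/measurable_EFinP; exact: continuous_measurable_fun.
have cF : continuous F.
  by move=> x; apply: differentiable_continuous; apply/derivable1_diffP; case: (dF x).
rewrite (@continuous_FTC2 R f F 0 (2 * pi)) ?two_pi_gt0//.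
- by rewrite subr0 -EFinB -EFinM/= mulrC.
- exact: continuous_subspaceT.
- split; first by move=> x _; case: (dF x).
  + by apply: cvg_at_right_filter; exact: cF.
  + by apply: cvg_at_left_filter; exact: cF.
- by move=> x _; rewrite derive1E; case: (dF x).
Qed.

Lemma sin_nat_pi m : sin (m%:R * (2 * pi)) = 0 :> R /\ cos (m%:R * (2 * pi)) = 1 :> R.
Proof.
elim: m => [|m [IHs IHc]]; first by rewrite mul0r sin0 cos0.
have -> : m.+1%:R * (2 * pi) = m%:R * (2 * pi) + pi *+ 2 :> R.
  by rewrite -natr1 mulrDl mul1r -[pi *+ 2]mulr_natl.
by rewrite sinD2pi cosD2pi.
Qed.

Lemma avg_cos m : avg (fun s => cos (m.+1%:R * s)) = 0.
Proof.
have bc : bcont (fun s => cos (m.+1%:R * s)).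
  by have := bcont_cos m.+1%:R 0; under eq_fun do rewrite addr0.
have m0 : m.+1%:R != 0 :> R by rewrite pnatr_eq0.
(* [avg_FTC] is for nonnegative integrands, hence the added constant 1. *)
have := @avg_FTC (fun s => 1 + cos (m.+1%:R * s)) (fun s => s + sin (m.+1%:R * s) / m.+1%:R).
rewrite avgD//; last exact: bcont_cst.
rewrite avg_cst (sin_nat_pi m.+1).1 mulr0 sin0 !mul0r !addr0 subr0 divff ?gt_eqF ?two_pi_gt0// => H.
have : 1 + avg (fun s => cos (m.+1%:R * s)) = 1; last by lra.
apply: H.
- exact: (bcontD (bcont_cst 1) bc).1.
- by move=> s; have := cos_geN1 (m.+1%:R * s); lra.
- move=> s; move: m0; move: (m.+1%:R : R) => M m0.
  by apply: is_derive_eq; rewrite /GRing.scale/=; field.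
Qed.

Lemma avg_sin m : avg (fun s => sin (m.+1%:R * s)) = 0.
Proof.
have m0 : m.+1%:R != 0 :> R by rewrite pnatr_eq0.
have bs := bcont_sin m.+1%:R.
have := @avg_FTC (fun s => 1 + sin (m.+1%:R * s)) (fun s => s - cos (m.+1%:R * s) / m.+1%:R).
rewrite avgD//; last exact: bcont_cst.
rewrite avg_cst (sin_nat_pi m.+1).2 mulr0 cos0 sub0r opprK subrK divff ?gt_eqF ?two_pi_gt0// => H.
have : 1 + avg (fun s => sin (m.+1%:R * s)) = 1; last by lra.
apply: H.
- exact: (bcontD (bcont_cst 1) bs).1.
- by move=> s; have := sin_geN1 (m.+1%:R * s); lra.
- move=> s; move: m0; move: (m.+1%:R : R) => M m0.
  by apply: is_derive_eq; rewrite /GRing.scale/=; field.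
Qed.

Fixpoint dirichlet n s : R := if n is n'.+1 then dirichlet n' s + 2 * cos (n'.+1%:R * s) else 1.
(** The Fejer kernel without its factor [1 / (N + 1)], so that its mean is [N + 1]. *)
Fixpoint fejer N s : R := if N is N'.+1 then fejer N' s + dirichlet N'.+1 s else 1.

(** The factor [1 - cos s] makes the cosine sum telescope; summing over [n] telescopes once more in
    [fejer_mul]. *)
Lemma dirichlet_mul n s : (1 - cos s) * dirichlet n s = cos (n%:R * s) - cos (n.+1%:R * s).
Proof.
elim: n => [|n IH] /=; first by rewrite mul0r cos0 mul1r mulr1.
rewrite mulrDr IH.
have -> : n.+2%:R * s = n.+1%:R * s + s by rewrite -natr1 mulrDl mul1r.
have -> : n%:R * s = n.+1%:R * s - s by rewrite -natr1 mulrDl mul1r addrK.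
rewrite cosB cosD; ring.
Qed.

Lemma fejer_mul N s : (1 - cos s) * fejer N s = 1 - cos (N.+1%:R * s).
Proof.
elim: N => [|N IH] /=; first by rewrite mul1r mulr1.
by rewrite mulrDr IH -/(dirichlet N.+1 s) dirichlet_mul; ring.
Qed.

Lemma dirichlet_cos1 n s : cos s = 1 -> 0 <= dirichlet n s.
Proof.
move=> c1; have s0 : sin s = 0.
  by have := cos2Dsin2 s; rewrite c1 expr1n => h; apply/eqP; rewrite -sqrf_eq0; apply/eqP; lra.
have cs m : cos (m%:R * s) = 1 /\ sin (m%:R * s) = 0.
  elim: m => [|m [IHc IHs]]; first by rewrite mul0r cos0 sin0.
  by rewrite -natr1 mulrDl mul1r cosD sinD IHc IHs c1 s0; split; ring.
elim: n => [|n IH] //=; rewrite (cs n.+1).1; lra.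
Qed.

(** Where [cos s] differs from 1, divide [fejer_mul] by [1 - cos s]; elsewhere every Dirichlet
    kernel is nonnegative. *)
Lemma fejer_ge0 N s : 0 <= fejer N s.
Proof.
have [c1|c1] := eqVneq (cos s) 1.
  by elim: N => [|N IH] //; apply: addr_ge0 => //; exact: dirichlet_cos1.
have c2 : 0 < 1 - cos s by rewrite subr_gt0 lt_neqAle c1 cos_le1.
rewrite -(pmulr_rge0 _ c2) fejer_mul; have := cos_le1 (N.+1%:R * s); lra.
Qed.

Lemma bcont_dirichlet n t : bcont (fun s => dirichlet n (t - s)).
Proof.
elim: n => [|n IH] /=; first exact: bcont_cst.
apply: bcontD => //; apply: bcontZ.
have := bcont_cos (- n.+1%:R) (n.+1%:R * t); congr bcont; apply/funext => s; congr cos; ring.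
Qed.

Lemma bcont_fejer N t : bcont (fun s => fejer N (t - s)).
Proof.
elim: N => [|N IH]; first exact: bcont_cst.
exact: (bcontD IH (@bcont_dirichlet N.+1 t)).
Qed.

Section partial_sums.
Variables (g : R -> R).
Hypothesis bg : bcont g.

Definition coefc m := avg (fun s => cos (m%:R * s) * g s).
Definition coefs m := avg (fun s => sin (m%:R * s) * g s).

(** [C] and [S] stand for the basis functions. With [cos(m t)] and [sin(m t)] the sums live on the
    circle, with the real and imaginary parts of [(z / r)^m] they are the harmonic extension to the
    disc, and with 0 they are its value at the centre. *)
Fixpoint dirichlet_sum (C S : nat -> R) n : R := if n is n'.+1 then
  dirichlet_sum C S n' + 2 * (C n * coefc n + S n * coefs n) else coefc 0.
Fixpoint fejer_sum (C S : nat -> R) N : R := if N is N'.+1 then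
  fejer_sum C S N' + dirichlet_sum C S N'.+1 else coefc 0.

Lemma avg_dirichlet n t : avg (fun s => dirichlet n (t - s) * g s) =
  dirichlet_sum (fun m => cos (m%:R * t)) (fun m => sin (m%:R * t)) n.
Proof.
have bcos m : bcont (fun s => cos (m%:R * s) * g s).
  by apply: bcontM => //; have := bcont_cos m%:R 0; under eq_fun do rewrite addr0.
have bsin m : bcont (fun s => sin (m%:R * s) * g s) by exact/bcontM/bg/bcont_sin.
elim: n => [|n IH] /=.
  by apply: eq_avg => s; rewrite mul0r cos0.
rewrite -IH /coefc /coefs -!avgZ// -avgD; [|exact: bcontZ|exact: bcontZ].
rewrite -avgZ; last by apply: bcontD; exact: bcontZ.
rewrite -avgD; [|exact/bcontM/bg/bcont_dirichlet|by apply: bcontZ; apply: bcontD; exact: bcontZ].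
by apply: eq_avg => s; rewrite mulrBr cosB; ring.
Qed.

Lemma avg_fejer N t : avg (fun s => fejer N (t - s) * g s) =
  fejer_sum (fun m => cos (m%:R * t)) (fun m => sin (m%:R * t)) N.
Proof.
elim: N => [|N IH] /=; first by apply: eq_avg => s; rewrite mul0r cos0.
rewrite -IH -[dirichlet_sum _ _ N + _]/(dirichlet_sum (fun m => cos (m%:R * t)) (fun m => sin (m%:R * t)) N.+1).
rewrite -avg_dirichlet -avgD; [|exact/bcontM/bg/bcont_fejer|exact: (bcontM (@bcont_dirichlet N.+1 t) bg)].
by apply: eq_avg => s; rewrite mulrDl.
Qed.

Lemma dirichlet_sum0 n : dirichlet_sum (fun=> 0) (fun=> 0) n = avg g.
Proof.
elim: n => [|n IH] /=; first by apply: eq_avg => s; rewrite mul0r cos0 mul1r.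
by rewrite IH !mul0r addr0 mulr0 addr0.
Qed.

Lemma fejer_sum0 N : fejer_sum (fun=> 0) (fun=> 0) N = N.+1%:R * avg g.
Proof.
elim: N => [|N IH] /=; first by rewrite mul1r; apply: eq_avg => s; rewrite mul0r cos0 mul1r.
rewrite IH -[dirichlet_sum _ _ N + _]/(dirichlet_sum (fun=> 0) (fun=> 0) N.+1) dirichlet_sum0.
by rewrite -[N.+2%:R]natr1; ring.
Qed.

End partial_sums.

Lemma avg_fejer1 N t : avg (fun s => fejer N (t - s)) = N.+1%:R.
Proof.
have := avg_fejer (bcont_cst 1) N t; under eq_avg do rewrite mulr1; move=> ->.
have c0 : coefc (fun=> 1) 0 = 1.
  by rewrite -[RHS]avg_cst; apply: eq_avg => s; rewrite mul0r cos0 mulr1.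
have c1 m : coefc (fun=> 1) m.+1 = 0.
  by rewrite -(avg_cos m); apply: eq_avg => s; rewrite mulr1.
have s1 m : coefs (fun=> 1) m.+1 = 0.
  by rewrite -(avg_sin m); apply: eq_avg => s; rewrite mulr1.
set C := fun m => cos _; set S := fun m => sin _.
have d n : dirichlet_sum (fun=> 1) C S n = 1.
  by elim: n => [|n IH] //=; rewrite IH c1 s1 !mulr0 addr0 mulr0 addr0.
elim: N => [|N IH] //=; rewrite IH -[dirichlet_sum _ _ _ N + _]/(dirichlet_sum (fun=> 1) C S N.+1) d.
by rewrite natr1.
Qed.

(** The modulus of continuity is stated with [1 - cos(t - s)] because this factor times the kernel
    is [1 - cos((N + 1)(t - s))], which is at most 2. *)
Lemma fejer_approx g (e M : R) N t : bcont g -> 0 <= e -> 0 <= M ->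
  (forall s, `|g s - g t| <= e + M * (1 - cos (t - s))) ->
  `|avg (fun s => fejer N (t - s) * g s) / N.+1%:R - g t| <= e + 2 * M / N.+1%:R.
Proof.
move=> bg e0 M0 H; have N0 : 0 < N.+1%:R :> R by rewrite ltr0n.
have bF := bcont_fejer N t.
have -> : g t = (g t * N.+1%:R) / N.+1%:R by rewrite mulfK ?gt_eqF.
rewrite -mulrBl normrM [X in _ * X]gtr0_norm ?invr_gt0// ler_pdivrMr// mulrDl divfK ?gt_eqF//.
have E k : avg (fun s => k * fejer N (t - s)) = k * N.+1%:R by rewrite avgZ// avg_fejer1.
have E2 (k : R) : 0 <= k -> avg (fun s => (e + M * (1 - cos (t - s))) * fejer N (t - s)) <= e * N.+1%:R + 2 * M.
  move=> _; have -> : (fun s => (e + M * (1 - cos (t - s))) * fejer N (t - s)) =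
     (fun s => e * fejer N (t - s) + M * (1 - cos (- N.+1%:R * s + N.+1%:R * t))).
    apply/funext => s; rewrite mulrDl -mulrA fejer_mul; congr (_ + _ * (_ - cos _)); ring.
  have b1 : bcont (fun s => M * (1 - cos (- N.+1%:R * s + N.+1%:R * t))).
    apply: bcontZ; apply: bcontD; first exact: bcont_cst.
    by have := bcontZ (- 1) (bcont_cos (- N.+1%:R) (N.+1%:R * t)); under eq_fun do rewrite mulN1r.
  rewrite avgD//; last exact: bcontZ.
  rewrite E lerD2l; apply: le_trans (le_avg b1 (bcont_cst (2 * M)) _) _; last by rewrite avg_cst.
  by move=> s; rewrite mulrC ler_wpM2r//; have := cos_geN1 (- N.+1%:R * s + N.+1%:R * t); lra.
have b2 : bcont (fun s => (e + M * (1 - cos (t - s))) * fejer N (t - s)).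
  apply: bcontM => //; apply: bcontD; first exact: bcont_cst.
  apply: bcontZ; apply: bcontD; first exact: bcont_cst.
  have := bcontZ (- 1) (bcont_cos (- 1) t); congr bcont; apply/funext => s.
  by rewrite mulN1r; congr (- cos _); ring.
have b3 : bcont (fun s => fejer N (t - s) * g s) by exact: bcontM.
have b4 := bcontZ (g t) bF.
have key s : `|fejer N (t - s) * g s - g t * fejer N (t - s)| <= (e + M * (1 - cos (t - s))) * fejer N (t - s).
  rewrite [g t * _]mulrC -mulrBr normrM ger0_norm ?fejer_ge0// mulrC.
  by apply: ler_wpM2r; [exact: fejer_ge0|exact: H].
rewrite -(E (g t)).
have E2' := E2 0 (lexx 0).
rewrite ler_norml; apply/andP; split.
  rewrite lerBrDr; have : avg (fun s => g t * fejer N (t - s)) <= avg (fun s => fejer N (t - s) * g s)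
     + avg (fun s => (e + M * (1 - cos (t - s))) * fejer N (t - s)).
    rewrite -avgD//; apply: le_avg => //; first exact: bcontD.
    by move=> s; have := key s; rewrite ler_norml; lra.
  lra.
rewrite lerBlDr; have : avg (fun s => fejer N (t - s) * g s) <= avg (fun s => g t * fejer N (t - s))
     + avg (fun s => (e + M * (1 - cos (t - s))) * fejer N (t - s)).
  rewrite -avgD//; apply: le_avg => //; first exact: bcontD.
  by move=> s; have := key s; rewrite ler_norml; lra.
lra.
Qed.

End average.

(** * Harmonic measure of discs *)

Section holomorphic_polynomials.
Context {R : realType}.
Local Notation R2 := 'rV[R]_2.
Implicit Types (f g a b c d : R2 -> R) (U : set R2).

Lemma crZ U (x y : R) f g a b : cauchy_riemann U f g a b ->
  cauchy_riemann U (fun z => x * f z - y * g z) (fun z => x * g z + y * f z)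
    (fun z => x * a z - y * b z) (fun z => x * b z + y * a z).
Proof.
move=> H; have := crM (cr_cst (U := U) x y) H.
by congr cauchy_riemann; apply/funext => z /=; ring.
Qed.

(** Real parts of entire functions, with the derivatives that [cr_harmonic] asks for; the class is
    closed under real linear combinations. *)
Definition re_hol f := exists g a b c d,
  [/\ cauchy_riemann setT f g a b, cauchy_riemann setT a b c d, continuous c & continuous d].

Lemma re_hol_harmonic f : re_hol f -> harmonic_on setT f.
Proof.
move=> [g [a [b [c [d [H K cc cd]]]]]].
have cc2 z : [set: R2] z -> {for z, continuous c} /\ {for z, continuous d} by split; [exact: cc|exact: cd].
exact: (cr_harmonic openT H K cc2).1.
Qed.

Lemma re_holD f f' : re_hol f -> re_hol f' -> re_hol (fun z => f z + f' z).
Proof.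
move=> [g [a [b [c [d [H K cc cd]]]]]] [g' [a' [b' [c' [d' [H' K' cc' cd']]]]]].
exists (fun z => g z + g' z), (fun z => a z + a' z), (fun z => b z + b' z),
  (fun z => c z + c' z), (fun z => d z + d' z).
split; [exact: crD|exact: crD| |] => z.
  by apply: (@continuousD _ _ _ c c'); [exact: cc|exact: cc'].
by apply: (@continuousD _ _ _ d d'); [exact: cd|exact: cd'].
Qed.

Lemma re_holZ k f : re_hol f -> re_hol (fun z => k * f z).
Proof.
move=> [g [a [b [c [d [H K cc cd]]]]]].
have kE (q q' : R2 -> R) : (fun z => k * q z - 0 * q' z) = (fun z => k * q z).
  by apply/funext => z; rewrite mul0r subr0.
have kE' (q q' : R2 -> R) : (fun z => k * q z + 0 * q' z) = (fun z => k * q z).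
  by apply/funext => z; rewrite mul0r addr0.
exists (fun z => k * g z), (fun z => k * a z), (fun z => k * b z), (fun z => k * c z), (fun z => k * d z).
split; [by have := crZ k 0 H; rewrite !kE !kE'|by have := crZ k 0 K; rewrite !kE !kE'| |] => z.
  by apply: (@continuousM _ _ (cst k) c); [exact: cst_continuous|exact: cc].
by apply: (@continuousM _ _ (cst k) d); [exact: cst_continuous|exact: cd].
Qed.

Lemma re_hol_cst (k : R) : re_hol (fun=> k).
Proof.
by exists (fun=> 0), (cst 0), (cst 0), (cst 0), (cst 0); split; try exact: cr_cst; exact: cst_continuous.
Qed.

(** At [m = 0] the factor [m] vanishes, so the truncated predecessor still gives the right
    derivative. *)
Lemma cpow_cr0 m : cauchy_riemann setT (fun z : R2 => (cpow m z).1) (fun z => (cpow m z).2)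
  (fun z => m%:R * (cpow m.-1 z).1) (fun z => m%:R * (cpow m.-1 z).2).
Proof.
case: m => [|m]; last exact: cpow_cr.
have := cr_cst (U := [set: R2]) 1 0.
by congr cauchy_riemann; apply/funext => z /=; rewrite mul0r.
Qed.

Lemma re_hol_cpow m (x y : R) : re_hol (fun z => x * (cpow m z).1 + y * (cpow m z).2).
Proof.
pose k : R := m%:R; pose l : R := m.-1%:R.
have E1 (q q' : R2 -> R) : (fun z => k * q z - 0 * q' z) = (fun z => k * q z).
  by apply/funext => z; rewrite mul0r subr0.
have E2 (q q' : R2 -> R) : (fun z => k * q z + 0 * q' z) = (fun z => k * q z).
  by apply/funext => z; rewrite mul0r addr0.
have K := crZ k 0 (@cpow_cr0 m.-1); rewrite !E1 !E2 in K.
have yE (q q' : R2 -> R) : (fun z => x * q z - - y * q' z) = (fun z => x * q z + y * q' z).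
  by apply/funext => z; rewrite mulNr opprK.
(* [x Re(w) + y Im(w)] is the real part of [(x - i y) w]. *)
have := crZ x (- y) (@cpow_cr0 m); rewrite yE => H.
eexists; eexists; eexists; eexists; eexists; split; [exact: H|exact: (crZ x (- y) K)| |];
  have [c1 c2] := @cpow_continuous R m.-2; move=> z.
- apply: (@continuousB _ _ _ (fun z => x * (k * (l * (cpow m.-2 z).1))) (fun z => - y * (k * (l * (cpow m.-2 z).2)))).
    by apply: (@continuousM _ _ (cst x)); [exact: cst_continuous|apply: (@continuousM _ _ (cst k)); [exact: cst_continuous|apply: (@continuousM _ _ (cst l)); [exact: cst_continuous|exact: c1]]].
  by apply: (@continuousM _ _ (cst (- y))); [exact: cst_continuous|apply: (@continuousM _ _ (cst k)); [exact: cst_continuous|apply: (@continuousM _ _ (cst l)); [exact: cst_continuous|exact: c2]]].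
- apply: (@continuousD _ _ _ (fun z => x * (k * (l * (cpow m.-2 z).2))) (fun z => - y * (k * (l * (cpow m.-2 z).1)))).
    by apply: (@continuousM _ _ (cst x)); [exact: cst_continuous|apply: (@continuousM _ _ (cst k)); [exact: cst_continuous|apply: (@continuousM _ _ (cst l)); [exact: cst_continuous|exact: c2]]].
  by apply: (@continuousM _ _ (cst (- y))); [exact: cst_continuous|apply: (@continuousM _ _ (cst k)); [exact: cst_continuous|apply: (@continuousM _ _ (cst l)); [exact: cst_continuous|exact: c1]]].
Qed.

End holomorphic_polynomials.

Section uniform_continuity.
Context {R : realType} {n : nat}.
Local Notation Rn := 'rV[R]_n.

Lemma nsq_lt_ball (x y : Rn) (d : R) : 0 < d -> nsq x y < d ^+ 2 -> `|x - y| < d.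
Proof.
move=> d0 h; apply: mxnorm_lt => // i; rewrite !mxE distrC.
have := le_lt_trans (nsq_coord x y i) h.
by rewrite -(real_normK (num_real (y 0 i - x 0 i))) ltr_sqr ?nnegrE// ltW.
Qed.

Lemma nsq_triangle (x y w : Rn) : nsq x w <= 2 * nsq x y + 2 * nsq y w.
Proof.
rewrite /nsq !mulr_sumr -big_split/=; apply: ler_sum => i _.
by have := sqr_ge0 ((y 0 i - x 0 i) - (w 0 i - y 0 i)); nra.
Qed.

Lemma compact_unif (K : set Rn) (f : Rn -> R) (e : R) : compact K -> continuous f -> 0 < e ->
  exists2 d : R, 0 < d & forall x y, K x -> nsq x y < d ^+ 2 -> `|f x - f y| <= e.
Proof.
move=> cK cf e0.
have pw x : K x -> \forall x' \near x & d \near (0 : R)^'+, forall y, nsq x' y < d ^+ 2 -> `|f x' - f y| <= e.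
  move=> Kx.
  have /cvgrPdist_le/(_ (e / 2)) := cf x; rewrite divr_gt0// => /(_ isT).
  move=> /nbhs_ballP[r /= r0 H].
  (* Half radii, since by [nsq_triangle] two Euclidean distances below [r/2] give one below [r]. *)
  exists (eball x (r / 2), [set d : R | 0 < d < r / 2]) => /=.
    split; first by apply: open_nbhs_nbhs; split; [exact: open_eball|rewrite /eball/= (eq_bigr (fun=> 0)) ?big1 ?exprn_gt0 ?divr_gt0// => i _; rewrite subrr expr0n].
    near=> d => /=; apply/andP; split; first by near: d; exact: nbhs_right_gt.
    by near: d; apply: nbhs_right_lt; rewrite divr_gt0.
  move=> [x' d] /= [xx' /andP[d0 dr]] y yd.
  have near_x w : nsq x w < r ^+ 2 -> `|f x - f w| <= e / 2.
    by move=> h; apply: H; rewrite -ball_normE/=; exact: nsq_lt_ball.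
  have h1 : nsq x x' < (r / 2) ^+ 2 by [].
  have dr2 : d ^+ 2 < (r / 2) ^+ 2 by rewrite ltr_pXn2r ?nnegrE ?divr_ge0 ?ltW.
  have rE : r ^+ 2 = 4 * (r / 2) ^+ 2 by field.
  have := nsq_triangle x x' y => h2.
  have := near_x y _; rewrite rE => /(_ ltac:(lra)) h3.
  have := near_x x' _; rewrite rE => /(_ ltac:(have := sqr_ge0 (r / 2); lra)) h4.
  rewrite (_ : f x' - f y = - (f x - f x') + (f x - f y)); last by ring.
  by have := ler_normD (- (f x - f x')) (f x - f y); rewrite normrN; lra.
have FF : ProperFilter (0 : R)^'+ by exact: _.
have cov := (compact_near_coveringP K).1 cK R ((0 : R)^'+)
  (fun d x => forall y, nsq x y < d ^+ 2 -> `|f x - f y| <= e) _ pw.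
have [d [d0 Hd]] := filter_ex (filterI (nbhs_right_gt 0) (cov _)).
by exists d => // x y Kx; exact: Hd.
Unshelve. all: by end_near.
Qed.

End uniform_continuity.

Section disc.
Context {R : realType}.
Local Notation R2 := 'rV[R]_2.
Implicit Types (z w : R2) (f : R2 -> R) (r s t e : R).

Definition circ r t : R2 := (r * cos t) *: delta_mx 0 0 + (r * sin t) *: delta_mx 0 1.

Lemma circ0 r t : circ r t 0 0 = r * cos t.
Proof. by rewrite !mxE /= mulr1 mulr0 addr0. Qed.

Lemma circ1 r t : circ r t 0 1 = r * sin t.
Proof. by rewrite !mxE /= mulr1 mulr0 add0r. Qed.

Lemma continuous_circ r : continuous (circ r).
Proof.
move=> t; apply: cvgD; apply: cvgZr_tmp.
  by apply: (@continuousM _ _ (cst r) cos); [exact: cst_continuous|exact: continuous_cos].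
by apply: (@continuousM _ _ (cst r) sin); [exact: cst_continuous|exact: continuous_sin].
Qed.

Lemma nsq2 w z : nsq w z = (z 0 0 - w 0 0) ^+ 2 + (z 0 1 - w 0 1) ^+ 2.
Proof. exact: sum2. Qed.

Lemma nsq02 z : nsq 0 z = z 0 0 ^+ 2 + z 0 1 ^+ 2.
Proof. by rewrite nsq2 !mxE !subr0. Qed.

Lemma row2P z w : z 0 0 = w 0 0 -> z 0 1 = w 0 1 -> z = w.
Proof. by move=> h0 h1; apply/rowP; apply: ord2P. Qed.

Lemma nsq_circ r t : nsq 0 (circ r t) = r ^+ 2.
Proof. by rewrite nsq02 circ0 circ1 !exprMn -mulrDr cos2Dsin2 mulr1. Qed.

(** The squared chord links Euclidean continuity to the factor [1 - cos(t - s)] of the Fejer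
    estimate. *)
Lemma nsq_circ2 r s t : nsq (circ r t) (circ r s) = 2 * r ^+ 2 * (1 - cos (t - s)).
Proof.
rewrite nsq2 !circ0 !circ1 cosB; have := cos2Dsin2 s; have := cos2Dsin2 t.
move: (cos s) (sin s) (cos t) (sin t) => a b c d h1 h2.
rewrite (_ : _ + _ = r ^+ 2 * ((a ^+ 2 + b ^+ 2) + (c ^+ 2 + d ^+ 2) - 2 * (a * c + b * d))); last by ring.
by rewrite h1 h2; ring.
Qed.

Lemma circ_surj r z : 0 < r -> nsq 0 z = r ^+ 2 -> exists t, z = circ r t.
Proof.
rewrite nsq02 => r0 E; have rn : r != 0 by rewrite gt_eqF.
pose c := z 0 0 / r; pose d := z 0 1 / r.
have E1 : c ^+ 2 + d ^+ 2 = 1 by rewrite !expr_div_n -mulrDl E divff// expf_neq0.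
have c1 : -1 <= c <= 1.
  by rewrite -ler_norml -(@ler_pXn2r _ 2)// ?nnegrE// expr1n real_normK ?num_real//; have := sqr_ge0 d; lra.
have d2 : 1 - c ^+ 2 = d ^+ 2 by lra.
have cK : cos (acos c) = c by apply: acosK; rewrite in_itv.
have sK : sin (acos c) = `|d| by rewrite sin_acos// d2 sqrtr_sqr.
have z0 : z 0 0 = r * c by rewrite /c mulrC divfK.
have z1 : z 0 1 = r * d by rewrite /d mulrC divfK.
have [d0|d0] := leP 0 d.
  by exists (acos c); apply: row2P; rewrite ?circ0 ?circ1 ?cK ?sK ?ger0_norm.
by exists (- acos c); apply: row2P; rewrite ?circ0 ?circ1 ?cosN ?sinN ?cK ?sK ?(ltr0_norm d0) ?opprK.
Qed.

Lemma cpow_circ r m t : cpow m (circ r t) = (r ^+ m * cos (m%:R * t), r ^+ m * sin (m%:R * t)).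
Proof.
elim: m => [|m IH] /=; first by rewrite mul0r cos0 sin0 expr0 mulr1 mulr0.
rewrite IH /= circ0 circ1 -natr1 mulrDl mul1r cosD sinD exprS.
by congr (_, _); ring.
Qed.

Lemma cpow0 m : cpow m.+1 (0 : R2) = (0, 0).
Proof. by elim: m => [|m IH] /=; rewrite !mxE !mulr0 subr0 addr0. Qed.

Section polynomial.
Variables (g : R -> R) (r : R).
Hypothesis r0 : 0 < r.

Definition fejer_poly N z : R :=
  fejer_sum g (fun m => (cpow m z).1 / r ^+ m) (fun m => (cpow m z).2 / r ^+ m) N / N.+1%:R.

Lemma fejer_poly_re_hol N : re_hol (fejer_poly N).
Proof.
have hd n : re_hol (fun z => dirichlet_sum g (fun m => (cpow m z).1 / r ^+ m) (fun m => (cpow m z).2 / r ^+ m) n).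
  elim: n => [|n IH]; first exact: re_hol_cst.
  apply: (re_holD IH); have := re_hol_cpow n.+1 (2 * coefc g n.+1 / r ^+ n.+1) (2 * coefs g n.+1 / r ^+ n.+1).
  congr re_hol; apply/funext => z; move: (cpow _ z).1 (cpow _ z).2 (coefc _ _) (coefs _ _) (_ ^+ _)^-1 => a b c d k; ring.
have hf : re_hol (fun z => fejer_sum g (fun m => (cpow m z).1 / r ^+ m) (fun m => (cpow m z).2 / r ^+ m) N).
  by elim: N => [|N IH]; [exact: re_hol_cst|exact: (re_holD IH (hd N.+1))].
by have := re_holZ (N.+1%:R)^-1 hf; congr re_hol; apply/funext => z; rewrite /fejer_poly mulrC.
Qed.

Lemma eq_fejer_sum (C S C' S' : nat -> R) N : (forall m, C m.+1 = C' m.+1) ->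
  (forall m, S m.+1 = S' m.+1) -> fejer_sum g C S N = fejer_sum g C' S' N.
Proof.
move=> CC SS; have d n : dirichlet_sum g C S n = dirichlet_sum g C' S' n.
  by elim: n => [|n IH] //=; rewrite IH CC SS.
by elim: N => [|N IH] //; rewrite -[LHS]/(fejer_sum g C S N + dirichlet_sum g C S N.+1) IH d.
Qed.

Lemma fejer_poly0 N : fejer_poly N 0 = avg g.
Proof.
rewrite /fejer_poly (@eq_fejer_sum _ _ (fun=> 0) (fun=> 0)).
- by rewrite fejer_sum0 mulrC mulKf// pnatr_eq0.
- by move=> m; rewrite cpow0 mul0r.
- by move=> m; rewrite cpow0 mul0r.
Qed.

Lemma fejer_poly_circ N t : bcont g -> fejer_poly N (circ r t) = avg (fun s => fejer N (t - s) * g s) / N.+1%:R.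
Proof.
move=> bg; rewrite /fejer_poly avg_fejer//; congr (_ / _).
have rm m : r ^+ m != 0 by rewrite expf_neq0 ?gt_eqF.
by apply: eq_fejer_sum => m; rewrite cpow_circ /= mulrC mulKf.
Qed.

End polynomial.

Lemma bcont_circ f r : continuous f -> bcont (fun s => f (circ r s)).
Proof.
move=> cf; split.
  by move=> s; apply: (@continuous_comp _ _ _ (circ r) f); [exact: continuous_circ|exact: cf].
have [M [_ HM]] := compact_bounded (continuous_compact (continuous_subspaceT cf) (@compact_ecball R 2 0 r)).
exists (`|M| + 1) => s; apply: HM; first by have := ler_norm M; lra.
by exists (circ r s) => //; rewrite /ecball/= -[X in X <= _]/(nsq 0 (circ r s)) nsq_circ.
Qed.

(** Fejer means preserve the constant coefficient, so the value at the centre is the exact mean and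
    only the boundary values carry an error. *)
Lemma harmonic_approx f r e : continuous f -> 0 < r -> 0 < e ->
  exists H, [/\ re_hol H, H 0 = avg (fun s => f (circ r s)) &
    forall z, nsq 0 z = r ^+ 2 -> `|H z - f z| <= e].
Proof.
move=> cf r0 e0; have bg := bcont_circ r cf.
have e2 : 0 < e / 2 by rewrite divr_gt0.
have [d d0 Hd] := compact_unif (@compact_ecball R 2 0 r) cf e2.
have [_ [B HB]] := bg.
have B0 : 0 <= B by exact: le_trans (normr_ge0 _) (HB 0).
(* At chord distance at least [d], the oscillation [2 B] is at most [2 B / d^2] times the squared
   chord, which is [2 r^2 (1 - cos(t - s))]. *)
pose M := 2 * B / d ^+ 2 * (2 * r ^+ 2).
have M0 : 0 <= M by rewrite /M; apply: mulr_ge0; [apply: divr_ge0; [exact: mulr_ge0|exact: sqr_ge0]|apply: mulr_ge0 => //; exact: sqr_ge0].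
have osc s t : `|f (circ r s) - f (circ r t)| <= e / 2 + M * (1 - cos (t - s)).
  have c1 : 0 <= 1 - cos (t - s) by have := cos_le1 (t - s); lra.
  have [h|h] := ltP (nsq (circ r t) (circ r s)) (d ^+ 2).
    rewrite distrC; apply: le_trans (Hd _ _ _ h) _; last by rewrite lerDl mulr_ge0.
    by rewrite /ecball/= -[X in X <= _]/(nsq 0 (circ r t)) nsq_circ.
  have d20 : 0 < d ^+ 2 by rewrite exprn_gt0.
  have : 2 * B <= M * (1 - cos (t - s)).
    rewrite /M -mulrA -nsq_circ2 mulrAC ler_pdivlMr//; apply: ler_wpM2l => //; exact: mulr_ge0.
  have := ler_normB (f (circ r s)) (f (circ r t)); have := HB s; have := HB t; lra.
have [N HN] : exists N : nat, 2 * M / N.+1%:R <= e / 2.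
  exists (Num.trunc (2 * M / (e / 2))); rewrite ler_pdivrMr ?ltr0n// -ler_pdivrMl// [X in X <= _]mulrC.
  by apply/ltW; exact: truncnS_gt.
exists (fejer_poly (fun s => f (circ r s)) r N); split.
- exact: fejer_poly_re_hol.
- exact: fejer_poly0.
- move=> z /(circ_surj r0)[t ->]; rewrite fejer_poly_circ//.
  apply: le_trans (fejer_approx N bg (ltW e2) M0 (fun s => osc s t)) _.
  by rewrite [leRHS]splitr lerD2l.
Qed.

Lemma nsq_scale (k : R) z : nsq 0 (k *: z) = k ^+ 2 * nsq 0 z.
Proof. by rewrite !nsq02 !mxE; ring. Qed.

Lemma closure_eball r : closure (eball (0 : R2) r) `<=` ecball 0 r.
Proof.
have := closed_ecball (c := 0 : R2) (r := r).
rewrite closure_id => ->; apply: closure_subset => z; exact: ltW.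
Qed.

Lemma bdry_eball r : 0 < r -> bdry (eball (0 : R2) r) = esphere 0 r.
Proof.
move=> r0; apply/seteqP; split => z.
  move=> [/closure_eball zc zb]; apply/eqP; rewrite eq_le zc/= leNgt; exact/negP.
move=> zs; have zs' : nsq 0 z = r ^+ 2 := zs; split; last by rewrite /eball/= -[X in X < _]/(nsq 0 z) zs' ltxx.
move=> B; rewrite nbhsE => -[V [oV Vz] VB].
have [rho rho0 H] := near_line (- z) oV Vz.
pose t := Num.min (rho / 2) (1 / 2).
have t0 : 0 < t by rewrite lt_min !divr_gt0.
have t1 : t <= 1 / 2 by rewrite ge_min lexx orbT.
exists (z + t *: - z); split; last by apply/VB/H; rewrite gtr0_norm// gt_min ltr_pdivrMr// ltr_pMr// ltr1n.
have -> : z + t *: - z = (1 - t) *: z by rewrite scalerN scalerBl scale1r.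
rewrite /eball/= -[X in X < _]/(nsq 0 _) nsq_scale zs' -[X in _ < X]mul1r ltr_pM2r ?exprn_gt0//.
by rewrite expr_lt1//; lra.
Qed.

Lemma domain_eball r : 0 < r -> domain (eball (0 : R2) r).
Proof.
move=> r0; have b0 : eball (0 : R2) r 0 by rewrite /eball/= -[X in X < _]/(nsq 0 (0 : R2)) nsq02 !mxE expr0n addr0 exprn_gt0.
split; [exact: open_eball|split; last by exists 0].
(* The disc is the union of the segments from its centre. *)
have -> : eball (0 : R2) r = \bigcup_(z in eball (0 : R2) r) ((fun t : R => t *: z) @` `[0, 1]).
  apply/seteqP; split => [z zr|z [w wr [t]]].
    by exists z => //; exists 1; [rewrite /= in_itv/= lexx ler01|rewrite scale1r].
  rewrite /= in_itv/= => /andP[t0 t1] <-.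
  rewrite /eball/= -[X in X < _]/(nsq 0 _) nsq_scale; apply: le_lt_trans wr.
  by rewrite -[X in _ <= X]/(nsq 0 w) ler_piMl ?nsq_ge0// expr_le1.
apply: bigcup_connected.
  by exists 0 => z _; exists 0; [rewrite /= in_itv/= lexx ler01|rewrite scale0r].
move=> z _; apply: connected_continuous_connected; first exact: segment_connected.
apply: continuous_subspaceT => t; apply: (@cvgZr_tmp _ _ _ _ _ _ _ z); exact: cvg_id.
Qed.

Lemma bounded_eball r : bounded_set (eball (0 : R2) r).
Proof.
have [M [Mr HM]] := @bounded_ecball R 2 0 r; exists M; split => // N MN z zr.
by apply: (HM N MN); exact: ltW.
Qed.

(** The boundary condition on [s] is a lower limit, and superharmonicity concerns closed balls
    inside the disc. Compactness keeps the set where [h < s] fails away from the circle, so the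
    comparison takes place on a slightly smaller one. *)
Lemma harmonic_le_perron f (h : R2 -> R) r e (s : R2 -> \bar R) : 0 < r -> 0 < e ->
  harmonic_on setT h -> (forall z, nsq 0 z = r ^+ 2 -> h z + e <= f z) ->
  perron_upper_class (eball 0 r) f s -> ((h (0 : R2)%R)%:E <= s (0 : R2)%R)%E.
Proof.
move=> r0 e0 hh hf [[_ [_ sup]] [_ bs]].
have hc z : {for z, continuous h} by exact: harmonic_continuous hh I.
pose A := [set z | eball (0 : R2) r z /\ ~ ((h z)%:E < s z)%E].
have r20 : 0 < r ^+ 2 by rewrite exprn_gt0.
have notA z : nsq 0 z = r ^+ 2 -> ~ closure A z.
  move=> zr; have zb : bdry (eball (0 : R2) r) z by rewrite bdry_eball.
  have hz := hf z zr.
  have az : h z + e / 2 < f z by lra.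
  have n1 := bs z zb _ az.
  have n2 : \forall y \near z, h y < h z + e / 2.
    have hz' : h z < h z + e / 2 by lra.
    exact: (hc z _ (lt_nbhsl hz')).
  move=> /(_ _ (filterI n1 n2)) [y [[yr yA] [y1 y2]]]; apply: yA.
  by apply: lt_trans (y1 yr); rewrite lte_fin.
have bA : bounded_set A.
  have [M [Mr HM]] := bounded_eball r; exists M; split => // N MN z [zr _]; exact: (HM N MN).
have [r' [r'0 r'r Hr]] : exists r', [/\ 0 < r', r' < r & forall z, nsq 0 z = r' ^+ 2 -> ((h z)%:E < s z)%E].
  have inB (q : R) z : 0 < q -> q < r -> nsq 0 z = q ^+ 2 -> eball 0 r z.
    by move=> q0 qr zq; rewrite /eball/= -[X in X < _]/(nsq 0 z) zq ltr_pXn2r ?nnegrE ?ltW.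
  have [A0|A0] := pselect (closure A !=set0); last first.
    exists (r / 2); split; [by rewrite divr_gt0|by rewrite ltr_pdivrMr// ltr_pMr// ltr1n|].
    move=> z zr; apply: contrapT => hz; apply: A0; exists z; apply: subset_closure; split => //.
    by apply: inB zr; [rewrite divr_gt0|rewrite ltr_pdivrMr// ltr_pMr// ltr1n].
  have [|||w wA wmax] := @EVT_max_rV R 2 (nsq 0) (closure A).
  - by [].
  - exact: closure_compact.
  - by apply: continuous_subspaceT; exact: nsq_continuous.
  rewrite inE in wA.
  have wr : nsq 0 w < r ^+ 2.
    have : nsq 0 w <= r ^+ 2.
      have AB : A `<=` eball 0 r by move=> z [].
      exact: closure_eball (closure_subset AB wA).
    by rewrite le_eqVlt => /predU1P[/notA|].
  have w0 := nsq_ge0 0 w.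
  (* [q^2] lies halfway between the largest squared distance of the exceptional set from the centre
     and [r^2]. *)
  pose q := Num.sqrt ((nsq 0 w + r ^+ 2) / 2).
  have q2 : q ^+ 2 = (nsq 0 w + r ^+ 2) / 2 by rewrite sqr_sqrtr// divr_ge0//; lra.
  have q0 : 0 < q by rewrite sqrtr_gt0 divr_gt0//; lra.
  have qr : q < r by rewrite -(ltr_pXn2r (ltn0Sn 1)) ?nnegrE ?ltW// q2; lra.
  exists q; split => // z zq; apply: contrapT => hz.
  have : nsq 0 z <= nsq 0 w.
    by apply: wmax; rewrite inE; apply: subset_closure; split => //; exact: inB zq.
  rewrite zq q2; lra.
have sub : ecball (0 : R2) r' `<=` eball 0 r.
  by move=> z zr; apply: le_lt_trans zr _; rewrite ltr_pXn2r ?nnegrE ?ltW.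
apply: (sup 0 r' r'0 sub h) => //.
- by apply: continuous_subspaceT => z; exact: hc.
- have [_ [d [c l]]] := hh; split; first exact: open_eball.
  by split; [|split] => *; [exact: d|exact: c|exact: l].
- by move=> z zr; apply: ltW; exact: Hr.
- by rewrite /eball/= -[X in X < _]/(nsq 0 (0 : R2)) nsq02 !mxE expr0n addr0 exprn_gt0.
Qed.

Lemma harmonic_sub_lapN (U : set R2) h z : harmonic_on U h -> U z -> sub_lap (fun y => - h y) z.
Proof.
move=> hh Uz; exists (fun i => 2 * (- 1 * (partial i (partial i h) z / 2))); split.
  move=> i; have := peano_sdge (peanoZ (- 1) (harmonic_peano i hh Uz)).
  by under eq_fun do rewrite mulN1r.
by rewrite -!mulr_sumr (sum_lap0 hh Uz) !mulr0.
Qed.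

(** With [H] the harmonic approximation of [f], [H + e] is an upper function and [H - e] lies below
    every upper function at the centre. *)
Lemma perron_upper_disc f r : continuous f -> 0 < r ->
  perron_upper (eball 0 r) f 0 = (avg (fun s => f (circ r s)))%:E.
Proof.
move=> cf r0; apply/eqP; rewrite eq_le; apply/andP; split.
  apply/lee_addgt0Pr => e e0.
  have [H [hH H0 Hf]] := harmonic_approx cf r0 e0.
  have hc z : {for z, continuous H} by exact: harmonic_continuous (re_hol_harmonic hH) I.
  have b0 : eball (0 : R2) r 0 by rewrite /eball/= -[X in X < _]/(nsq 0 (0 : R2)) nsq02 !mxE expr0n addr0 exprn_gt0.
  rewrite -H0 -EFinD; apply: (@perron_upper_le R 2 isT _ (bounded_eball r) (fun z => H z + e)) => //.
  - by move=> z _; apply: (@continuousD _ _ _ H (cst e)); [exact: hc|exact: cst_continuous].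
  - move=> z zr; have := sub_lapD_cst (- e) (harmonic_sub_lapN (re_hol_harmonic hH) (I : setT z)).
    by congr (sub_lap _ z); apply/funext => y; ring.
  - move=> z; rewrite bdry_eball// => zr; have := Hf z zr; rewrite ler_norml; lra.
apply: le_ereal_inf_tmp => _ [s sc <-]; apply/lee_addgt0Pr => e e0.
have e2 : 0 < e / 2 by rewrite divr_gt0.
have [H [hH H0 Hf]] := harmonic_approx cf r0 e2.
pose h z := H z + (- e).
have hh : harmonic_on setT h by exact: (re_hol_harmonic (re_holD hH (re_hol_cst (- e)))).
have := @harmonic_le_perron f h r (e / 2) s r0 e2 hh _ sc.
rewrite /h H0 EFinD EFinN leeBlDr//; apply.
by move=> z zr; have := Hf z zr; rewrite ler_norml /h; lra.
Qed.

Lemma measurable_circ r : measurable_fun [set: R] (circ r : R -> Rn_borel R 2).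
Proof.
apply: (@measurability _ _ R (Rn_borel R 2) _ _ (@open R2)) => // _ [B oB <-].
rewrite setTI; apply: open_measurable.
by apply: open_comp => // t _; exact: continuous_circ.
Qed.

Definition circ_measure r : {measure set (Rn_borel R 2) -> \bar R}.
Proof. unshelve refine (pushforward (@unif_angle R) (circ r : R -> Rn_borel R 2) : {measure set (Rn_borel R 2) -> \bar R}); exact: measurable_circ. Defined.

Lemma harmonic_measure_disc r : 0 < r -> harmonic_measure (eball 0 r) 0 (circ_measure r).
Proof.
move=> r0; split.
  rewrite bdry_eball// /circ_measure /= /pushforward.
  rewrite (_ : _ @^-1` _ = set0) ?measure0//.
  by apply/seteqP; split => // t /= h; apply: h; rewrite /esphere/= -[LHS]/(nsq 0 (circ r t)) nsq_circ.
move=> f cf; rewrite perron_upper_disc//.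
have bg := bcont_circ r cf.
rewrite integral_pushforward//.
- rewrite avgE /Rintegral fineK//; apply: integrable_fin_num => //; exact: bcont_integrable.
- exact: measurable_circ.
- by apply/measurable_EFinP; exact: continuous_borel.
- by rewrite preimage_setT; exact: bcont_integrable.
Qed.

End disc.

(** * The extremal pair *)

Section strip_map.
Context {R : realType}.
Local Notation R2 := 'rV[R]_2.
Implicit Types (f g a b c d : R2 -> R) (z : R2) (U : set R2).

Lemma is_derive_inv (x : R) : x != 0 -> is_derive x 1 (@GRing.inv R) (- x ^- 2).
Proof.
move=> x0; have h := is_deriveV x0 (is_derive_id x (1 : R)).
by apply: is_derive_eq; rewrite /GRing.scale/= mulr1.
Qed.

(* [h + i k = 1 / (f + i g)], with derivative [- (a + i b) (h + i k)^2]. *)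
Lemma crV U f g a b : cauchy_riemann U f g a b -> (forall z, U z -> f z ^+ 2 + g z ^+ 2 != 0) ->
  let h z := f z * (f z * f z + g z * g z)^-1 in
  let k z := - g z * (f z * f z + g z * g z)^-1 in
  cauchy_riemann U h k (fun z => - (a z * (h z * h z - k z * k z) - b z * (h z * k z + k z * h z)))
    (fun z => - (a z * (h z * k z + k z * h z) + b z * (h z * h z - k z * k z))).
Proof.
move=> H N0 h k z Uz; have [[df dg] f0 f1 g0 g1] := H z Uz.
have Nz := N0 z Uz; rewrite !expr2 in Nz.
have dff : differentiable (fun z => f z * f z) z by exact: differentiableM.
have dgg : differentiable (fun z => g z * g z) z by exact: differentiableM.
have dN : differentiable (fun z => f z * f z + g z * g z) z by exact: differentiableD.
have dg' : differentiable (fun z => - g z) z by exact: differentiableN.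
have pN i : partial i (fun z => - g z) z = - partial i g z.
  by apply: deriveN; exact: diff_derivable.
have dV : is_derive (f z * f z + g z * g z) 1 (@GRing.inv R) (- (f z * f z + g z * g z) ^- 2).
  exact: is_derive_inv.
have dI := (partial_comp 0 dN dV).1.
have pI i := (partial_comp i dN dV).2.
rewrite /= in pI dI.
split.
- by split; exact: differentiableM.
all: rewrite /h /k !partialM// ?pN !pI !partialD// !partialM// ?f0 ?f1 ?g0 ?g1;
  move: Nz; clear; move: (f z) (g z) (a z) (b z) => F G A B Nz; by field.
Qed.

(** Real and imaginary parts of [log((1 + z) / (1 - z))]; the argument is given by [atan] because
    [(1 + z) / (1 - z)] has positive real part on the disc. *)
Definition strip_re z : R := 2^-1 * (ln ((1 + z 0 0) * (1 + z 0 0) + z 0 1 * z 0 1) -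
  ln ((1 - z 0 0) * (1 - z 0 0) + z 0 1 * z 0 1)).
Definition strip_im z : R := atan (2 * z 0 1 * (1 - (z 0 0 * z 0 0 + z 0 1 * z 0 1))^-1).

Let U : set R2 := eball 0 1.

Lemma unit_discP z : U z -> z 0 0 * z 0 0 + z 0 1 * z 0 1 < 1.
Proof. by rewrite /U /eball/= -[X in X < _]/(nsq 0 z) nsq02 expr1n !expr2. Qed.

(** [f + i g = 1 - z^2]. Below, [h + i k] is its inverse, and [2 / (1 - z^2)] is the derivative of
    the logarithm. *)
Let f z := 1 + (- 1) * (z 0 0 * z 0 0 - z 0 1 * z 0 1).
Let g z := 0 + (- 1) * (z 0 0 * z 0 1 + z 0 1 * z 0 0).

(** The last equation is [|1 - z^2|^2 = |1 + z|^2 |1 - z|^2]. *)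
Lemma strip_den (x y : R) : x * x + y * y < 1 ->
  [/\ 0 < (1 + x) * (1 + x) + y * y, 0 < (1 - x) * (1 - x) + y * y, 0 < 1 - (x * x + y * y) &
  (1 + (- 1) * (x * x - y * y)) ^+ 2 + (0 + (- 1) * (x * y + y * x)) ^+ 2 =
    ((1 + x) * (1 + x) + y * y) * ((1 - x) * (1 - x) + y * y)].
Proof. by move=> h; split; [nra|nra|lra|ring]. Qed.

Lemma cr_one_sub_sqr : cauchy_riemann U f g (fun z => - 2 * z 0 0) (fun z => - 2 * z 0 1).
Proof.
have H := crD (cr_cst (U := U) 1 0) (crZ (- 1) 0 (crM (@cr_id R U) (@cr_id R U))).
move: H; congr cauchy_riemann; apply/funext => z; rewrite /f /g /=; ring.
Qed.

Let h z := f z * (f z * f z + g z * g z)^-1.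
Let k z := - g z * (f z * f z + g z * g z)^-1.

Lemma fg_neq0 z : U z -> f z ^+ 2 + g z ^+ 2 != 0.
Proof.
by move=> /unit_discP /strip_den[q1 q2 _ E]; rewrite /f /g E mulf_neq0 ?gt_eqF.
Qed.

Lemma cr_strip : cauchy_riemann U strip_re strip_im (fun z => 2 * h z) (fun z => 2 * k z).
Proof.
move=> z Uz; have := unit_discP Uz => zU; have [q1 q2 S0 E] := strip_den zU.
have dX : differentiable (fun z : R2 => z 0 0) z by exact: differentiable_coordinate.
have dY : differentiable (fun z : R2 => z 0 1) z by exact: differentiable_coordinate.
have pX i := @partial_coordinate R 2 i 0 z.
have pY i := @partial_coordinate R 2 i 1 z.
have dc (x : R) : differentiable (fun _ : R2 => x) z by exact: differentiable_cst.
have d1 : differentiable (fun z : R2 => 1 + z 0 0) z by exact: differentiableD.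
have d2 : differentiable (fun z : R2 => 1 - z 0 0) z by exact: differentiableB.
have d3 : differentiable (fun z : R2 => z 0 1 * z 0 1) z by exact: differentiableM.
have d4 : differentiable (fun z : R2 => z 0 0 * z 0 0) z by exact: differentiableM.
have d5 : differentiable (fun z : R2 => (1 + z 0 0) * (1 + z 0 0)) z by exact: differentiableM.
have d6 : differentiable (fun z : R2 => (1 - z 0 0) * (1 - z 0 0)) z by exact: differentiableM.
have d7 : differentiable (fun z : R2 => (1 + z 0 0) * (1 + z 0 0) + z 0 1 * z 0 1) z by exact: differentiableD.
have d8 : differentiable (fun z : R2 => (1 - z 0 0) * (1 - z 0 0) + z 0 1 * z 0 1) z by exact: differentiableD.
have d9 : differentiable (fun z : R2 => z 0 0 * z 0 0 + z 0 1 * z 0 1) z by exact: differentiableD.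
have d10 : differentiable (fun z : R2 => 1 - (z 0 0 * z 0 0 + z 0 1 * z 0 1)) z by exact: differentiableB.
have d11 : differentiable (fun z : R2 => 2 * z 0 1) z by exact: differentiableM.
have dV : is_derive (1 - (z 0 0 * z 0 0 + z 0 1 * z 0 1)) 1 (@GRing.inv R) (- (1 - (z 0 0 * z 0 0 + z 0 1 * z 0 1)) ^- 2).
  by apply: is_derive_inv; rewrite gt_eqF.
have L1 i := partial_comp i d7 (is_derive1_ln q1).
have L2 i := partial_comp i d8 (is_derive1_ln q2).
have L3 i := partial_comp i d10 dV.
have [e1 _] := L1 0; have [e2 _] := L2 0; have [e3 _] := L3 0.
have p1 i := (L1 i).2; have p2 i := (L2 i).2; have p3 i := (L3 i).2.
rewrite /= in e1 e2 e3 p1 p2 p3.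
have d12 : differentiable (fun z : R2 => 2 * z 0 1 * (1 - (z 0 0 * z 0 0 + z 0 1 * z 0 1))^-1) z by exact: differentiableM.
have L4 i := partial_comp i d12 (is_derive1_atan _).
have [e4 _] := L4 0; have p4 i := (L4 i).2; rewrite /= in e4 p4.
have d13 : differentiable (fun z : R2 => ln ((1 + z 0 0) * (1 + z 0 0) + z 0 1 * z 0 1) - ln ((1 - z 0 0) * (1 - z 0 0) + z 0 1 * z 0 1)) z by exact: differentiableB.
split; first by split => //; exact: differentiableM.
- rewrite /strip_re partialM// partial_cst partialB// p1 p2 !partialD// !partialM// partialB// partialD// !partial_cst !pX !pY /=.
  move: q1 q2 E; rewrite /h /k /f /g; clear; move: (z 0 0) (z 0 1) => x y q1 q2 E.
  by rewrite -!expr2 E; field; rewrite !gt_eqF.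
- rewrite /strip_re partialM// partial_cst partialB// p1 p2 !partialD// !partialM// partialB// partialD// !partial_cst !pX !pY /=.
  move: q1 q2 E; rewrite /h /k /f /g; clear; move: (z 0 0) (z 0 1) => x y q1 q2 E.
  by rewrite -!expr2 E; field; rewrite !gt_eqF.
- rewrite /strip_im p4 partialM// p3 partialM// partialB// partialD// !partialM// !partial_cst !pX !pY /=.
  move: q1 q2 S0 E; rewrite /h /k /f /g; clear; move: (z 0 0) (z 0 1) => x y q1 q2 S0 E.
  field; rewrite (gt_eqF S0) andbT (_ : _ + _ = ((1 + x) * (1 + x) + y * y) * ((1 - x) * (1 - x) + y * y)); last by ring.
  by rewrite mulf_neq0 ?gt_eqF.
- rewrite /strip_im p4 partialM// p3 partialM// partialB// partialD// !partialM// !partial_cst !pX !pY /=.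
  move: q1 q2 S0 E; rewrite /h /k /f /g; clear; move: (z 0 0) (z 0 1) => x y q1 q2 S0 E.
  field; rewrite (gt_eqF S0) andbT (_ : _ + _ = ((1 + x) * (1 + x) + y * y) * ((1 - x) * (1 - x) + y * y)); last by ring.
  by rewrite mulf_neq0 ?gt_eqF.
Qed.

Lemma strip_harmonic : harmonic_on U strip_re /\ harmonic_on U strip_im.
Proof.
have H1 := cr_one_sub_sqr.
have H2 : cauchy_riemann U h k _ _ := crV H1 fg_neq0.
have H3 := crZ 2 0 H2.
have H0 : cauchy_riemann U (fun z => - 2 * z 0 0) (fun z => - 2 * z 0 1) (cst (- 2)) (cst 0).
  by move: (crZ (- 2) 0 (@cr_id R U)); congr cauchy_riemann; apply/funext => z /=; ring.
(* The second derivative [4 z / (1 - z^2)^2] is itself holomorphic, hence continuous. *)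
have H4 := crZ (- 2) 0 (crM H0 (crM H2 H2)).
apply: (cr_harmonic (open_eball (c := 0) (r := 1)) cr_strip).
- move: H3; congr cauchy_riemann; apply/funext => z /=; ring.
- move=> z Uz; have [[dc dd] _ _ _ _] := H4 z Uz.
  have tr (q q' : R2 -> R) : differentiable q z -> q' =1 q -> {for z, continuous q'}.
    by move=> dq /funext ->; exact: differentiable_continuous.
  split; [apply: (tr _ _ dc)|apply: (tr _ _ dd)] => w; rewrite -/(h w) -/(k w) /=; ring.
Qed.

End strip_map.

Section sharpness.
Context {R : realType} (p : R) (hp : 1 <= p <= 2).
Local Notation R2 := 'rV[R]_2.
Notation P := (@unif_angle R).
Let D : set R2 := eball 0 1.

Lemma strip_im_bound z : `|strip_im z| < pi / 2 :> R.
Proof. by rewrite ltr_norml atan_gtNpi2 atan_ltpi2. Qed.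

Lemma strip_re0 : strip_re (0 : R2) = 0 :> R.
Proof. by rewrite /strip_re !mxE addr0 subr0 mulr1 subrr mulr0. Qed.

Lemma strip_im0 : strip_im (0 : R2) = 0 :> R.
Proof. by rewrite /strip_im !mxE mulr0 mul0r atan0. Qed.

Lemma disc_center (r : R) : 0 < r -> eball (0 : R2) r 0.
Proof.
by move=> r0; rewrite /eball/= -[X in X < _]/(nsq 0 (0 : R2)) nsq02 !mxE expr0n addr0 exprn_gt0.
Qed.

Lemma strip_grad z : D z -> grad_norm2 strip_im z = grad_norm2 strip_re z /\
  grad_dot (@strip_re R) strip_im z = 0.
Proof. by move=> Dz; exact: cr_grad (@cr_strip R) Dz. Qed.

Lemma strong_norm_strip : (strong_norm D 0 p (@strip_re R) <= (Wp p 0 0 `^ p^-1)%:E)%E.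
Proof.
have [hu hv] := @strip_harmonic R.
have p0 : 0 <= p^-1 by rewrite invr_ge0; move: hp => /andP[]; lra.
apply: ge_ereal_sup => _ [mu /= [U [[[oU _] [bU [U0 UD]]] hmu]] <-].
rewrite -poweR_EFin; apply: gt0_ler_poweR => //.
- by rewrite in_itv/= leey andbT; apply: integral_ge0 => x _; rewrite lee_fin powR_ge0.
- by rewrite in_itv/= leey andbT lee_fin; apply: ltW; exact: Wp_center_gt0.
have cu z : closure U z -> {for z, continuous (@strip_re R)}.
  by move=> zU; apply: (harmonic_continuous hu); exact: UD.
have cv z : closure U z -> {for z, continuous (@strip_im R)}.
  by move=> zU; apply: (harmonic_continuous hv); exact: UD.
have [u' [cu' uu _]] := compact_extension (closure_compact bU) (fun z zK => cu z (set_mem zK)).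
have mB : measurable (bdry U : set (Rn_borel R 2)) by apply: closed_borel; exact: bdry_closed.
apply: (@le_trans _ _ (\int[mu]_(x in (setT : set (Rn_borel R 2))) (`|u' x| `^ p)%:E)%E).
  apply: (le_integral_carried mB hmu.1) => x; rewrite ?lee_fin ?powR_ge0// => bx.
  by rewrite (uu x bx.1).
have -> : Wp p 0 0 = What p (strip_re (0 : R2)) (strip_im (0 : R2)).
  by rewrite /What strip_im_bound strip_re0 strip_im0.
have h := @integral_le_superharmonic R 2 isT U bU 0 mu U0 hmu
  (fun z => What p (strip_re z) (strip_im z)) (fun x => `|u' x| `^ p).
apply: h.
- by move=> x; apply: (powR_comp_continuous hp); exact: cu'.
- by move=> z zU; apply: What_comp_continuous => //; [apply: cu|apply: cv]; exact: set_mem.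
- move=> z Uz; have Dz : D z by apply: UD; exact: subset_closure.
  have [gE d0] := strip_grad Dz.
  have := @Wp_sub_lapN R 2 p hp D _ _ 1 hu hv z Dz gE d0.
  rewrite mul1r strip_im_bound => /(_ isT); congr (sub_lap _ z); apply/funext => y.
  by rewrite !mul1r /What strip_im_bound.
- by move=> z bz; rewrite (uu z bz.1); exact: What_ge.
Qed.

Lemma unif_itv (a b : R) : 0 <= a -> a <= b -> b <= 2 * pi ->
  P `[a, b] = ((b - a) / (2 * pi))%:E.
Proof.
move=> a0 ab bp; have mI : measurable (`[a, b]%classic : set R) by exact: measurable_itv.
have -> : P `[a, b] = (\int[P]_x (\1_(`[a, b]%classic) x)%:E)%E by rewrite integral_indic// setIT.
rewrite integral_uniform//; last by apply/measurable_EFinP; exact: measurable_indic.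
rewrite integral_indic// (setIidl (_ : `[a, b] `<=` `[0, 2 * pi])); last first.
  by move=> x /=; rewrite !in_itv/= => /andP[ax xb]; rewrite (le_trans a0 ax) (le_trans xb bp).
have L : @lebesgue_measure R `[a, b] = (b - a)%:E.
  rewrite lebesgue_measure_itv/= lte_fin; case: ltP => // ba.
  by rewrite (_ : b = a) ?subrr//; apply/eqP; rewrite eq_le ab ba.
transitivity (((2 * pi)^-1)%:E * (b - a)%:E)%E; last by rewrite -EFinM mulrC.
by congr (_ * _)%E; [rewrite subr0|exact: L].
Qed.

Lemma strip_im_circ (r t : R) : strip_im (circ r t) = atan (2 * (r * sin t) / (1 - r ^+ 2)).
Proof.
by rewrite /strip_im circ0 circ1 -!expr2 !exprMn -mulrDr cos2Dsin2 mulr1.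
Qed.

Lemma closure_disc_sub (r : R) : 0 < r < 1 -> closure (eball (0 : R2) r) `<=` D.
Proof.
move=> /andP[r0 r1] z /closure_eball zr; apply: le_lt_trans zr _.
by rewrite ltr_pXn2r ?nnegrE ?ltW.
Qed.

Lemma admissible_disc (r : R) : 0 < r < 1 -> admissible D 0 (eball 0 r).
Proof.
move=> r01; have r0 : 0 < r by case/andP: r01.
split; [exact: domain_eball|split; [exact: bounded_eball|split; [exact: disc_center|]]].
exact: closure_disc_sub.
Qed.

(* The part of the circle where [|sin t|] is at least [sin (pi e / 2)] has mass at least [1 - e];
   for [r] close to [1] the image of that part leaves [|y| < lam]. *)
Lemma weak_norm_strip (e : R) : 0 < e < 1 ->
  ((pi / 2 - pi * e)%:E <= weak_norm D 0 p (@strip_im R))%E.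
Proof.
move=> /andP[e0 e1]; have pi0 := pi_gt0 R.
have [p1 p2] : 1 <= p /\ p <= 2 by move: hp => /andP[].
(* As [e] tends to 0, [lam] tends to [pi/2] and [del] to 0; the level and the mass each lose the
   factor [1 - e]. *)
pose lam := pi / 2 * (1 - e); pose del := pi * e / 2.
have l0 : 0 < lam by rewrite mulr_gt0 ?divr_gt0// subr_gt0.
have lp : lam < pi / 2 by rewrite /lam gtr_pMr ?divr_gt0//; lra.
have d0 : 0 < del by rewrite divr_gt0// mulr_gt0.
have dp : del < pi / 2 by rewrite /del ltr_pM2r ?invr_gt0// gtr_pMr.
have T0 : 0 < tan lam.
  by rewrite /tan divr_gt0 ?sin_gt0_pihalf ?cos_gt0_pihalf ?l0 ?lp//; lra.
have s0 : 0 < sin del by apply: sin_gt0_pihalf; rewrite d0.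
(* Solves [r sin del / (1 - r) = tan lam]. As [2 / (1 + r) >= 1], the argument of [atan] below is
   then at least [tan lam]. *)
pose r := tan lam / (tan lam + sin del).
have TS : 0 < tan lam + sin del by exact: addr_gt0.
have r0 : 0 < r by rewrite divr_gt0.
have r1 : r < 1 by rewrite ltr_pdivrMr// mul1r ltrDl.
have rE : r * (tan lam + sin del) = tan lam by rewrite divfK ?gt_eqF.
have r2 : 0 < 1 - r ^+ 2 by rewrite subr_gt0 expr_lt1// ltW.
have key (s : R) : sin del <= s -> lam <= atan (2 * (r * s) / (1 - r ^+ 2)).
  move=> ss; rewrite -[X in X <= _]tanK; last by rewrite in_itv/= lp andbT; lra.
  apply: le_atan; rewrite ler_pdivlMr//.
  have : tan lam * (1 - r ^+ 2) <= tan lam * (2 * (1 - r)).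
    by rewrite ler_pM2l//; have := sqr_ge0 (1 - r); rewrite expr2; nra.
  have : r * sin del <= r * s by rewrite ler_pM2l.
  move: rE; rewrite mulrDr; move: (tan lam) (sin del) => T S; nra.
have adm : admissible D 0 (eball 0 r) by apply: admissible_disc; rewrite r0.
have hmu := harmonic_measure_disc r0.
have sin_mono (x : R) : del <= x <= pi - del -> sin del <= sin x.
  have mono (y w : R) : del <= y -> y <= w -> w <= pi / 2 -> sin y <= sin w.
    move=> dy yw wp; rewrite leNgt ltr_sin -?leNgt// in_itv/=; apply/andP; split; lra.
  move=> /andP[h1 h2]; have [xp|xp] := leP x (pi / 2); first exact: mono.
  have -> : sin x = sin (pi - x) by rewrite sinB sinpi cospi; ring.
  by apply: mono => //; lra.
pose B : set R := [set t | lam <= `|strip_im (circ r t)|].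
have HB : `[del, pi - del] `|` `[pi + del, 2 * pi - del] `<=` B.
  move=> t [] /=; rewrite in_itv/= => /andP[h1 h2]; rewrite /B/= strip_im_circ ler_normr.
    by apply/orP; left; apply: key; apply: sin_mono; rewrite h1.
  apply/orP; right; rewrite -atanN -mulNr -mulrN -mulrN; apply: key.
  have -> : - sin t = sin (t - pi) by rewrite sinB sinpi cospi; ring.
  by apply: sin_mono; apply/andP; split; lra.
have mB : measurable (B : set R).
  apply: closed_measurable; rewrite (_ : B = (fun t => `|strip_im (circ r t)|) @^-1` [set s | lam <= s])//.
  apply: closed_comp; last exact: closed_ge.
  move=> t _; apply: (@continuous_comp _ _ _ (fun t => strip_im (circ r t)) Num.norm); last exact: norm_continuous.
  apply: (@continuous_comp _ _ _ (circ r) (@strip_im R)); first exact: continuous_circ.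
  apply: (harmonic_continuous (@strip_harmonic R).2); apply: (@closure_disc_sub r); first by rewrite r0.
  suff [] : bdry (eball 0 r) (circ r t) by [].
  by rewrite bdry_eball// /esphere/= -[LHS]/(nsq 0 (circ r t)) nsq_circ.
have mass : ((1 - e)%:E <= P B)%E.
  pose A1 : set R := `[del, pi - del]%classic; pose A2 : set R := `[pi + del, 2 * pi - del]%classic.
  have m1 : measurable A1 by exact: measurable_itv.
  have m2 : measurable A2 by exact: measurable_itv.
  have mU : (P (A1 `|` A2) = P A1 + P A2)%E.
    apply: measureU => //.
    apply/seteqP; split => // t [] /=; rewrite /A1 /A2 /= !in_itv/= => /andP[_ h1] /andP[h2 _].
    by exfalso; lra.
  have E1 : P A1 = ((pi - del - del) / (2 * pi))%:E by apply: unif_itv; lra.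
  have E2 : P A2 = ((2 * pi - del - (pi + del)) / (2 * pi))%:E by apply: unif_itv; lra.
  have PB : (P (A1 `|` A2) <= P B)%E by apply: le_measure; rewrite ?inE//; exact: measurableU.
  apply: le_trans PB; rewrite mU E1 E2.
  (* The two arcs have total length [2 pi - 4 del], a proportion [1 - e] of the circle. *)
  rewrite -EFinD lee_fin /del le_eqVlt; apply/orP; left; apply/eqP.
  by move: (@pi R) pi0 => Q Q0; field; rewrite gt_eqF.
pose S : set (Rn_borel R 2) := [set x | bdry (eball 0 r) x /\ lam <= `|strip_im x|].
apply: (@le_trans _ _ (((lam `^ p)%:E * circ_measure r S) `^ p^-1)%E); last first.
  by apply: ereal_sup_ubound; exists (lam, (eball 0 r, circ_measure r)).
have -> : circ_measure r S = P B.
  rewrite /circ_measure /= /pushforward; congr (P _); apply/seteqP; split => t /=; first by case.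
  by move=> h; split => //; rewrite bdry_eball// /esphere/= -[LHS]/(nsq 0 (circ r t)) nsq_circ.
have pi1 : 0 <= p^-1 by rewrite invr_ge0; lra.
have e1' : 0 < 1 - e by lra.
apply: (@le_trans _ _ (((lam `^ p)%:E * (1 - e)%:E) `^ p^-1)%E); last first.
  apply: gt0_ler_poweR => //.
  - by rewrite in_itv/= leey andbT lee_fin mulr_ge0 ?powR_ge0// ltW.
  - by rewrite in_itv/= leey andbT mule_ge0 ?lee_fin ?powR_ge0.
  - by apply: lee_wpmul2l mass; rewrite lee_fin powR_ge0.
have pn0 : p != 0 by rewrite gt_eqF//; lra.
rewrite -EFinM poweR_EFin lee_fin powRM ?powR_ge0 ?(ltW e1')// -powRrM divff// (powRr1 (ltW l0)).
(* [(1 - e)^(1/p) >= 1 - e], and [lam (1 - e) = (pi/2) (1 - e)^2]. *)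
apply: (@le_trans _ _ (lam * (1 - e))).
  rewrite /lam -mulrA -expr2 -subr_ge0.
  rewrite (_ : _ - _ = pi / 2 * e ^+ 2); last by field.
  by rewrite mulr_ge0 ?sqr_ge0// divr_ge0// ltW.
rewrite ler_pM2l//; apply: ger1_powR; first by apply/andP; split; lra.
by rewrite invf_le1//; lra.
Qed.

Lemma sharp (c : R) : c < ((pi / 2) `^ p / Wp p 0 0) `^ p^-1 ->
  (c%:E * strong_norm D 0 p (@strip_re R) < weak_norm D 0 p (@strip_im R))%E.
Proof.
move=> cK; have pi0 := pi_gt0 R; have W0 := Wp_center_gt0 hp.
have p0 : 0 < p by move: hp => /andP[]; lra.
pose w := Wp p 0 0 `^ p^-1; have w0 : 0 < w by exact: powR_gt0.
have Kw : ((pi / 2) `^ p / Wp p 0 0) `^ p^-1 * w = pi / 2.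
  rewrite -powRM ?divr_ge0 ?powR_ge0 ?(ltW W0)// divfK ?gt_eqF// -powRrM divff ?gt_eqF// powRr1//.
  by rewrite divr_ge0// ltW.
have cw : c * w < pi / 2 by rewrite -Kw ltr_pM2r.
(* [c] may be negative, in which case 0 bounds the left-hand side. *)
pose m := Num.max 0 (c * w).
have m2 : m < pi / 2 by rewrite gt_max cw divr_gt0.
have s0 : (0 <= strong_norm D 0 p (@strip_re R))%E.
  apply: le_trans (ereal_sup_ubound _); last first.
    exists (circ_measure (1 / 2)) => //; exists (eball 0 (1 / 2)); split.
      by apply: admissible_disc; apply/andP; split; lra.
    by apply: harmonic_measure_disc; lra.
  exact: poweR_ge0.
have cs : (c%:E * strong_norm D 0 p (@strip_re R) <= m%:E)%E.
  have [c0|c0] := leP 0 c.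
    apply: (@le_trans _ _ (c%:E * w%:E)%E); first by apply: lee_wpmul2l strong_norm_strip; rewrite lee_fin.
    by rewrite -EFinM lee_fin le_max lexx orbT.
  apply: (@le_trans _ _ 0%E); last by rewrite lee_fin le_max lexx.
  by apply: mule_le0_ge0 => //; rewrite lee_fin ltW.
(* The second entry makes the loss [pi e] at most half of the gap [pi/2 - m]. *)
pose e := Num.min (1 / 2) ((pi / 2 - m) / (2 * pi)).
have e0 : 0 < e by rewrite lt_min divr_gt0//= divr_gt0 ?subr_gt0// mulr_gt0.
have e1 : e < 1 by apply: (@le_lt_trans _ _ (1 / 2)); [rewrite ge_min lexx|lra].
have e2 : pi * e < pi / 2 - m.
  have : e <= (pi / 2 - m) / (2 * pi) by rewrite ge_min lexx orbT.
  rewrite ler_pdivlMr ?mulr_gt0//; have : 0 < pi * e by exact: mulr_gt0.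
  lra.
have we : 0 < e < 1 by rewrite e0 e1.
apply: le_lt_trans cs (lt_le_trans _ (weak_norm_strip we)).
by rewrite lte_fin; lra.
Qed.

End sharpness.

(** * The constant *)

Section odd_squares.
Context {R : realType}.

Lemma is_derive_ge0_le (f f' : R -> R) (a b : R) : a <= b ->
  (forall x : R, is_derive x 1 f (f' x)) -> (forall x, a < x < b -> 0 <= f' x) -> f a <= f b.
Proof.
move=> ab df f'0; apply: (@ger0_derive1_ndecr R f a b) => //.
- by move=> x; rewrite in_itv/= => /f'0; rewrite derive1E; case: (df x) => _ ->.
- apply: continuous_subspaceT => x; apply: differentiable_continuous.
  by apply/derivable1_diffP; case: (df x).
Qed.

Lemma sin_le_id (x : R) : 0 <= x -> sin x <= x.
Proof.
move=> x0; have := @is_derive_ge0_le (fun t => t - sin t) (fun t => 1 - cos t) 0 x x0.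
rewrite sin0 !subr0 subr_ge0; apply => t; by rewrite ?subr_ge0 ?cos_le1//; apply: is_derive_eq; rewrite ?mulr1.
Qed.

Lemma mul_cos_le_sin (x : R) : 0 <= x < pi / 2 -> x * cos x <= sin x.
Proof.
move=> /andP[x0 xp].
have := @is_derive_ge0_le (fun t => sin t - t * cos t) (fun t => t * sin t) 0 x x0.
rewrite sin0 mul0r subrr subr_ge0; apply => t.
  by apply: is_derive_eq; rewrite /GRing.scale/=; ring.
move=> /andP[t0 tx]; apply: mulr_ge0; first exact: ltW.
by apply: sin_ge0_pi; have := pi_gt0 R; lra.
Qed.

(* Summing [1/sin(a/2)^2 + 1/cos(a/2)^2 = 4/sin(a)^2] over the odd multiples [a] of the mesh. *)
Lemma sum_invsin2 m : \sum_(0 <= k < 2 ^ m) (sin ((2 * k%:R + 1) * (pi / (4 * 2 ^+ m))) ^- 2)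
  = 2 * 4 ^+ m :> R.
Proof.
have pi0 := pi_gt0 R.
elim: m => [|m IH].
  rewrite big_nat1 !expr0 !mulr1 mulr0 add0r mul1r.
  have E := cos_mulr2n (pi / 4 : R); rewrite (_ : pi / 4 *+ 2 = pi / 2) ?cos_pihalf in E; last by field.
  have := cos2Dsin2 (pi / 4 : R); move: (sin _) (cos _) E => s c E1 E2.
  have -> : s ^+ 2 = 1 / 2 by lra.
  by field.
(* The second half of the range is run backwards, so that the angle [a/2] is paired with
   [pi/2 - a/2]. *)
have rev (F : nat -> R) : \sum_(0 <= k < 2 ^ m.+1) F k =
    \sum_(0 <= k < 2 ^ m) (F k + F (2 ^ m + (2 ^ m - k.+1))%N).
  rewrite expnS mul2n -addnn (@big_cat_nat _ _ _ (2 ^ m)) ?leq_addr//= big_split/=; congr (_ + _).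
  rewrite -{1}(add0n (2 ^ m)%N) big_addn addnK big_nat_rev/=.
  by apply: eq_big_nat => k _; congr F; lia.
rewrite rev [in RHS]exprS [RHS]mulrCA -IH mulr_sumr.
apply: eq_big_nat => k /andP[_ km].
set a := (2 * k%:R + 1) * (pi / (4 * 2 ^+ m)).
have m0 : 0 < 2 ^+ m :> R by rewrite exprn_gt0.
have n2 : (2 ^ m)%:R = 2 ^+ m :> R by rewrite natrX.
have kR : k%:R + 1 <= 2 ^+ m :> R by rewrite -n2 natr1 ler_nat.
have -> : (2 * k%:R + 1) * (pi / (4 * 2 ^+ m.+1)) = a / 2.
  rewrite /a exprS; move: (@pi R) m0 => P; move: (2 ^+ m : R) => N N0; by field; rewrite gt_eqF.
have -> : (2 * (2 ^ m + (2 ^ m - k.+1))%N%:R + 1) * (pi / (4 * 2 ^+ m.+1)) = pi / 2 - a / 2.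
  rewrite natrD natrB// n2 -natr1 /a exprS; move: (@pi R) m0 => P; move: (2 ^+ m : R) => N N0.
  by field; rewrite gt_eqF.
rewrite sinB sin_pihalf cos_pihalf mul0r subr0 mul1r.
have a0 : 0 < a by rewrite mulr_gt0 ?divr_gt0 ?mulr_gt0//; have := ler0n R k; lra.
have ap : a < pi / 2.
  rewrite /a mulrA ltr_pdivrMr ?mulr_gt0//.
  rewrite (_ : pi / 2 * (4 * 2 ^+ m) = 2 * 2 ^+ m * pi); last by field.
  by rewrite ltr_pM2r//; lra.
have s0 : 0 < sin (a / 2) by apply: sin_gt0_pi; lra.
have c0 : 0 < cos (a / 2) by apply: cos_gt0_pihalf; lra.
rewrite [in RHS](_ : a = a / 2 + a / 2); last by field.
rewrite sinD; have := cos2Dsin2 (a / 2); move: (sin _) (cos _) s0 c0 => s c s0 c0 E.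
rewrite (_ : s * c + c * s = 2 * (s * c)); last by ring.
have s0' : s != 0 by rewrite gt_eqF.
have c0' : c != 0 by rewrite gt_eqF.
rewrite !exprMn (_ : 2 ^+ 2 = 4 :> R); last by ring.
have -> : s ^- 2 + c ^- 2 = (c ^+ 2 + s ^+ 2) / (s ^+ 2 * c ^+ 2) by field; rewrite s0' c0'.
by rewrite E; field; rewrite s0' c0'.
Qed.

Let a (k : nat) : R := k.*2.+1%:R ^- 2.

(** [1/sin(x)^2 - 1 <= 1/x^2 <= 1/sin(x)^2] on [(0, pi/2)], summed over odd multiples [x] of [th]:
    each of the [2^m] terms loses at most 1, that is [th^2] after rescaling. *)
Lemma sum_odd_sqr m :
  pi ^+ 2 / 8 - pi ^+ 2 / 16 / 2 ^+ m <= series a (2 ^ m)%N <= pi ^+ 2 / 8.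
Proof.
have pi0 := pi_gt0 R.
have m0 : 0 < 2 ^+ m :> R by rewrite exprn_gt0.
have n2 : (2 ^ m)%:R = 2 ^+ m :> R by rewrite natrX.
have m4 : 4 ^+ m = 2 ^+ m * 2 ^+ m :> R.
  by rewrite -exprMn; congr (_ ^+ _); ring.
pose th : R := pi / (4 * 2 ^+ m).
have th0 : 0 < th by rewrite /th divr_gt0 ?mulr_gt0.
have bd k : (k < 2 ^ m)%N -> sin ((2 * k%:R + 1) * th) ^- 2 - 1 <= th ^- 2 * a k <= sin ((2 * k%:R + 1) * th) ^- 2.
  move=> km; have kR : k%:R + 1 <= 2 ^+ m :> R by rewrite -n2 natr1 ler_nat.
  set x := (2 * k%:R + 1) * th.
  have k0 := ler0n R k.
  have x0 : 0 < x by rewrite mulr_gt0//; lra.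
  have xp : x < pi / 2.
    rewrite /x /th mulrA ltr_pdivrMr ?mulr_gt0//.
    rewrite (_ : pi / 2 * (4 * 2 ^+ m) = 2 * 2 ^+ m * pi); last by field.
    by rewrite ltr_pM2r//; lra.
  have -> : th ^- 2 * a k = x ^- 2.
    rewrite /a (_ : k.*2.+1%:R = 2 * k%:R + 1 :> R); last by rewrite -natr1 -mul2n natrM.
    by rewrite [in RHS]/x [in RHS]exprMn [RHS]invfM [LHS]mulrC.
  have s0 : 0 < sin x by apply: sin_gt0_pi; lra.
  have h1 := sin_le_id (ltW x0); have h2 := @mul_cos_le_sin x.
  have c0 : 0 < cos x by apply: cos_gt0_pihalf; lra.
  have sx : sin x ^+ 2 <= x ^+ 2 by rewrite ler_sqr// nnegrE ltW.
  have h3 : x ^+ 2 * cos x ^+ 2 <= sin x ^+ 2.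
    have sc : x * cos x <= sin x by apply: h2; rewrite xp andbT; exact: ltW.
    by rewrite -exprMn ler_sqr// ?nnegrE ?mulr_ge0 ?ltW.
  rewrite lef_pV2 ?posrE ?exprn_gt0// sx andbT.
  have -> : sin x ^- 2 - 1 = cos x ^+ 2 / sin x ^+ 2.
    by rewrite -[1](divff (_ : sin x ^+ 2 != 0)) ?expf_neq0 ?gt_eqF// -[X in X - _]mul1r -mulrBl -(cos2Dsin2 x) addrK.
  by rewrite ler_pdivrMr ?exprn_gt0// mulrC ler_pdivlMr ?exprn_gt0// mulrC.
have E := sum_invsin2 m; rewrite -/th in E.
have up : th ^- 2 * series a (2 ^ m)%N <= 2 * 4 ^+ m.
  rewrite -E /series /= mulr_sumr; apply: ler_sum_nat => k /andP[_ /bd /andP[]//].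
have lo : 2 * 4 ^+ m - 2 ^+ m <= th ^- 2 * series a (2 ^ m)%N.
  rewrite -E -n2 /series /= mulr_sumr.
  have -> : (2 ^ m)%N%:R = \sum_(0 <= k < 2 ^ m) (1 : R) by rewrite sumr_const_nat subn0.
  rewrite -sumrB.
  by apply: ler_sum_nat => k /andP[_ /bd /andP[]//].
have t2 : 0 < th ^+ 2 by rewrite exprn_gt0.
rewrite ler_pdivrMl// in up; rewrite ler_pdivlMl// in lo.
have tE : th ^+ 2 = pi ^+ 2 / 16 / (2 ^+ m * 2 ^+ m).
  rewrite /th; move: (@pi R) (2 ^+ m : R) m0 => P N N0; by field; rewrite gt_eqF.
rewrite tE m4 in up lo; move: (series a _) up lo => S up lo.
apply/andP; split.
  apply: le_trans lo; rewrite le_eqVlt; apply/orP; left; apply/eqP.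
  by move: (@pi R) (2 ^+ m : R) m0 => P N N0; field; rewrite gt_eqF.
apply: le_trans up _; rewrite le_eqVlt; apply/orP; left; apply/eqP.
by move: (@pi R) (2 ^+ m : R) m0 => P N N0; field; rewrite gt_eqF.
Qed.

(** The partial sums increase, so the dyadic ones determine the limit. *)
Lemma lim_odd_sqr : limn (series a) = pi ^+ 2 / 8.
Proof.
have pi0 := pi_gt0 R.
apply/cvg_lim; first exact: Rhausdorff.
have nd : {homo series a : m n / (m <= n)%N >-> m <= n}.
  by apply: nondecreasing_series => k _ _; rewrite invr_ge0 exprn_ge0.
apply/cvgrPdist_le => e e0.
have P0 : 0 <= pi ^+ 2 / 16 / e by rewrite !divr_ge0 ?sqr_ge0 ?ltW.
pose m := (Num.trunc (pi ^+ 2 / 16 / e)).+1.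
have em : pi ^+ 2 / 16 / 2 ^+ m <= e.
  rewrite ler_pdivrMr ?exprn_gt0// -ler_pdivrMl// [X in X <= _]mulrC.
  apply/ltW/(lt_le_trans (truncnS_gt _)).
  by rewrite -natrX ler_nat ltnW// ltn_expl.
exists (2 ^ m)%N => // n /= mn.
have /andP[h1 _] := sum_odd_sqr m; have /andP[_ h2] := sum_odd_sqr n.
have h3 := nd _ _ mn; have h4 := nd n (2 ^ n)%N (ltnW (ltn_expl n (ltnSn 1))).
rewrite ler_norml; move: (series a n) (series a (2 ^ m)%N) (series a (2 ^ n)%N) h1 h2 h3 h4 => s1 s2 s3; move: (pi ^+ 2 / 8) (pi ^+ 2 / 16 / 2 ^+ m) em => P Q; lra.
Qed.

End odd_squares.

(** * Gamma integrals and the alternating series *)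

Section gamma_series.
Context {R : realType} (p : R) (hp : 1 <= p <= 2).
Notation mu := (@lebesgue_measure R).
Let wp := wadm_powR hp.

Lemma lint_scale (c : R) (f : R -> R) : 0 < c -> continuous f -> (forall x, 0 <= f x) ->
  lint (fun x => f (c * x) * c) = lint f.
Proof.
move=> c0 cf f0.
have D : ((fun x : R => c * x)^`() = cst c)%classic.
  by apply/funext => x; rewrite derive1E deriveM// derive_id derive_cst scaler0 addr0 /GRing.scale/= mulr1.
rewrite !lintE /Rintegral; congr fine.
rewrite [RHS](@increasing_ge0_integration_by_substitutionT R (fun x => c * x))//.
- by apply: eq_integral => x _; rewrite fctE D.
- by move=> x y xy; rewrite ltr_pM2l.
- by rewrite D => x; exact: cst_continuous.
- by rewrite D; exact: is_cvg_cst.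
- by rewrite D; exact: is_cvg_cst.
- exact: gt0_cvgMrNy.
- exact: gt0_cvgMry.
Qed.

(** Taken over the whole line, so the value is [2 Gamma(p + 1) / c^(p + 1)]. *)
Definition gammal (c : R) : R := lint (fun u => `|u| `^ p * expR (- (c * `|u|))).

Lemma continuous_expN (c : R) : continuous (fun u : R => expR (- (c * `|u|))).
Proof.
move=> u; apply: (@continuous_comp _ _ _ (fun u : R => - (c * `|u|)) expR); last exact: continuous_expR.
apply: (@continuousN _ _ _ (fun u : R => c * `|u|)).
by apply: (@continuousM _ _ (cst c) Num.norm); [exact: cst_continuous|exact: norm_continuous].
Qed.

Lemma cosh_abs (u : R) : cosh u = (expR `|u| + expR (- `|u|)) / 2.
Proof. by rewrite coshE; case: (ger0P u) => // _; rewrite opprK addrC. Qed.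

(** The closed form of the geometric series for [1 / cosh u] in powers of [exp(-2 |u|)]. *)
Lemma coshV_exp (u : R) : (cosh u)^-1 * (1 + expR (- (2 * `|u|))) = 2 * expR (- `|u|).
Proof.
rewrite cosh_abs (_ : - (2 * `|u|) = - `|u| + - `|u|); last by ring.
rewrite expRD expRN; have := expR_gt0 `|u|; move: (expR _) => e e0.
have e1 : e != 0 by rewrite gt_eqF.
have e2 : e * e + 1 != 0 by rewrite gt_eqF// ltr_wpDl ?mulr_ge0 ?ltW.
by field; rewrite e1.
Qed.

Lemma expN_le_coshV (u : R) : expR (- `|u|) <= (cosh u)^-1 <= 2 * expR (- `|u|).
Proof.
rewrite -coshV_exp; have c0 : 0 < (cosh u)^-1 by rewrite invr_gt0 cosh_gt0.
apply/andP; split; last by rewrite ler_peMr ?(ltW c0)// lerDl expR_ge0.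
have : expR (- (2 * `|u|)) <= 1 by rewrite -expR0 ler_expR oppr_le0 mulr_ge0.
by have := coshV_exp u; move: (expR (- (2 * _))) => e; nra.
Qed.

Lemma decay_expN (c : R) : 1 <= c -> decay (fun u => expR (- (c * `|u|))).
Proof.
move=> c1; split; first exact: continuous_expN.
exists 1 => u; rewrite mul1r ger0_norm ?expR_ge0//.
have /andP[h _] := expN_le_coshV u; apply: le_trans h.
by rewrite ler_expR lerN2 ler_peMl.
Qed.

Lemma adm_gammal (c : R) : 1 <= c -> adm (fun u => `|u| `^ p * expR (- (c * `|u|))).
Proof.
move=> c1; have := adm_wdecay 0 wp (decay_expN c1).
by under eq_fun do rewrite addr0.
Qed.

Lemma gammalZ (c : R) : 1 <= c -> gammal c = c `^ (- (p + 1)) * gammal 1.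
Proof.
move=> c1; have c0 : 0 < c by lra.
rewrite /gammal -[in RHS](lint_scale c0).
- rewrite -lintZ.
    apply: eq_lint => u; rewrite mul1r normrM (gtr0_norm c0) powRM ?(ltW c0)//.
    have E : c `^ (- (p + 1)) * c `^ p * c = 1.
      rewrite -powRD; last by rewrite (gt_eqF c0) implybT.
      rewrite -[X in _ * X]powRr1 ?(ltW c0)// -powRD; last by rewrite (gt_eqF c0) implybT.
      by rewrite (_ : _ + _ + _ = 0) ?powRr0//; ring.
    move: E; move: (c `^ (- (p + 1))) (c `^ p) (`|u| `^ p) (expR _) => x y z t E.
    transitivity ((x * y * c) * (z * t)); first by rewrite E mul1r.
    by ring.
  have := adm_gammal (lexx 1) => [[cf [M fM]]]; split.
    move=> x; apply: (@continuousM _ _ (fun x => `|c * x| `^ p * expR (- (1 * `|c * x|))) (cst c)); last exact: cst_continuous.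
    apply: (@continuous_comp _ _ _ (fun x => c * x) (fun u => `|u| `^ p * expR (- (1 * `|u|)))); last exact: cf.
    by apply: (@continuousM _ _ (cst c) id); [exact: cst_continuous|].
  have M0 : 0 <= M.
    by have := le_trans (normr_ge0 _) (fM 0); rewrite pmulr_lge0// ew_gt0.
  exists (M * c) => s; rewrite normrM (gtr0_norm c0) mulrAC; apply: ler_wpM2r; first exact: ltW.
  apply: le_trans (fM _) _; apply: ler_wpM2l => //; rewrite /ew ler_expR normrM (gtr0_norm c0).
  have : 1 * `|s| <= c * `|s| by rewrite ler_wpM2r.
  lra.
- exact: (adm_gammal (lexx 1)).1.
- by move=> x; rewrite mulr_ge0 ?powR_ge0 ?expR_ge0.
Qed.

Lemma gammal1 : gammal 1 = 2 * Gamma (p + 1).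
Proof.
have f2 (x : \bar R) : fine (2%:E * x)%E = 2 * fine x.
  by case: x => [r| |]; rewrite ?gt0_muley ?gt0_muleNy ?lte_fin// mulr0.
rewrite /gammal /Gamma lintE /Rintegral ge0_symfun_integralT.
- rewrite -set_itvcy.
  have -> : (\int[mu]_(x in `[0%R, +oo[) (`|x| `^ p * expR (- (1 * `|x|)))%:E =
     \int[mu]_(t in `[0%R, +oo[) (t `^ (p + 1 - 1) * expR (- t))%:E)%E.
    apply: eq_integral => x; rewrite inE/= in_itv/= andbT => x0.
    by rewrite mul1r ger0_norm// addrK.
  exact: f2.
- by move=> x; rewrite mulr_ge0 ?powR_ge0 ?expR_ge0.
- exact: (adm_gammal (lexx 1)).1.
- by move=> x; rewrite /= normrN.
Qed.

(** Up to sign, the remainder after [n] terms when the geometric series of [1 / cosh] is integrated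
    against [|u|^p]; [r 0] is [pi] times [Wp p 0 0]. *)
Let r (n : nat) : R := lint (fun u => `|u| `^ p * (expR (- (n.*2%:R * `|u|)) / cosh u)).

Lemma adm_sech n : adm (fun u => `|u| `^ p * (expR (- (n.*2%:R * `|u|)) / cosh u)).
Proof.
have [cs _] := @decay_coshV R.
have d : decay (fun u : R => expR (- (n.*2%:R * `|u|)) / cosh u).
  split.
    by move=> u; apply: (@continuousM _ _ (fun u : R => expR (- (n.*2%:R * `|u|))) (fun u => (cosh u)^-1)); [exact: continuous_expN|exact: cs].
  exists 1 => u; rewrite ger0_norm; last by rewrite divr_ge0 ?expR_ge0// ltW ?cosh_gt0.
  rewrite ler_pM2r ?invr_gt0 ?cosh_gt0// -expR0 ler_expR oppr_le0 mulr_ge0 ?ler0n//.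
have := adm_wdecay 0 wp d; by under eq_fun do rewrite addr0.
Qed.

Lemma sech_step n : r n + r n.+1 = 2 * gammal n.*2.+1%:R.
Proof.
rewrite /r -lintD; [|exact: adm_sech|exact: adm_sech].
rewrite /gammal -lintZ; last by apply: adm_gammal; rewrite ler1n.
apply: eq_lint => u; rewrite -mulrDr mulrCA; congr (_ * _).
have -> : - (n.+1.*2%:R * `|u|) = - (n.*2%:R * `|u|) + - (2 * `|u|).
  by rewrite doubleS -addn2 natrD; ring.
have -> : - (n.*2.+1%:R * `|u|) = - (n.*2%:R * `|u|) + - `|u|.
  by rewrite -natr1; ring.
rewrite !expRD; have := coshV_exp u; move: (expR _) (expR _) (expR _) (cosh u)^-1 => a b c d E.
by rewrite mulrCA -E; ring.
Qed.

Lemma sech_ge0 n : 0 <= r n.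
Proof.
by apply: lint_ge0 => u; rewrite mulr_ge0 ?divr_ge0 ?powR_ge0 ?expR_ge0 ?ltW ?cosh_gt0.
Qed.

Let b (k : nat) : R := (-1) ^+ k * k.*2.+1%:R `^ (- (p + 1)).

(** Unrolling [sech_step] gives a finite identity with an explicit remainder, in place of an
    interchange of sum and integral. *)
Lemma sech_series n : r 0 = 2 * gammal 1 * series b n + (-1) ^+ n * r n.
Proof.
elim: n => [|n IH]; first by rewrite /series /= big_geq// mulr0 add0r mul1r.
rewrite IH /series /= big_nat_recr//= mulrDr -addrA; congr (_ + _).
have := sech_step n; rewrite gammalZ ?ler1n// /b exprS.
move: (_ `^ _) (gammal 1) (r n) (r n.+1) ((-1) ^+ n) => x y z t s E.
have -> : z = 2 * (x * y) - t by lra.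
by ring.
Qed.

(** By [sech_step] and positivity each remainder is at most a single Gamma term, which tends to
    0. *)
Lemma lim_sech_series : r 0 = 2 * gammal 1 * limn (series b).
Proof.
have g0 : 0 <= gammal 1 by apply: lint_ge0 => u; rewrite mulr_ge0 ?powR_ge0 ?expR_ge0.
have rle n : r n <= 2 * gammal 1 * harmonic n.
  have := sech_step n; have := sech_ge0 n.+1; rewrite gammalZ ?ler1n//.
  have : n.*2.+1%:R `^ (- (p + 1)) <= harmonic n :> R.
    rewrite powRN /harmonic /= lef_pV2 ?posrE ?ltr0n ?powR_gt0//.
    apply: (@le_trans _ _ (n.*2.+1%:R : R)); first by rewrite ler_nat; lia.
    by rewrite -[leLHS]powRr1//; apply: ler_powR; rewrite ?ler1n//; move: hp => /andP[]; lra.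
  move: (_ `^ _) (harmonic n) => x h xh; nra.
(* Keeps the later division legitimate; in this case [r 0] vanishes as well. *)
have [g00|g00] := eqVneq (gammal 1) 0.
  by rewrite (sech_series 0) /series /= big_geq// mulr0 add0r mul1r g00 mulr0 mul0r;
     apply/eqP; rewrite eq_le sech_ge0 andbT; have := rle 0; rewrite g00 mulr0 mul0r.
have g2 : 2 * gammal 1 != 0 by rewrite mulf_neq0.
suff : series b @ \oo --> r 0 / (2 * gammal 1).
  by move=> /cvg_lim -> //; rewrite mulrC divfK.
apply/cvgrPdist_le => e e0.
have /cvgrPdist_le/(_ e e0) := @cvg_harmonic R.
apply: filterS => n; rewrite sub0r normrN => h.
rewrite (sech_series n) mulrDl [2 * _ * _]mulrC mulfK// addrAC subrr add0r normrM normrM normrX normrN1 expr1n mul1r.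
rewrite normfV (ger0_norm (sech_ge0 n)) ger0_norm ?mulr_ge0// ler_pdivrMr ?lt_def ?g2 ?mulr_ge0//.
apply: le_trans (rle n) _; rewrite mulrC ler_wpM2r ?mulr_ge0//.
by apply: le_trans h; exact: ler_norm.
Qed.

Lemma Kp_powE : Kp_pow p = (pi / 2) `^ p / Wp p 0 0.
Proof.
have pi0 := pi_gt0 R.
have E : Wp p 0 0 = pi^-1 * r 0.
  rewrite /Wp /W /r -lintZ; last exact: adm_sech.
  apply: eq_lint => u; rewrite addr0 kap.unlock [RHS]mulrCA; congr (_ * _).
  rewrite mul0r oppr0 expR0 mul1r cos0 mulr1 expr1n [_ + 1]addrC -cosh2.
  have := cosh_gt0 u; move: (cosh u) (@pi R) pi0 => c P P0 c0.
  by field; rewrite !gt_eqF.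
rewrite E lim_sech_series gammal1 /Kp_pow lim_odd_sqr.
have aux (P : R) : 0 < P -> P `^ p = P `^ (p - 1) * P.
  by move=> P0; rewrite -[X in _ = _ * X]powRr1 ?(ltW P0)// -powRD ?subrK// (gt_eqF P0) implybT.
(* [P] is [pi], [G] the Gamma value and [L] the alternating series; [P^2 / 8] is the sum of the
   inverse odd squares. *)
have key (a G L P : R) : G^-1 * a * (P ^+ 2 / 8 / L) = a * (P / 2) / (P^-1 * (2 * (2 * G) * L)).
  by rewrite !invfM !invrK; move: G^-1 L^-1 => g l; field.
by rewrite (aux _ (divr_gt0 pi0 _))//; exact: key.
Qed.

End gamma_series.

Theorem theorem8p2 (R : realType) (p : R) (hp1 : 1 <= p) (hp2 : p <= 2) :
  (forall (n : nat) (D : set 'rV[R]_n) (xi : 'rV[R]_n) (u v : 'rV[R]_n -> R),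
      (0 < n)%N ->
      open D -> connected D -> D xi ->
      harmonic_on D u -> harmonic_on D v ->
      (* v is differentially subordinate to u *)
      `|v xi| <= `|u xi| ->
      (forall x, D x -> grad_norm2 v x <= grad_norm2 u x) ->
      (* u and v are orthogonal *)
      (forall x, D x -> grad_dot u v x = 0) ->
      (weak_norm D xi p v <= (Kp p)%:E * strong_norm D xi p u)%E)
  /\
  (* sharpness *)
  (forall c : R, c < Kp p ->
    exists (n : nat) (D : set 'rV[R]_n) (xi : 'rV[R]_n) (u v : 'rV[R]_n -> R),
      [/\ (0 < n)%N, open D, connected D & D xi] /\
      [/\ harmonic_on D u, harmonic_on D v,
          `|v xi| <= `|u xi|,
          (forall x, D x -> grad_norm2 v x <= grad_norm2 u x) &
          (forall x, D x -> grad_dot u v x = 0)] /\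
      (c%:E * strong_norm D xi p u < weak_norm D xi p v)%E).
Proof.
have hp : 1 <= p <= 2 by rewrite hp1.
have KE : Kp p = ((pi / 2) `^ p / Wp p 0 0) `^ p^-1 by rewrite /Kp Kp_powE.
rewrite KE; split=> [n D xi u v n0 _ _ Dxi hu hv sub0 sub dot|c cK].
  exact: weak_norm_le.
have [dO [dC _]] := domain_eball (@ltr01 R).
exists 2, (eball 0 1), 0, strip_re, strip_im; split; last split.
- by split => //; exact: disc_center.
- have [hu hv] := @strip_harmonic R; split; [exact: hu|exact: hv| | |].
  + by rewrite strip_re0 strip_im0.
  + by move=> x /strip_grad[-> _]; exact: lexx.
  + by move=> x /strip_grad[].
- exact: sharp.
Qed.
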